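(* Let $g>1$. Then $$F_g(q_1,\dots,q_{3g-3})=\sum_{\underline a}N_{\underline a,g}^{\operatorname{trop}}\,q^{2\cdot\underline a}=\sum_\Gamma I_\Gamma(q_1,\dots,q_{3g-3}),$$ where $\underline a$ runs over all tuples in $\mathbb{N}^{3g-3}$ (with $0\in\mathbb{N}$) and $\Gamma$ over all Feynman graphs of genus $g$ (each isomorphism class of trivalent connected graphs of genus $g$ taken once, with its fixed reference labeling). More precisely, for every Feynman graph $\Gamma$ of genus $g$ and every $\underline a$, the coefficient of the monomial $q^{2\cdot\underline a}$ in $I_\Gamma(q_1,\dots,q_{3g-3})$ equals $N_{\underline a,\Gamma}^{\operatorname{trop}}$.
   Context: **Feynman graphs.** A Feynman graph $\Gamma$ of genus $g$ is a trivalent connected graph (multiple edges and loops allowed) with first Betti number $g$, equipped with a fixed reference labeling $x_1,\dots,x_{2g-2}$ of its vertices and $q_1,\dots,q_{3g-3}$ of its edges. **Tropical covers.** A tropical curve $C$ is a connected, finite, trivalent metric graph; its genus is its first Betti number, its combinatorial type the underlying graph without lengths. A tropical elliptic curve $E$ is a circle of fixed length. A map $\pi:C\to E$ is a tropical cover if it is continuous, non-constant, integer affine on each edge, and balanced at every vertex $P$ of $C$: writing $w_e$ (weight of $e$) for the absolute value of the slope of $\pi_{|e}$, and letting $r_1,r_2$ be the two rays of a small neighbourhood $U$ of $\pi(P)$, among the three rays $R$ adjacent to $P$ in the component of $\pi^{-1}(U)$ containing $P$ one has $\sum_{R\mapsto r_1}w_R=\sum_{R\mapsto r_2}w_R$.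 The degree of $\pi$ is the number of preimages of a point $p\in E$ not having a vertex as preimage, each counted with the weight of the edge containing it. The branch points of $\pi$ are the images of the vertices of $C$. **Labeled covers.** A labeled tropical cover $\hat\pi:C\to E$ of type $\Gamma$ is a tropical cover together with a labeling of the vertices and edges of $C$ by the $x_i$ and $q_k$ such that the labeled underlying graph of $C$ is $\Gamma$ with its reference labeling. Isomorphisms of labeled covers are isometries of the source curves commuting with the maps to $E$ and respecting all labels; labeled covers are considered up to isomorphism. **Counts.** Fix pairwise distinct points $p_0,p_1,\dots,p_{2g-2}\in E$. For $\underline a=(a_1,\dots,a_{3g-3})$, $N_{\underline a,\Gamma}^{\operatorname{trop}}$ is the number of labeled tropical covers $\hat\pi:C\to E$ of type $\Gamma$ and degree $\sum_i a_i$, having their branch points exactly at $p_1,\dots,p_{2g-2}$ and satisfying $\#(\hat\pi^{-1}(p_0)\cap q_i)\cdot w_i=a_i$ for all $i$, each counted with multiplicity $\prod_{i=1}^{3g-3}w_i$, where $w_i$ is the weight of the edge $q_i$. $N_{\underline a,g}^{\operatorname{trop}}$ is the same weighted count over all source curves of genus $g$ (i.e. over all types $\Gamma$). $F_g(q_1,\dots,q_{3g-3}):=\sum_{\underline a\in\mathbb{N}^{3g-3}}N_{\underline a,g}^{\operatorname{trop}}q^{2\cdot\underline a}$ with $q^{2\cdot\underline a}=q_1^{2a_1}\cdots q_{3g-3}^{2a_{3g-3}}$. **Refined Feynman integrals.** The propagator is $P(z,q):=\frac{1}{4\pi^2}\wp(z,q)+\frac1{12}E_2(q^2)$, where $q=e^{i\pi\tau}$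 with $\tau$ in the upper half plane, $\wp(z,q)$ is the Weierstrass $\wp$-function of the lattice $\mathbb{Z}+\mathbb{Z}\tau$, and $E_2(q)=1-24\sum_{d\ge1}\sigma(d)q^d$, $\sigma(d)=\sum_{m\mid d}m$. For an edge $q_k$ of $\Gamma$ connecting $x_i$ and $x_j$ put $P_k:=P(z_i-z_j,q_k)$ (the sign of $z_i-z_j$ is irrelevant), with independent variables $q_1,\dots,q_{3g-3}$, $q_k=e^{i\pi\tau_k}$. For a total ordering $\Omega$ of the vertices choose pairwise different small real numbers $y_1,\dots,y_{2g-2}$ whose order equals $\Omega$, and paths $\gamma_j:[0,1]\to\mathbb{C}$, $t\mapsto iy_j+t$ (small means $|y_i-y_j|<\operatorname{Im}\tau_k$ for all $i,j,k$). Set $$I_{\Gamma,\Omega}(q_1,\dots,q_{3g-3}):=\int_{z_j\in\gamma_j}\prod_{k=1}^{3g-3}(-P_k)\,dz_1\cdots dz_{2g-2},\qquad I_\Gamma:=\sum_\Omega I_{\Gamma,\Omega},$$ the sum over all $(2g-2)!$ orders, regarded as power series in the $q_k$. If $\Gamma$ has an edge which is a loop (so the integrand is not defined), set $I_{\Gamma,\Omega}=0$. *)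

(* Defs.v *)
From HB Require Import structures.
From mathcomp Require Import all_boot all_order all_fingroup all_algebra.
From mathcomp Require Import finmap complex.
From mathcomp Require Import all_classical all_reals all_analysis.
From mathcomp.analysis.showcase Require Import summability.

Set Implicit Arguments.
Unset Strict Implicit.
Unset Printing Implicit Defensive.
Import Order.TTheory GRing.Theory Num.Theory.
Import numFieldNormedType.Exports.
Local Open Scope complex_scope.
Local Open Scope classical_set_scope.
Local Open Scope ring_scope.

(** * Multigraphs *)

(* Each edge is stored with an ordered pair of end points. The order is only
   used to parametrize the edge; all the notions below are insensitive to it. *)
Definition multigraph (V E : finType) : finType := {ffun E -> V * V}.

(* A half-edge [(e, b)] is the end of [e] at its first ([b = false]) or second
   ([b = true]) end point, so that a loop contributes two half-edges. *)
Definition half_base (V E : finType) (G : multigraph V E) (h : E * bool) : V :=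
  if h.2 then (G h.1).2 else (G h.1).1.

Definition trivalent (V E : finType) (G : multigraph V E) : bool :=
  [forall v, #|[set h | half_base G h == v]| == 3%N].

Definition adjacency (V E : finType) (G : multigraph V E) : rel V :=
  fun u v => [exists e, (G e == (u, v)) || (G e == (v, u))].

Definition graph_connected (V E : finType) (G : multigraph V E) : bool :=
  [forall u, forall v, connect (adjacency G) u v].

Definition betti1 (V E : finType) (G : multigraph V E) : nat :=
  (#|E| + n_comp (adjacency G) predT - #|V|)%N.

Definition has_loop (V E : finType) (G : multigraph V E) : bool :=
  [exists e, (G e).1 == (G e).2].

Definition same_ends (V : eqType) (x y : V * V) : bool :=
  (x == y) || (x == (y.2, y.1)).

Definition same_graph (V E : finType) (G H : multigraph V E) : Prop :=
  forall e, same_ends (G e) (H e).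

Definition graph_iso (V E : finType) (G H : multigraph V E) : Prop :=
  exists (s : {perm V}) (t : {perm E}),
    forall e, same_ends (s (G e).1, s (G e).2) (H (t e)).

(** * Feynman graphs *)

(* The vertices [x_i] and the edges [q_k], numbered from 0. *)
Notation vert g := ('I_(2 * g - 2)).
Notation edge g := ('I_(3 * g - 3)).

Definition is_feynman (g : nat) (G : multigraph (vert g) (edge g)) : bool :=
  [&& trivalent G, graph_connected G & betti1 G == g].

Definition feynman_graph (g : nat) : finType :=
  {G : multigraph (vert g) (edge g) | is_feynman G}.

(* One labeled graph in each isomorphism class of (unlabeled) graphs. *)
Definition feynman_representatives (g : nat) (T : {set feynman_graph g}) :=
  forall G : feynman_graph g,
    exists! H : feynman_graph g, H \in T /\ graph_iso (val G) (val H).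

(** * Tropical curves *)

Record tropical_curve (R : realType) (V E : finType) := TropicalCurve {
  curve_graph : multigraph V E;
  curve_len : E -> R;
  curve_trivalent : trivalent curve_graph;
  curve_connected : graph_connected curve_graph;
  curve_len_gt0 : forall e, 0 < curve_len e
}.

(* The points of the metric graph: its vertices, and the interior points
   [(e, t)] of the edges, at distance [t] from the first end point of [e]. *)
Definition curve_point (R : realType) (V E : finType) (C : tropical_curve R V E)
    : choiceType :=
  (V + {x : E * R | 0 < x.2 < curve_len C x.1})%type.

(* The characteristic map of the closed edge [e], meaningful on
   [[0, curve_len C e]]; the curve is the quotient of the disjoint union of
   these intervals by the identifications at their end points. *)
Definition edge_param (R : realType) (V E : finType) (C : tropical_curve R V E)
    (e : E) (t : R) : curve_point C :=
  if insub (e, t) is Some x then inr x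
  else inl (if t <= 0 then (curve_graph C e).1 else (curve_graph C e).2).

Definition on_edge (R : realType) (V E : finType) (C : tropical_curve R V E)
    (e : E) : set (curve_point C) :=
  [set edge_param C e t | t in `[0, curve_len C e]].
Arguments on_edge {R V E} C e _.

(* Isometries of metric graphs: bijections carrying each edge isometrically
   onto an edge. *)
Definition isometry (R : realType) (V E : finType)
    (C C' : tropical_curve R V E) (f : curve_point C -> curve_point C') : Prop :=
  bijective f /\
  forall e, exists e', curve_len C' e' = curve_len C e /\
    ((forall t, t \in `[0, curve_len C e] ->
        f (edge_param C e t) = edge_param C' e' t) \/
     (forall t, t \in `[0, curve_len C e] ->
        f (edge_param C e t) = edge_param C' e' (curve_len C e - t))).

(** * The tropical elliptic curve *)

(* The circle [R / L Z] of length [L], by its fundamental domain. *)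
Definition circle (R : realType) (L : {posnum R}) := {x : R | 0 <= x < L%:num}.

Lemma circle_proj_subproof (R : realType) (L : {posnum R}) (x : R) :
  0 <= x - (Num.floor (x / L%:num))%:~R * L%:num < L%:num.
Proof.
have L0 : 0 < L%:num by [].
rewrite subr_ge0 -ler_pdivlMr // floor_le /= ltrBlDl.
rewrite -[X in _ + X]mul1r -mulrDl -ltr_pdivrMr //.
by have := floorD1_gt (x / L%:num); rewrite intrD.
Qed.

Definition circle_proj (R : realType) (L : {posnum R}) (x : R) : circle L :=
  exist (fun x => is_true (0 <= x < L%:num)) _ (circle_proj_subproof L x).

Definition circle_dist (R : realType) (L : {posnum R}) (x y : circle L) : R :=
  Num.min `|val x - val y| (L%:num - `|val x - val y|).

(** * Tropical covers *)

(* Signed slope of the half-edge [h], oriented away from its base vertex, when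
   [s e] is the slope of [e] from its first to its second end point. *)
Definition out_slope (E : finType) (s : E -> int) (h : E * bool) : int :=
  if h.2 then - s h.1 else s h.1.

(* The circle is oriented by [circle_proj]; a half-edge at [v] maps to the
   positive (negative) ray at the image of [v] iff its outgoing slope is
   positive (negative). *)
Definition balanced (V E : finType) (G : multigraph V E) (s : E -> int) : Prop :=
  forall v : V,
    (\sum_(h | (half_base G h == v) && (0 < out_slope s h)%R) `|out_slope s h|
     = \sum_(h | (half_base G h == v) && (out_slope s h < 0)%R)
         `|out_slope s h|)%N.

(* The slopes are determined by the map, since edges have positive length.
   Continuity is with respect to the quotient topology on the curve. *)
Record tropical_cover (R : realType) (L : {posnum R}) (V E : finType)
    (C : tropical_curve R V E) := TropicalCover {
  cover_map : curve_point C -> circle L;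
  cover_slope : E -> int;
  cover_continuous : forall e, forall t0, t0 \in `[0, curve_len C e] ->
    circle_dist (cover_map (edge_param C e t0)) (cover_map (edge_param C e t))
      @[t --> within `[0, curve_len C e] (nbhs t0)] --> (0 : R);
  cover_nonconstant : exists x y, cover_map x <> cover_map y;
  cover_affine : forall e, exists b : R, forall t,
    t \in `[0, curve_len C e] ->
    cover_map (edge_param C e t) = circle_proj L (b + (cover_slope e)%:~R * t);
  cover_balanced : balanced (curve_graph C) cover_slope
}.

Definition weight (R : realType) (L : {posnum R}) (V E : finType)
    (C : tropical_curve R V E) (f : tropical_cover L C) (e : E) : nat :=
  `|cover_slope f e|%N.

(* Number of preimages of [p] on [e], for [p] not the image of a vertex. *)
Definition edge_fiber_card (R : realType) (L : {posnum R}) (V E : finType)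
    (C : tropical_curve R V E) (f : tropical_cover L C) (p : circle L) (e : E)
    : nat :=
  #|` fset_set (cover_map f @^-1` [set p] `&` on_edge C e) |.

Definition branch_points (R : realType) (L : {posnum R}) (V E : finType)
    (C : tropical_curve R V E) (f : tropical_cover L C) : set (circle L) :=
  range (fun v : V => cover_map f (inl v)).

Definition has_degree (R : realType) (L : {posnum R}) (V E : finType)
    (C : tropical_curve R V E) (f : tropical_cover L C) (d : nat) : Prop :=
  forall p, ~ branch_points f p ->
    d = (\sum_e edge_fiber_card f p e * weight f e)%N.

(** * Labeled tropical covers and their counts *)

(* The labeling is built in: the vertices and edges of the source are the
   labels themselves. *)
Record labeled_cover (R : realType) (L : {posnum R}) (g : nat) := LabeledCover {
  source : tropical_curve R (vert g) (edge g);
  underlying_cover : tropical_cover L source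
}.

Definition has_type (R : realType) (L : {posnum R}) (g : nat)
    (X : labeled_cover L g) (G : feynman_graph g) : Prop :=
  same_graph (curve_graph (source X)) (val G).

Definition cover_iso (R : realType) (L : {posnum R}) (g : nat)
    (X Y : labeled_cover L g) : Prop :=
  exists f : curve_point (source X) -> curve_point (source Y),
    [/\ isometry f,
        forall x, cover_map (underlying_cover Y) (f x) = cover_map (underlying_cover X) x,
        forall v, f (inl v) = inl v
      & forall e x, on_edge (source X) e x -> on_edge (source Y) e (f x)].

Definition cover_mult (R : realType) (L : {posnum R}) (g : nat)
    (X : labeled_cover L g) : nat :=
  (\prod_e weight (underlying_cover X) e)%N.

Definition iso_class (R : realType) (L : {posnum R}) (g : nat)
    (X : labeled_cover L g) : set (labeled_cover L g) :=
  [set Y | cover_iso X Y].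

(* The common multiplicity of the elements of an isomorphism class. *)
Definition class_mult (R : realType) (L : {posnum R}) (g : nat)
    (K : set (labeled_cover L g)) : nat :=
  xget 0%N [set cover_mult X | X in K].

Definition exponent (g : nat) := {ffun edge g -> nat}.

Definition counted_covers (R : realType) (L : {posnum R}) (g : nat)
    (p0 : circle L) (p : vert g -> circle L) (T : {set feynman_graph g})
    (a : exponent g) : set (labeled_cover L g) :=
  [set X | [/\ exists2 G, G \in T & has_type X G,
               has_degree (underlying_cover X) (\sum_k a k)%N,
               branch_points (underlying_cover X) = range p
             & forall k, (edge_fiber_card (underlying_cover X) p0 k * weight (underlying_cover X) k)%N
                         = a k]].

(* Weighted number of isomorphism classes of labeled covers whose type belongs
   to [T]. *)
Definition trop_count (R : realType) (L : {posnum R}) (g : nat)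
    (p0 : circle L) (p : vert g -> circle L) (T : {set feynman_graph g})
    (a : exponent g) : nat :=
  \sum_(K \in [set iso_class X | X in counted_covers p0 p T a]) class_mult K.

(** * Power series *)

(* Unordered sums of complex numbers; they exist iff the family is absolutely
   summable. *)
Definition has_sum (R : realType) (I : choiceType) (u : I -> R[i]) (s : R[i]) :=
  partial_sum (u : I -> R[i]^o) @ totally --> (s : R[i]^o).

Definition csum (R : realType) (I : choiceType) (u : I -> R[i]) : R[i] :=
  summability.sum (u : I -> R[i]^o).

(* A formal power series in the variables [q_k] is its family of
   coefficients. *)
Definition power_series (R : realType) (g : nat) := exponent g -> R[i].

Definition monomial (R : realType) (g : nat) (q : edge g -> R[i])
    (b : exponent g) : R[i] :=
  \prod_k q k ^+ b k.

Definition twice (g : nat) (a : exponent g) : exponent g :=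
  [ffun k => (2 * a k)%N].

(* The series of the [N_a q^(2 a)]. *)
Definition even_series (R : realType) (g : nat) (N : exponent g -> nat)
    : power_series R g :=
  fun b => if [forall k, ~~ odd (b k)] then (N [ffun k => (b k)./2])%:R else 0.

(** * The propagator *)

Definition cexp (R : realType) (z : R[i]) : R[i] :=
  (expR (complex.Re z) * cos (complex.Im z))
  +i* (expR (complex.Re z) * sin (complex.Im z)).

Definition weierstrass_p (R : realType) (z tau : R[i]) : R[i] :=
  z ^- 2 + csum (fun mn : int * int =>
    if mn == 0 then 0
    else let w := mn.1%:~R + mn.2%:~R * tau in (z - w) ^- 2 - w ^- 2).

Definition sigma1 (d : nat) : nat := (\sum_(m <- divisors d) m)%N.

Definition eisenstein2 (R : realType) (q : R[i]) : R[i] :=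
  1 - 24%:R * csum (fun d : nat => (sigma1 d.+1)%:R * q ^+ d.+1).

Definition nome (R : realType) (tau : R[i]) : R[i] :=
  cexp (('i * pi%:C)%C * tau).

Definition propagator (R : realType) (z tau : R[i]) : R[i] :=
  (4%:R * (pi%:C)%C ^+ 2)^-1 * weierstrass_p z tau
  + 12%:R^-1 * eisenstein2 (nome tau ^+ 2).

(** * Feynman integrals *)

Definition cintegral01 (R : realType) (f : R -> R[i]) : R[i] :=
  (\int[lebesgue_measure]_(t in `[0, 1]) complex.Re (f t))
  +i* (\int[lebesgue_measure]_(t in `[0, 1]) complex.Im (f t)).

(* Iterated integral over [[0, 1]] in the variables listed in [vs]. *)
Fixpoint iterated_integral (R : realType) (V : eqType) (vs : seq V)
    (f : (V -> R) -> R[i]) (t : V -> R) : R[i] :=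
  if vs is v :: vs' then
    cintegral01 (fun s =>
      iterated_integral vs' f (fun u => if u == v then s else t u))
  else f t.

(* [I_(G, Omega)], for the heights [y] chosen according to [Omega]; the
   variable [z_j] runs over [t |-> i y_j + t]. *)
Definition feynman_integral_order (R : realType) (g : nat)
    (G : feynman_graph g) (tau : edge g -> R[i]) (y : vert g -> R) : R[i] :=
  if has_loop (val G) then 0
  else iterated_integral (enum (vert g))
         (fun t => let z j := t j +i* y j in
            \prod_k - propagator (z (val G k).1 - z (val G k).2) (tau k))
         (fun=> 0).

(* An order of the vertices is given by the permutation sending each vertex to
   its rank; [Y Omega] are the heights chosen for the order [Omega]. *)
Definition admissible_heights (R : realType) (g : nat) (tau : edge g -> R[i])
    (Y : {perm vert g} -> vert g -> R) : Prop :=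
  forall Omega : {perm vert g},
    (forall i j, (Y Omega i < Y Omega j) = (Omega i < Omega j)%N) /\
    (forall i j k, `|Y Omega i - Y Omega j| < complex.Im (tau k)).

Definition feynman_integral (R : realType) (g : nat) (G : feynman_graph g)
    (tau : edge g -> R[i]) (Y : {perm vert g} -> vert g -> R) : R[i] :=
  \sum_(Omega : {perm vert g}) feynman_integral_order G tau (Y Omega).

(* [c] is the power series in the [q_k = exp(i pi tau_k)] of a function of the
   [tau_k] given by means of auxiliary heights. *)
Definition expands_to (R : realType) (g : nat)
    (F : (edge g -> R[i]) -> ({perm vert g} -> vert g -> R) -> R[i])
    (c : power_series R g) : Prop :=
  forall tau Y, (forall k, 0 < complex.Im (tau k)) -> admissible_heights tau Y ->
    has_sum (fun b => c b * monomial (fun k => nome (tau k)) b) (F tau Y).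

(* Main.v *)
Require Import Defs.
From HB Require Import structures.
From mathcomp Require Import all_boot all_order all_fingroup all_algebra.
From mathcomp Require Import finmap complex.
From mathcomp Require Import all_classical all_reals all_analysis.
From mathcomp.analysis.showcase Require Import summability.
From mathcomp Require Import ring lra zify.

Set Implicit Arguments.
Unset Strict Implicit.
Unset Printing Implicit Defensive.
Import Order.TTheory GRing.Theory Num.Theory.
Import numFieldNormedType.Exports.
Local Open Scope classical_set_scope.
Local Open Scope ring_scope.

(** Both sides count integer flows on the graph. The link is the pair [(s, a)]
    carried by an edge: a nonzero slope [s] and the product [a] of [|s|] with the
    number of windings around the circle, in the direction of [s]. If the edge
    does not wind, the sign of [s] is dictated by the order of its ends. This is
    [edge_ok], and [flow_count] adds up the product of the [|s e|] over the flows
    that are balanced at all vertices, for a given order of the vertices.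

    Analytic side. For [z] off the real axis and in the strip [|Im z| < Im tau],
    the opposite of the propagator is the sum of [|s| q ^ (2 a) exp (2 i pi s z)]
    over these pairs, with the order of the ends given by the sign of [Im z]
    ([has_sum_propagator]). Indeed the Weierstrass sum converges absolutely
    ([abs_summable_lattice]) and may be summed row by row; the Lipschitz formula
    ([has_sum_lipschitz]) makes each row a value of the squared cosecant, whose
    expansion in the half plane is geometric, and the constants left over cancel
    against [E_2] ([lambert_series]). In the product of these expansions over the
    edges, the frequency of the real part of [z_v] is the divergence of the flow
    [s] at [v]. Integrating over the periods keeps the balanced flows
    ([iterated_integral_series]); for those the imaginary parts of the [z_v]
    cancel, so that they matter only through their order. This gives
    [feynman_integral_series].

    Tropical side. A cover is a balanced flow, its slopes, together with the
    distribution of its vertices over the branch points. Cutting the circle at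
    [p0], an edge lifts to a path between the positions of its ends plus [n]
    turns; its length is the displacement divided by the slope, and its fibre
    over [p0], counted with the weight, is [s n]. So the prescribed fibres fix
    the windings and the lengths ([realizes_unique]), and the positivity of the
    lengths is [edge_ok] ([realizes_valid], [new_len_gt0]). Summing over the
    distributions amounts to summing over the orders of the vertices
    ([trop_count_flows]). In both counts a loop contributes nothing, for a
    trivalent vertex cannot be balanced at a loop ([balanced_no_loop]).

    Finally an expansion in powers of the [q_k] has unique coefficients, which
    are recovered by integrating over the real parts of the [tau_k]
    ([expands_to_unique]). *)

#[local] Existing Instance totally_filter.

(** * Unordered sums of complex numbers *)

Section Sums.
Local Open Scope complex_scope.
Local Open Scope ring_scope.
Variable R : realType.
Local Notation C := R[i].
Implicit Types (I J : choiceType) (s t : C).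

Lemma has_sumP I (u : I -> C) s :
  has_sum u s <-> forall e : C, 0 < e -> exists J0 : {fset I},
    forall J : {fset I}, (J0 `<=` J)%fset -> `|\sum_(i <- J) u i - s| < e.
Proof.
rewrite /has_sum /partial_sum; split.
  move=> h e e0.
  have [J0 _ h0] := @cvgr_dist_lt _ _ _ _ _ _ _ h e e0.
  by exists J0 => J JJ; have /= := h0 J JJ; rewrite distrC big_seq_fsetE.
move=> h; apply/cvgrPdist_lt => e e0; have [J0 h0] := h e e0.
by exists J0 => // J JJ /=; rewrite distrC; have := h0 J JJ; rewrite big_seq_fsetE.
Qed.

Lemma has_sum_unique I (u : I -> C) s t : has_sum u s -> has_sum u t -> s = t.
Proof. by move=> us ut; apply: (cvg_unique _ us ut); exact: norm_hausdorff. Qed.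

Lemma csum_has_sum I (u : I -> C) s : has_sum u s -> csum u = s.
Proof.
move=> us; rewrite /csum /summability.sum.
by apply: (cvg_lim _ us); exact: norm_hausdorff.
Qed.

Lemma eq_has_sum I (u v : I -> C) s : u =1 v -> has_sum u s -> has_sum v s.
Proof. by move=> /funext ->. Qed.

Lemma has_sumD I (u v : I -> C) s t :
  has_sum u s -> has_sum v t -> has_sum (fun i => u i + v i) (s + t).
Proof.
move=> /has_sumP us /has_sumP vt; apply/has_sumP => e e0.
have e20 : 0 < e / 2 by rewrite divr_gt0.
have [J1 h1] := us _ e20; have [J2 h2] := vt _ e20.
exists (J1 `|` J2)%fset => J; rewrite fsubUset => /andP[J1J J2J].
rewrite big_split/= opprD addrACA (splitr e).
by rewrite (le_lt_trans (ler_normD _ _))// ltrD ?h1 ?h2.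
Qed.

Lemma has_sumZ I (u : I -> C) s c :
  has_sum u s -> has_sum (fun i => c * u i) (c * s).
Proof.
move=> /has_sumP us; apply/has_sumP => e e0.
have c0 : 0 < `|c| + 1 by rewrite ltr_wpDl.
have [J0 h0] := us _ (divr_gt0 e0 c0).
exists J0 => J /h0; rewrite -mulr_sumr -mulrBr normrM ltr_pdivlMr// mulrC.
by apply: le_lt_trans; rewrite ler_wpM2r// lerDl.
Qed.

Lemma has_sum0 I : has_sum (fun _ : I => 0 : C) 0.
Proof.
apply/has_sumP => e e0; exists fset0 => J _.
by rewrite big1// subr0 normr0.
Qed.

Lemma has_sum_big I (K : Type) (r : seq K) (P : pred K) (u : K -> I -> C) (s : K -> C) :
  (forall k, P k -> has_sum (u k) (s k)) ->
  has_sum (fun i => \sum_(k <- r | P k) u k i) (\sum_(k <- r | P k) s k).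
Proof.
move=> us; elim: r => [|k r IH].
  by rewrite big_nil; apply: eq_has_sum (has_sum0 I) => i; rewrite big_nil.
rewrite big_cons; case: ifPn => Pk.
  by apply: eq_has_sum (has_sumD (us k Pk) IH) => i; rewrite big_cons Pk.
by apply: eq_has_sum IH => i; rewrite big_cons (negPf Pk).
Qed.

Lemma has_sum_finite I (u : I -> C) (J : {fset I}) :
  (forall i, i \notin J -> u i = 0) -> has_sum u (\sum_(i <- J) u i).
Proof.
move=> uJ; apply/has_sumP => e e0; exists J => K JK.
rewrite (big_fset_incl _ JK) ?subrr ?normr0// => i _ iJ; exact: uJ.
Qed.

Lemma has_sum_single I (u : I -> C) i0 :
  (forall i, i != i0 -> u i = 0) -> has_sum u (u i0).
Proof.
move=> ui; have := @has_sum_finite _ u [fset i0]%fset; rewrite big_seq_fset1.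
by apply=> i; rewrite inE => /ui.
Qed.

(** A large finite part of [u] can be enlarged so as to approximate
    simultaneously the sums of finitely many blocks. *)
Lemma has_sum_partition I J (b : I -> J) (u : I -> C) (v : J -> C) s :
  has_sum u s ->
  (forall j, has_sum (fun i => if b i == j then u i else 0) (v j)) ->
  has_sum v s.
Proof.
move=> /has_sumP us uv; apply/has_sumP => e e0.
have e20 : 0 < e / 2 by rewrite divr_gt0.
have [J0 h0] := us _ e20.
exists (b @` J0)%fset => B sB.
have /has_sumP /(_ _ e20)[J1 h1] :=
  @has_sum_big I J B xpredT (fun j i => if b i == j then u i else 0) v (fun j _ => uv j).
pose K := (J0 `|` J1)%fset.
have {h1}/h1 := fsubsetUr J0 J1; rewrite -/K => hB.
have eK : \sum_(i <- K) \sum_(j <- B) (if b i == j then u i else 0) =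
          \sum_(i <- [fset i in K | b i \in B]%fset) u i.
  rewrite big_fset/= [RHS]big_mkcond/=.
  apply: eq_bigr => i _; case: ifPn => bi; last first.
    rewrite big1_seq// => j /andP[_ jB]; case: eqP => // bj.
    by rewrite bj jB in bi.
  rewrite (big_fsetD1 (b i))//= eqxx big1_seq ?addr0// => j.
  by rewrite !inE => /andP[_ /andP[ji _]]; rewrite eq_sym (negPf ji).
rewrite eK in hB.
have /h0 hs : (J0 `<=` [fset i in K | b i \in B])%fset.
  apply/fsubsetP => i iJ0; rewrite !inE/= iJ0/=.
  by move/fsubsetP: sB; apply; apply/imfsetP; exists i.
rewrite (splitr e); apply: le_lt_trans (ltrD hs hB).
rewrite [in leRHS]addrC -[X in `|X| + _]opprB normrN.
by rewrite (le_trans _ (ler_normD _ _))// addrA subrK.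
Qed.

(** The order of the complex numbers forces the bound [M] to be real. *)
Definition abs_summable I (u : I -> C) :=
  exists M : C, forall J : {fset I}, \sum_(i <- J) `|u i| <= M.

Lemma Re_sum I (r : seq I) (u : I -> C) :
  complex.Re (\sum_(i <- r) u i) = \sum_(i <- r) complex.Re (u i).
Proof. by elim: r => [|i r IH]; rewrite ?big_nil// !big_cons -IH; case: (u i) (\sum_(j <- r) u j) => ? ? []. Qed.
Lemma Im_sum I (r : seq I) (u : I -> C) :
  complex.Im (\sum_(i <- r) u i) = \sum_(i <- r) complex.Im (u i).
Proof. by elim: r => [|i r IH]; rewrite ?big_nil// !big_cons -IH; case: (u i) (\sum_(j <- r) u j) => ? ? []. Qed.

Lemma normC_Re (z : C) : (complex.Re `|z| )%:C = `|z|.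
Proof. by rewrite RRe_real// normr_real. Qed.

Lemma le_Re_norm (z : C) : `|complex.Re z| <= complex.Re `|z|.
Proof. by have := normc_ge_Re z; rewrite -[ `|z| ]normC_Re lecR. Qed.

Lemma le_Im_norm (z : C) : `|complex.Im z| <= complex.Re `|z|.
Proof.
rewrite normc_def /= -sqrtr_sqr ler_wsqrtr// lerDr; exact: sqr_ge0.
Qed.

Lemma norm_le_ReIm (z : C) : complex.Re `|z| <= `|complex.Re z| + `|complex.Im z|.
Proof.
rewrite normc_def /= -[leRHS]ger0_norm ?addr_ge0// -sqrtr_sqr ler_wsqrtr//.
rewrite sqrrD !real_normK ?num_real// addrAC lerDl mulrn_wge0// mulr_ge0//.
Qed.
End Sums.
Arguments has_sumZ {R I u s} c _.

Section AbsoluteSums.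
Local Open Scope complex_scope.
Local Open Scope ring_scope.
Variable R : realType.
Local Notation C := R[i].
Implicit Types (I J : choiceType) (s t : C).

Lemma sum_fset_split I (J : {fset I}) (P : pred I) (V : nmodType) (F : I -> V) :
  \sum_(i <- J | P i) F i = \sum_(i <- [fset i in J | P i]%fset) F i.
Proof. by rewrite big_fset. Qed.

Lemma big_fset_inter_diff I (K J : {fset I}) (V : nmodType) (F : I -> V) :
  \sum_(i <- K) F i = \sum_(i <- (K `&` J)%fset) F i + \sum_(i <- (K `\` J)%fset) F i.
Proof.
rewrite (big_fsetID _ (mem J))/=; congr (_ + _); apply: eq_fbigl => i.
  by rewrite !inE.
by rewrite !inE andbC.
Qed.

Lemma big_fset_disjointU I (K J : {fset I}) (V : nmodType) (F : I -> V) :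
  [disjoint K & J]%fset ->
  \sum_(i <- (K `|` J)%fset) F i = \sum_(i <- K) F i + \sum_(i <- J) F i.
Proof.
move=> /fdisjointP dKJ; rewrite (big_fset_inter_diff _ K); congr (_ + _); apply: eq_fbigl => i.
  by rewrite !inE; case: (i \in K); rewrite ?andbT ?andbF.
by rewrite !inE; case: (boolP (i \in K)) => [/dKJ/negPf ->|].
Qed.

Lemma ler_sum_fset I (K J : {fset I}) (V : numDomainType) (F : I -> V) :
  (forall i, 0 <= F i) -> (K `<=` J)%fset -> \sum_(i <- K) F i <= \sum_(i <- J) F i.
Proof.
move=> F0 KJ; rewrite (big_fset_inter_diff J K) (fsetIidPr KJ) lerDl.
exact: sumr_ge0.
Qed.

(** The terms where [phi] is nonnegative and those where it is negative are
    summed separately: on each part the sum of the absolute values is, up to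
    sign, the [phi] of a partial sum. *)
Lemma sum_norm_component_le I (u : I -> C) (J : {fset I}) (B : R) (phi : C -> R) :
  (forall (r : seq I) , phi (\sum_(i <- r) u i) = \sum_(i <- r) phi (u i)) ->
  (forall z, `|phi z| <= complex.Re `|z| ) ->
  (forall K : {fset I}, (K `<=` J)%fset -> complex.Re `|\sum_(i <- K) u i| <= B) ->
  \sum_(i <- J) `|phi (u i)| <= B + B.
Proof.
move=> phiS phiN hB.
rewrite (bigID (fun i => 0 <= phi (u i)))/=.
have h (P : pred I) : `|\sum_(i <- J | P i) phi (u i)| <= B.
  rewrite sum_fset_split -phiS (le_trans (phiN _))// hB//.
  exact: fset_sub.
rewrite lerD//.
  apply: le_trans (h (fun i => 0 <= phi (u i))).
  by rewrite (eq_bigr (fun i => phi (u i))) ?ler_norm// => i /ger0_norm.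
apply: le_trans (h (fun i => ~~ (0 <= phi (u i)))).
rewrite (eq_bigr (fun i => - phi (u i))) ?sumrN.
  by rewrite -normrN ler_norm.
by move=> i; rewrite -ltNge => /ltr0_norm.
Qed.

(** By the Cauchy criterion the partial sums over sets disjoint from some finite
    [J0] are bounded, hence so are, by [sum_norm_component_le], the sums of the
    absolute values of their real and imaginary parts. *)
Lemma has_sum_abs I (u : I -> C) s : has_sum u s -> abs_summable u.
Proof.
move=> /has_sumP /(_ 1 ltr01)[J0 h0].
have hK (K : {fset I}) : [disjoint J0 & K]%fset -> complex.Re `|\sum_(i <- K) u i| <= 2.
  move=> dK; rewrite -lecR normC_Re.
  have := h0 (J0 `|` K)%fset (fsubsetUl _ _).
  have := h0 J0 (fsubset_refl _).
  rewrite big_fset_disjointU//; set a := \sum_(i <- J0) _; set b := \sum_(i <- K) _.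
  move=> h1 h2.
  have -> : b = (a + b - s) - (a - s) by ring.
  rewrite (le_trans (ler_normB _ _))//.
  have -> : (2 : R)%:C = 1 + 1 :> C by rewrite rmorphD /= rmorph1.
  by rewrite lerD// ltW.
exists (\sum_(i <- J0) `|u i| + (2 + 2 + (2 + 2))%:C) => K.
rewrite (big_fset_inter_diff K J0) lerD//.
  by rewrite ler_sum_fset// fsubsetIr.
rewrite (eq_bigr (fun i => (complex.Re `|u i| )%:C)) => [|i _]; last by rewrite normC_Re.
rewrite -rmorph_sum lecR.
apply: (@le_trans _ _ (\sum_(i <- (K `\` J0)%fset) (`|complex.Re (u i)| + `|complex.Im (u i)|))).
  by apply: ler_sum => i _; exact: norm_le_ReIm.
have hs (K' : {fset I}) : (K' `<=` K `\` J0)%fset -> complex.Re `|\sum_(i <- K') u i| <= 2.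
  move=> sK; apply: hK; rewrite fdisjoint_sym; apply/fdisjointP => i.
  by move=> /(fsubsetP sK); rewrite !inE => /andP[].
rewrite big_split lerD//.
  by apply: (@sum_norm_component_le _ _ _ _ (@complex.Re R)) => //; [move=> r; exact: Re_sum|exact: le_Re_norm].
by apply: (@sum_norm_component_le _ _ _ _ (@complex.Im R)) => //; [move=> r; exact: Im_sum|exact: le_Im_norm].
Qed.

Lemma has_sum_bounded_ge0 I (v : I -> R) (M : R) : (forall i, 0 <= v i) ->
  (forall J : {fset I}, \sum_(i <- J) v i <= M) ->
  exists s, has_sum (fun i => (v i)%:C) s.
Proof.
move=> v0 vM.
pose A := range (fun J : {fset I} => \sum_(i <- J) v i).
have hA : has_sup A.
  split; first by exists (\sum_(i <- fset0) v i); exists fset0.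
  by exists M => _ [J _ <-].
exists (sup A)%:C; apply/has_sumP => e e0.
have eR : (complex.Re e)%:C = e by rewrite RRe_real// gtr0_real.
have e0' : 0 < complex.Re e by rewrite -ltcR eR.
have [_ [J0 _ <-] hJ0] := sup_adherent e0' hA.
exists J0 => J sJ; rewrite -rmorph_sum -rmorphB normc_def /= expr0n/= addr0 sqrtr_sqr.
rewrite -eR ltcR.
have hle : \sum_(i <- J) v i <= sup A by apply: sup_upper_bound => //; exists J.
have hle2 : \sum_(i <- J0) v i <= \sum_(i <- J) v i.
  exact: ler_sum_fset.
rewrite ler0_norm ?subr_le0// opprB; lra.
Qed.

(** A real family dominated by a summable one is the difference of two
    nonnegative bounded families, [|u| + phi u] and [|u|]. *)
Lemma abs_summableP I (u : I -> C) : abs_summable u -> exists s, has_sum u s.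
Proof.
move=> [M hM].
have MR : (complex.Re M)%:C = M.
  by rewrite RRe_real// ger0_real// (le_trans _ (hM fset0))// big_seq_fset0.
have hMR (J : {fset I}) : \sum_(i <- J) complex.Re `|u i| <= complex.Re M.
  rewrite -lecR MR rmorph_sum/= (eq_bigr (fun i => `|u i|)) => [|i _]; [exact: hM|exact: normC_Re].
have N0 (z : C) : 0 <= complex.Re `|z| by rewrite -ler0c normC_Re.
have [s0 hs0] := has_sum_bounded_ge0 (fun i => N0 (u i)) hMR.
have key (phi : C -> R) : (forall z, `|phi z| <= complex.Re `|z| ) ->
    exists s, has_sum (fun i => (phi (u i))%:C) s.
  move=> phiN.
  have [||s1 hs1] := @has_sum_bounded_ge0 I (fun i => complex.Re `|u i| + phi (u i)) (complex.Re M + complex.Re M).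
  - move=> i; have := phiN (u i); rewrite ler_norml => /andP[]; lra.
  - move=> J; rewrite big_split lerD//.
    apply: le_trans (hMR J); apply: ler_sum => i _.
    by apply: le_trans (phiN _); exact: ler_norm.
  exists (s1 + (-1) * s0).
  by apply: eq_has_sum (has_sumD hs1 (has_sumZ (-1) hs0)) => i; rewrite rmorphD/=; ring.
have [s1 hs1] := key _ (@le_Re_norm R).
have [s2 hs2] := key _ (@le_Im_norm R).
exists (s1 + 'i%C * s2).
by apply: eq_has_sum (has_sumD hs1 (has_sumZ 'i%C hs2)) => i; rewrite -complexE.
Qed.

Lemma abs_summable_norm I (u : I -> C) : abs_summable u -> abs_summable (fun i => `|u i|).
Proof. by move=> [M hM]; exists M => J; under eq_bigr do rewrite normr_id; exact: hM. Qed.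

Lemma abs_summable_le I (u v : I -> C) (J0 : {fset I}) :
  (forall i, i \notin J0 -> `|u i| <= `|v i|) -> abs_summable v -> abs_summable u.
Proof.
move=> uv [M hM]; exists (\sum_(i <- J0) `|u i| + M) => K.
rewrite (big_fset_inter_diff K J0) lerD//.
  by rewrite ler_sum_fset// fsubsetIr.
apply: le_trans (hM (K `\` J0)%fset).
rewrite big_seq [leRHS]big_seq; apply: ler_sum => i; rewrite !inE => /andP[+ _]; exact: uv.
Qed.

Lemma abs_summableZ I (u : I -> C) c : abs_summable u -> abs_summable (fun i => c * u i).
Proof. by move=> /abs_summableP[s /(has_sumZ c)/has_sum_abs]. Qed.

Lemma abs_summable_inj I J (h : I -> J) (u : J -> C) : injective h ->
  abs_summable u -> abs_summable (fun i => u (h i)).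
Proof.
move=> hI [M hM]; exists M => K; apply: le_trans (hM (h @` K)%fset).
by rewrite big_imfset//= => ? ? _ _; exact: hI.
Qed.

Lemma has_sum_extend I J (h : I -> J) (u : J -> C) s : injective h ->
  (forall j, (forall i, h i != j) -> u j = 0) ->
  has_sum (fun i => u (h i)) s -> has_sum u s.
Proof.
move=> hI u0 ut; apply: (has_sum_partition ut (b := h)) => j.
have [[i hij]|nj] := pselect (exists i, h i = j).
  have := @has_sum_single _ _ (fun k => if h k == j then u (h k) else 0) i.
  rewrite /= hij eqxx; apply => k ki; case: eqP => // hk.
  by rewrite -hij in hk; rewrite (hI _ _ hk) eqxx in ki.
rewrite u0 => [|i]; last by apply/eqP => hij; apply: nj; exists i.
by apply: eq_has_sum (@has_sum0 R I) => i; case: eqP => // hij; case: nj; exists i.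
Qed.

Lemma has_sum_restrict I J (h : I -> J) (u : J -> C) s : injective h ->
  (forall j, (forall i, h i != j) -> u j = 0) ->
  has_sum u s -> has_sum (fun i => u (h i)) s.
Proof.
move=> hI u0 us; have /abs_summableP[t ut] := abs_summable_inj hI (has_sum_abs us).
by rewrite (has_sum_unique us (has_sum_extend hI u0 ut)).
Qed.

Lemma has_sum_tail I (u : I -> C) : abs_summable u -> forall e : C, 0 < e ->
  exists J0 : {fset I}, forall J : {fset I}, [disjoint J0 & J]%fset -> \sum_(i <- J) `|u i| < e.
Proof.
move=> /abs_summable_norm/abs_summableP[s /has_sumP us] e e0.
have e20 : 0 < e / 2 by rewrite divr_gt0.
have [J0 h0] := us _ e20; exists J0 => J dJ.
have h1 := h0 _ (fsubset_refl J0); have := h0 _ (fsubsetUl J0 J).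
rewrite big_fset_disjointU//; set a := \sum_(i <- J0) _ in h1 *; set b := \sum_(i <- J) _ => h2.
have -> : b = `|b| by rewrite ger0_norm// sumr_ge0.
have -> : b = (a + b - s) - (a - s) by ring.
by rewrite (splitr e) (le_lt_trans (ler_normB _ _))// ltrD.
Qed.

Lemma ltr0C (x : R) : (0 < x%:C :> C) = (0 < x).
Proof. exact: ltcR. Qed.

End AbsoluteSums.

Section LimitsAndProducts.
Local Open Scope complex_scope.
Local Open Scope ring_scope.
Variable R : realType.
Local Notation C := R[i].
Implicit Types (I J : choiceType) (s t : C).

Lemma eq_of_dist (x y c : C) : 0 < c -> (forall e : C, 0 < e -> `|x - y| < e * c) -> x = y.
Proof.
move=> c0 h; apply/eqP; rewrite -subr_eq0 -normr_eq0; apply: contraT => n0.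
have p : 0 < `|x - y| by rewrite lt_def n0/=.
have := h _ (divr_gt0 p c0); rewrite divfK ?ltxx// gt_eqF//.
Qed.

Lemma has_sum_dist_tail I (u : I -> C) s (J0 : {fset I}) (e : C) : 0 < e ->
  has_sum u s -> (forall J : {fset I}, [disjoint J0 & J]%fset -> \sum_(i <- J) `|u i| < e) ->
  `|s - \sum_(i <- J0) u i| < e + e.
Proof.
move=> e0 /has_sumP /(_ _ e0)[J1 h1] ht.
have := h1 _ (fsubsetUr J0 J1).
have := ht ((J0 `|` J1) `\` J0)%fset.
have dJ : [disjoint J0 & (J0 `|` J1) `\` J0]%fset by apply/fdisjointP => i iJ; rewrite !inE iJ.
move=> /(_ dJ).
rewrite (big_fset_inter_diff (J0 `|` J1)%fset J0) (fsetIidPr (fsubsetUl J0 J1)).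
move=> h2 h3.
have -> : s - \sum_(i <- J0) u i =
  - (\sum_(i <- J0) u i + \sum_(i <- ((J0 `|` J1) `\` J0)%fset) u i - s)
  + \sum_(i <- ((J0 `|` J1) `\` J0)%fset) u i by ring.
rewrite (le_lt_trans (ler_normD _ _))// normrN ltrD//.
exact: le_lt_trans (ler_norm_sum _ _ _) h2.
Qed.

Lemma sum_eventually_small (T : Type) (r : seq T) (F : nat -> T -> C) (e : C) : 0 < e ->
  (forall i, forall e : C, 0 < e -> exists N1, forall N, (N1 <= N)%N -> `|F N i| < e) ->
  exists N1, forall N, (N1 <= N)%N -> \sum_(i <- r) `|F N i| < e.
Proof.
move=> + hF; elim: r e => [|i r IH] e e0.
  by exists 0%N => N _; rewrite big_nil.
have e20 : 0 < e / 2 by rewrite divr_gt0.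
have [N1 h1] := IH _ e20; have [N2 h2] := hF i _ e20.
exists (maxn N1 N2) => N; rewrite geq_max => /andP[/h1 ? /h2 ?].
by rewrite big_cons (splitr e) ltrD.
Qed.

(** Dominated convergence for the counting measure: outside one finite set, all
    the families are uniformly small. *)
Lemma has_sum_dominated I (F : nat -> I -> C) (f M : I -> C) s :
  abs_summable M ->
  (forall N i, `|F N i| <= `|M i|) ->
  (forall N, has_sum (F N) s) ->
  (forall i, forall e : C, 0 < e -> exists N1, forall N, (N1 <= N)%N -> `|F N i - f i| < e) ->
  has_sum f s.
Proof.
move=> sM FM Fs Ff.
have fM i : `|f i| <= `|M i|.
  rewrite -normC_Re -[leRHS]normC_Re lecR; apply/ler_addgt0Pr => e e0.
  have [N1 /(_ N1 (leqnn _)) h] := Ff i e%:C (etrans (ltr0C e) e0).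
  rewrite -lecR rmorphD/= !normC_Re.
  have -> : f i = F N1 i - (F N1 i - f i) by ring.
  by rewrite (le_trans (ler_normB _ _))// lerD// ltW.
have [t ft] : exists t, has_sum f t.
  by apply: abs_summableP; apply: (abs_summable_le (J0 := fset0)) sM => i _.
suff -> : s = t by [].
(* 5 = 2 + 1 + 2: the tails of the two sums and the finite part. *)
apply: (@eq_of_dist _ _ 5) => // e e0.
have [J0 hJ0] := has_sum_tail sM e0.
have tail (g : I -> C) : (forall i, `|g i| <= `|M i|) ->
    forall J : {fset I}, [disjoint J0 & J]%fset -> \sum_(i <- J) `|g i| < e.
  by move=> gM J dJ; apply: le_lt_trans (hJ0 J dJ); apply: ler_sum.
have h1 := has_sum_dist_tail e0 ft (tail _ fM).
have [N1 /(_ N1 (leqnn _)) h2] := sum_eventually_small J0 e0 (F := fun N i => F N i - f i) Ff.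
have h3 := has_sum_dist_tail e0 (Fs N1) (tail _ (FM N1)).
have -> : s - t = (s - \sum_(i <- J0) F N1 i) + (\sum_(i <- J0) (F N1 i - f i)) - (t - \sum_(i <- J0) f i).
  by rewrite sumrB; ring.
have -> : e * 5 = (e + e) + e + (e + e) by ring.
rewrite (le_lt_trans (ler_normB _ _))// ltrD//.
rewrite (le_lt_trans (ler_normD _ _))// ltrD//.
exact: le_lt_trans (ler_norm_sum _ _ _) h2.
Qed.

(** The functions with values in [S] form a box, over which a sum of products is
    the product of the sums. *)
Lemma box_fset (K : finType) I (S : {fset I}) : exists B : {fset {ffun K -> I}},
  (forall f, (f \in B) = [forall k, f k \in S]) /\
  forall F : K -> I -> C, \sum_(f <- B) \prod_k F k (f k) = \prod_k \sum_(i <- S) F k i.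
Proof.
pose g (h : {ffun K -> S}) : {ffun K -> I} := [ffun k => val (h k)].
exists [fset g h | h in {: {ffun K -> S}}]%fset; split => [f|F].
  apply/imfsetP/forallP => [[h _ ->] k|fS]; first by rewrite ffunE; exact: fsvalP.
  exists [ffun k => [` fS k]%fset] => //.
  by apply/ffunP => k; rewrite !ffunE.
rewrite big_imfset/=; last first.
  by move=> h h' _ _ /ffunP hh; apply/ffunP => k; apply: val_inj; have := hh k; rewrite !ffunE.
under [in RHS]eq_bigr do rewrite big_seq_fsetE/=.
rewrite bigA_distr_bigA/= big_enum/=; apply: eq_bigr => h _.
by apply: eq_bigr => k _; rewrite ffunE.
Qed.

(** Every finite set of functions lies in a box, so boxes compute the sum of the
    products, while the sums over boxes converge to the product of the sums. *)
Lemma has_sum_prod (K : finType) I (u : K -> I -> C) (s : K -> C) :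
  (forall k, has_sum (u k) (s k)) ->
  has_sum (fun f : {ffun K -> I} => \prod_k u k (f k)) (\prod_k s k).
Proof.
move=> us.
have [M hM] : exists M : K -> C, forall k (J : {fset I}), \sum_(i <- J) `|u k i| <= M k.
  have := fun k => has_sum_abs (us k) => /choice[M hM]; by exists M.
have /abs_summableP[t ht] : abs_summable (fun f : {ffun K -> I} => \prod_k u k (f k)).
  exists (\prod_k M k) => J.
  pose S := (\bigcup_(f <- J) [fset f k | k in K])%fset.
  have [B [BE BS]] := @box_fset K I S.
  apply: (@le_trans _ _ (\sum_(f <- B) \prod_k `|u k (f k)|)).
    under eq_bigr do rewrite normr_prod.
    apply: ler_sum_fset => [f|]; first exact: prodr_ge0.
    apply/fsubsetP => f fJ; rewrite BE; apply/forallP => k.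
    apply/bigfcupP; exists f; first by rewrite fJ.
    by apply/imfsetP; exists k.
  by rewrite (BS (fun k i => `|u k i|)); apply: ler_prod => k _; rewrite hM sumr_ge0.
suff <- : t = \prod_k s k by [].
have cvgp : (fun S : {fset I} => \prod_k (\sum_(i <- S) u k i) : C^o) @ totally --> (\prod_k s k : C^o).
  elim: (index_enum K) => [|k r IH].
    rewrite (_ : (fun _ => _) = fun=> 1) ?big_nil; first exact: cvg_cst.
    by apply/funext => S; rewrite big_nil.
  have E : (fun S : {fset I} => \sum_(i <- S) u k i : C^o) @ totally --> (s k : C^o).
    rewrite (_ : (fun _ => _) = partial_sum (u k : I -> C^o)); first exact: us.
    by apply/funext => S; rewrite /partial_sum big_seq_fsetE.
  rewrite big_cons (_ : (fun _ => _) = fun S : {fset I} =>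
    (\sum_(i <- S) u k i) * (\prod_(l <- r) \sum_(i <- S) u l i) : C^o).
    exact: (cvgM E IH).
  by apply/funext => S; rewrite big_cons.
(* A box that is large for both limits at once. *)
apply: (@eq_of_dist _ _ 2) => // e e0.
have [J0 h0] := (has_sumP _ _).1 ht e e0.
have [S0 _ /(_ _ (fsubsetUl _ _)) h1] := @cvgr_dist_lt _ _ _ _ _ _ _ cvgp e e0.
have {}h1 := h1 (\bigcup_(f <- J0) [fset f k | k in K])%fset.
set S := (S0 `|` _)%fset in h1.
have [B [BE BS]] := @box_fset K I S.
have {}h0 : `|\sum_(f <- B) \prod_k u k (f k) - t| < e.
  apply: h0; apply/fsubsetP => f fJ; rewrite BE; apply/forallP => k.
  rewrite in_fsetU; apply/orP; right; apply/bigfcupP; exists f; first by rewrite fJ.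
  by apply/imfsetP; exists k.
rewrite BS in h0; rewrite distrC in h1.
have -> : t - \prod_k s k = (\prod_k (\sum_(i <- S) u k i) - \prod_k s k) - (\prod_k (\sum_(i <- S) u k i) - t) by ring.
by rewrite mulr_natr mulr2n (le_lt_trans (ler_normB _ _))// ltrD.
Qed.

End LimitsAndProducts.

(** * The complex exponential *)

Section Exp.
Local Open Scope complex_scope.
Local Open Scope ring_scope.
Variable R : realType.
Local Notation C := R[i].
Implicit Types (z u w : C).

Lemma cexpD z w : cexp (z + w) = cexp z * cexp w.
Proof.
case: z w => [a b] [c d]; rewrite /cexp /= expRD cosD sinD.
by apply/eqP; rewrite eq_complex /=; apply/andP; split; apply/eqP; ring.
Qed.

Lemma cexp0 : cexp (0 : C) = 1.
Proof. by rewrite /cexp /= expR0 cos0 sin0 mulr1 mulr0. Qed.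

Lemma norm_cexp z : `|cexp z| = (expR (complex.Re z))%:C.
Proof.
rewrite normc_def /= !exprMn -mulrDr cos2Dsin2 mulr1 sqrtr_sqr ger0_norm//.
Qed.

Lemma cexp_neq0 z : cexp z != 0.
Proof. by rewrite -normr_eq0 norm_cexp gt_eqF// ltr0C expR_gt0. Qed.

Lemma cexpN z : cexp (- z) = (cexp z)^-1.
Proof.
apply: (mulfI (cexp_neq0 z)); rewrite -cexpD subrr cexp0 divff//; exact: cexp_neq0.
Qed.

Lemma cexpMn z n : cexp z ^+ n = cexp (n%:R * z).
Proof.
elim: n => [|n IH]; first by rewrite expr0 mul0r cexp0.
by rewrite exprS IH -cexpD -(natr1 n); congr cexp; ring.
Qed.

Lemma cexp_sum (T : Type) (r : seq T) (F : T -> C) :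
  \prod_(i <- r) cexp (F i) = cexp (\sum_(i <- r) F i).
Proof. by elim: r => [|i r IH]; rewrite ?big_nil ?cexp0// !big_cons IH cexpD. Qed.

Definition exp2ipi z : C := cexp ('i%C * (2 * pi)%:C * z).

Lemma exp2ipiD z w : exp2ipi (z + w) = exp2ipi z * exp2ipi w.
Proof. by rewrite /exp2ipi mulrDr cexpD. Qed.
Lemma exp2ipi0 : exp2ipi 0 = 1.
Proof. by rewrite /exp2ipi mulr0 cexp0. Qed.
Lemma exp2ipiN z : exp2ipi (- z) = (exp2ipi z)^-1.
Proof. by rewrite /exp2ipi mulrN cexpN. Qed.
Lemma exp2ipiMn z n : exp2ipi z ^+ n = exp2ipi (n%:R * z).
Proof. by rewrite /exp2ipi cexpMn; congr cexp; ring. Qed.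
Lemma exp2ipi_neq0 z : exp2ipi z != 0.
Proof. exact: cexp_neq0. Qed.

Lemma exp2ipi1 : exp2ipi 1 = 1.
Proof.
have -> : exp2ipi 1 = cexp (0 +i* (pi *+ 2)).
  congr cexp; rewrite mulr1; apply/eqP; rewrite eq_complex/=.
  by rewrite -mulr_natl; apply/andP; split; apply/eqP; ring.
by rewrite /cexp/= expR0 cos2pi sin2pi mulr0 mulr1.
Qed.

Lemma exp2ipi_int (k : int) : exp2ipi k%:~R = 1.
Proof.
have hn (n : nat) : exp2ipi n%:R = 1 by rewrite -[n%:R]mulr1 -exp2ipiMn exp2ipi1 expr1n.
by case: k => n; rewrite ?NegzE ?rmorphN/= ?exp2ipiN -pmulrn hn ?invr1.
Qed.

Lemma exp2ipiDint z (k : int) : exp2ipi (z + k%:~R) = exp2ipi z.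
Proof. by rewrite exp2ipiD exp2ipi_int mulr1. Qed.

Lemma exp2ipi_half : exp2ipi (2^-1) = -1.
Proof.
have -> : exp2ipi 2^-1 = cexp (0 +i* pi).
  congr cexp; have -> : (2^-1 : C) = (2^-1 : R)%:C by rewrite fmorphV rmorphD rmorph1.
  apply/eqP; rewrite eq_complex/=.
  by apply/andP; split; apply/eqP; field.
rewrite /cexp/= expR0 cospi sinpi mulr0 mul1r.
by apply/eqP; rewrite eq_complex/= oppr0 !eqxx.
Qed.

Lemma Re_exponent z : complex.Re ('i%C * (2 * pi)%:C * z) = - (2 * pi * complex.Im z).
Proof. by case: z => a b /=; ring. Qed.
Lemma Im_exponent z : complex.Im ('i%C * (2 * pi)%:C * z) = 2 * pi * complex.Re z.
Proof. by case: z => a b /=; ring. Qed.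

Lemma norm_exp2ipi z : `|exp2ipi z| = (expR (- (2 * pi * complex.Im z)))%:C.
Proof. by rewrite norm_cexp Re_exponent. Qed.

Lemma ltC1 (x : R) : (x%:C < 1 :> C) = (x < 1).
Proof. exact: ltcR. Qed.

Lemma eqC1 (x : R) : (x%:C == 1 :> C) = (x == 1).
Proof. exact: (inj_eq (@complexI R)). Qed.

Lemma norm_exp2ipi_lt1 z : 0 < complex.Im z -> `|exp2ipi z| < 1.
Proof.
move=> z0; rewrite norm_exp2ipi ltC1 expR_lt1 oppr_lt0.
by rewrite mulr_gt0// mulr_gt0// pi_gt0.
Qed.

Lemma exp2ipi_neq1 z : complex.Im z != 0 -> exp2ipi z != 1.
Proof.
apply: contra_neq => h; have := norm_exp2ipi z; rewrite h normr1 => /esym/eqP.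
rewrite eqC1 -[X in _ == X]expR0 => /eqP/expR_inj/eqP.
rewrite oppr_eq0 !mulf_eq0.
by rewrite pnatr_eq0 (gt_eqF (pi_gt0 R)) => /eqP.
Qed.

Lemma nome_sqr z : nome z ^+ 2 = exp2ipi z.
Proof. by rewrite /nome -complexiE cexpMn; congr cexp; rewrite rmorphM rmorph_nat /=; ring. Qed.

End Exp.

(** * Sums over the natural numbers *)

Section Geometric.
Local Open Scope complex_scope.
Local Open Scope ring_scope.
Variable R : realType.
Local Notation C := R[i].

Lemma has_sum_nat_lt (f : nat -> C) m :
  has_sum (fun n => if (n < m)%N then f n else 0) (\sum_(n < m) f n).
Proof.
have := @has_sum_big R nat nat (index_iota 0 m) xpredT
  (fun k n => if n == k then f k else 0) f.
rewrite big_mkord => h; apply: eq_has_sum (h _) => [n|k _].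
  case: ltnP => nm.
    rewrite (bigD1_seq n) ?mem_index_iota ?iota_uniq//= eqxx big1 ?addr0// => k.
    by rewrite eq_sym => /negPf ->.
  rewrite big1_seq// => k; rewrite mem_index_iota => /= km; case: eqP => // nk.
  by rewrite -nk ltnNge nm in km.
have := @has_sum_single R _ (fun n => if n == k then f k else 0) k.
by rewrite eqxx; apply=> n /negPf ->.
Qed.

Lemma abs_summable_nat (f : nat -> C) (M : C) :
  (forall m, \sum_(n < m) `|f n| <= M) -> abs_summable f.
Proof.
move=> hM; exists M => J.
apply: (@le_trans _ _ (\sum_(n < (\max_(j <- J) j).+1) `|f n|)) => //.
rewrite -(big_mkord xpredT (fun n => `|f n|)).
rewrite [leRHS](_ : _ = \sum_(n <- [fset k in index_iota 0 (\max_(j <- J) j).+1]%fset) `|f n|).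
  apply: ler_sum_fset => //; apply/fsubsetP => j jJ.
  apply/imfsetP; exists j => //=; rewrite mem_index_iota ltnS leq0n/=; exact: (@leq_bigmax_seq _ (enum_fset J) xpredT id j jJ isT).
apply: perm_big; apply: uniq_perm; rewrite ?iota_uniq ?fset_uniq// => j.
by apply/idP/imfsetP => [jr|[k /= kr ->]//]; exists j.
Qed.

Lemma has_sum_natS (f : nat -> C) s : has_sum (fun n => f n.+1) s <-> has_sum f (f 0%N + s).
Proof.
have h0 : has_sum (fun n => if n == 0%N then f 0%N else 0) (f 0%N).
  have := @has_sum_single R _ (fun n => if n == 0%N then f 0%N else 0) 0%N.
  by rewrite eqxx; apply=> n /negPf ->.
have Si : injective S by move=> a b [].
have S0 j : (forall i, i.+1 != j) -> (if j == 0%N then 0 else f j) = 0.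
  by case: j => // n /(_ n); rewrite eqxx.
have key t : has_sum (fun n => f n.+1) t <-> has_sum (fun n => if n == 0%N then 0 else f n) t.
  by split; [exact: has_sum_extend Si S0|exact: (has_sum_restrict Si S0)].
rewrite key; split => h.
  by apply: eq_has_sum (has_sumD h0 h) => -[|n] /=; rewrite ?addr0 ?add0r.
have := has_sumD h (has_sumZ (-1) h0); rewrite mulN1r addrAC subrr add0r.
by apply: eq_has_sum => -[|n] /=; rewrite ?mulr0 ?addr0 ?mulN1r ?subrr.
Qed.

(** Once both series are known to converge, their sums are determined by the
    functional equations obtained by shifting the index by one. *)
Lemma has_sum_geometric_deriv (w : C) : `|w| < 1 ->
  has_sum (fun k : nat => k%:R * w ^+ k) (w / (1 - w) ^+ 2).
Proof.
move=> w1; set r := `|w|.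
have r0 : 0 <= r by exact: normr_ge0.
have r1 : 0 < 1 - r by rewrite subr_gt0.
have hs1 m : \sum_(k < m) r ^+ k <= (1 - r)^-1.
  rewrite -[leRHS]mul1r ler_pdivlMr// mulrC -opprB mulNr -subrX1 opprB gerBl.
  exact: exprn_ge0.
have hs2 m : (1 - r) ^+ 2 * \sum_(k < m) k%:R * r ^+ k = r - r ^+ m * (m%:R * (1 - r) + r).
  elim: m => [|m IH]; first by rewrite big_ord0; ring.
  by rewrite big_ord_recr mulrDr IH [r ^+ m.+1]exprS -natr1/=; ring.
have [g hg] : exists g, has_sum (fun k : nat => w ^+ k) g.
  apply/abs_summableP/(@abs_summable_nat _ (1 - r)^-1) => m.
  by under eq_bigr do rewrite normrX; exact: hs1.
have [s hs] : exists s, has_sum (fun k : nat => k%:R * w ^+ k) s.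
  apply/abs_summableP/(@abs_summable_nat _ (r / (1 - r) ^+ 2)) => m.
  under eq_bigr do rewrite normrM normrX normr_nat.
  rewrite ler_pdivlMr ?exprn_gt0// mulrC hs2 gerBl.
  by rewrite mulr_ge0 ?exprn_ge0// addr_ge0// mulr_ge0// ltW.
have g1 : g = 1 + w * g.
  rewrite -[1](expr0 w); apply: (has_sum_unique hg).
  by apply/(has_sum_natS (fun k => w ^+ k)); apply: eq_has_sum ((has_sumZ w hg)) => k /=; rewrite exprS.
have s1 : s = 0 + w * (s + g).
  rewrite -(mul0r (w ^+ 0)); apply: (has_sum_unique hs).
  apply/(has_sum_natS (fun k => k%:R * w ^+ k)).
  by apply: eq_has_sum (has_sumZ w (has_sumD hs hg)) => k /=; rewrite exprS -natr1; ring.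
have n1 : 1 - w != 0.
  by rewrite subr_eq0; apply: contraTneq w1 => <-; rewrite normr1 ltxx.
have eg : g = (1 - w)^-1.
  by apply: (mulIf n1); rewrite mulVf// mulrBr mulr1 {1}g1; ring.
suff -> : w / (1 - w) ^+ 2 = s by [].
have es : s * (1 - w) = w * g by rewrite mulrBr mulr1 {1}s1; ring.
by apply: (mulIf n1); rewrite es eg; field.
Qed.
End Geometric.

(** * The Lipschitz formula *)

Section Cosecant.
Local Open Scope complex_scope.
Local Open Scope ring_scope.
Variable R : realType.
Local Notation C := R[i].
Implicit Types (z u w : C).

(** The function [1 / sin (pi u) ^ 2], in a form whose expansion in powers of
    [exp2ipi u] is geometric. *)
Definition csc2 u : C := - 4 * exp2ipi u / (1 - exp2ipi u) ^+ 2.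

Lemma csc2_int u (k : int) : csc2 (u + k%:~R) = csc2 u.
Proof. by rewrite /csc2 exp2ipiDint. Qed.

(** The duplication formula, from which the Lipschitz formula is derived by
    iteration. *)
Lemma csc2_half u : exp2ipi u != 1 ->
  csc2 u = (csc2 (u / 2) + csc2 ((u + 1) / 2)) / 4.
Proof.
rewrite /csc2 [(u + 1) / 2]mulrDl mul1r exp2ipiD exp2ipi_half.
have -> : exp2ipi u = exp2ipi (u / 2) ^+ 2 by rewrite exp2ipiMn mulrC divfK.
set v := exp2ipi (u / 2) => v1.
have n1 : 1 - v != 0 by apply: contraNneq v1 => /eqP; rewrite subr_eq0 => /eqP <-; rewrite expr1n.
have n2 : 1 + v != 0.
  by apply: contraNneq v1 => /eqP; rewrite addrC addr_eq0 => /eqP ->; rewrite sqrrN expr1n.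
field.
rewrite n1/= mulrN1 opprK n2/=.
have -> : 1 - v ^+ 2 = (1 - v) * (1 + v) by ring.
by rewrite mulf_neq0.
Qed.

Lemma exp2ipi_dyadic_neq1 u (k : int) N : exp2ipi u != 1 -> exp2ipi ((u + k%:~R) / 2 ^+ N) != 1.
Proof.
apply: contraNneq => h; have := exp2ipiMn ((u + k%:~R) / 2 ^+ N) (2 ^ N).
by rewrite h expr1n natrX mulrC divfK ?expf_neq0// exp2ipiDint => <-.
Qed.

Lemma csc2_dyadic u N : exp2ipi u != 1 ->
  csc2 u = (4 ^+ N)^-1 * \sum_(k < (2 ^ N)%N) csc2 ((u + k%:R) / 2 ^+ N).
Proof.
move=> u1; elim: N => [|N IH].
  by rewrite expn0 big_ord1 !expr0 invr1 mul1r addr0 mulr1.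
have -> : (2 ^ N.+1 = 2 ^ N + 2 ^ N)%N by rewrite expnS mul2n addnn.
rewrite IH big_split_ord/= -big_split/= exprS invfM -mulrA [RHS]mulrCA; congr (_ * _).
rewrite mulr_sumr; apply: eq_bigr => k _.
have h2 : (2 : C) ^+ N != 0 by rewrite expf_neq0.
have e1 := exp2ipi_dyadic_neq1 (Posz k) N u1; rewrite -pmulrn in e1.
rewrite (csc2_half e1) mulrC; congr (_ * (csc2 _ + csc2 _)); rewrite exprS; first by field; rewrite h2.
by rewrite natrD natrX; field; rewrite h2.
Qed.

(** Centering the summation range at [0] keeps the real parts of all the arguments
    away from the nonzero integers, the other poles, as [csc2_bound] requires. *)
Lemma csc2_dyadic_sym u N : exp2ipi u != 1 ->
  csc2 u = (4 ^+ N.+1)^-1 * \sum_(k < (2 ^ N)%N) csc2 ((u + k%:R) / 2 ^+ N.+1)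
         + (4 ^+ N.+1)^-1 * \sum_(k < (2 ^ N)%N) csc2 ((u - k.+1%:R) / 2 ^+ N.+1).
Proof.
move=> u1; rewrite {1}(csc2_dyadic N.+1 u1) -mulrDr.
have -> : (2 ^ N.+1 = 2 ^ N + 2 ^ N)%N by rewrite expnS mul2n addnn.
rewrite big_split_ord/=; congr (_ * (_ + _)).
rewrite (reindex_inj rev_ord_inj)/=; apply: eq_bigr => k _.
rewrite -(csc2_int _ (-1)); congr csc2.
have h2 : (2 : C) ^+ N.+1 != 0 by rewrite expf_neq0.
rewrite natrD natrB ?ltn_ord// natrX mulrN1z.
rewrite -[X in _ - X](divff h2) -mulrBl; congr (_ / _).
by rewrite exprS; ring.
Qed.

(** On half the angle, which stays below [3 pi / 8], the cosine is bounded below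
    by [cos (3 pi / 8)], and by the mean value theorem the sine is bounded below by
    a multiple of its argument. *)
Lemma sin_lower : exists2 c : R, 0 < c & forall x : R, `|x| <= 3 / 4 -> c * `|x| <= `|sin (pi * x)|.
Proof.
have p0 : 0 < pi :> R by exact: pi_gt0.
pose t : R := pi * (3 / 8).
have ct : 0 < cos t by apply: cos_gt0_pihalf; rewrite /t; apply/andP; split; lra.
have h1 y : 0 <= y <= t -> cos t * y <= sin y.
  case/andP=> y0 yt; have [->|yn0] := eqVneq y 0; first by rewrite sin0 mulr0.
  have y0' : 0 < y by rewrite lt_def yn0.
  have [|z] := @MVT R (@sin R) (@cos R) 0 y y0'.
    by apply: continuous_subspaceT => x; exact: continuous_sin.
  rewrite in_itv/= => /andP[z0 zy]; rewrite sin0 !subr0 => ->.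
  have tpi : t < pi by rewrite /t; lra.
  by rewrite ler_pM2r// ltW// ltr_cos// ?in_itv/=; lra.
exists (cos t * cos t * pi); first by rewrite !mulr_gt0.
have h2 x : 0 <= x <= 3 / 4 -> cos t * cos t * pi * x <= sin (pi * x).
  move=> /andP[x0 x1].
  have -> : pi * x = (pi * x / 2) *+ 2 by rewrite -mulr_natr; field.
  rewrite sin_mulr2n.
  have h : 0 <= pi * x / 2 <= t by rewrite /t; apply/andP; split; nra.
  have hs := h1 _ h.
  have hc : cos t <= cos (pi * x / 2).
    have [->|n] := eqVneq (pi * x / 2) t; first by [].
    have tpi : t < pi by rewrite /t; lra.
    case/andP: h => h h'; have {}h' : pi * x / 2 < t by rewrite lt_neqAle n.
    by rewrite ltW// ltr_cos// ?in_itv/=; lra.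
  have s0 : 0 <= sin (pi * x / 2) by apply: le_trans hs; case/andP: h => h _; rewrite mulr_ge0// ltW.
  have : cos t * (cos t * (pi * x / 2)) <= cos (pi * x / 2) * sin (pi * x / 2).
    by apply: ler_pM => //; [exact: ltW|case/andP: h => h _; rewrite mulr_ge0// ltW].
  by rewrite -mulr_natr; lra.
move=> x; have [x0|x0] := leP 0 x.
  by rewrite (ger0_norm x0) => x1; apply: le_trans (ler_norm _); apply: h2; rewrite x0.
rewrite (ltr0_norm x0) => x1; rewrite -normrN -sinN -mulrN.
by apply: le_trans (ler_norm _); apply: h2; rewrite x1 andbT; lra.
Qed.

End Cosecant.

Section Cosecant.
Local Open Scope complex_scope.
Local Open Scope ring_scope.
Variable R : realType.
Local Notation C := R[i].
Implicit Types (z u w : C).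

(** This form exhibits the denominator of [csc2] as a sum of two squares, one
    controlled by the imaginary and the other by the real part of [h]. *)
Lemma norm_1Bexp2ipi (h : C) (E := expR (- (2 * pi * complex.Im h))) :
  `|1 - exp2ipi h| ^+ 2 = ((1 - E) ^+ 2 + 4 * E * sin (pi * complex.Re h) ^+ 2)%:C.
Proof.
have Ereal : complex.Re ('i%C * (2 * pi)%:C * h) = - (2 * pi * complex.Im h) by exact: Re_exponent.
have Eimag : complex.Im ('i%C * (2 * pi)%:C * h) = (pi * complex.Re h) *+ 2.
  by rewrite Im_exponent -mulr_natl; ring.
rewrite -add_Re2_Im2 /exp2ipi /cexp Ereal Eimag -/E; congr (_ %:C) => /=.
rewrite cos_mulr2n sin_mulr2n cos2sin2; set s := sin _; set c := cos _.
have -> : (0 - E * ((c * s) *+ 2)) ^+ 2 = 4 * E ^+ 2 * s ^+ 2 * c ^+ 2 by rewrite -mulr_natr; ring.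
by rewrite /c cos2sin2 -/s -mulr_natr; ring.
Qed.

(** The two squares of [norm_1Bexp2ipi] are bounded below by multiples of
    [4 E (Im h) ^ 2] and [4 E (Re h) ^ 2], where [E] is the norm of
    [exp2ipi h]; so [csc2] is dominated by its double pole. *)
Lemma csc2_bound : exists2 K : R, 0 < K &
  forall h : C, `|complex.Re h| <= 3 / 4 -> h != 0 -> `|csc2 h| <= K%:C / `|h| ^+ 2.
Proof.
have [c c0 hc] := sin_lower R.
exists (1 + c ^- 2); first by rewrite addr_gt0// invr_gt0 exprn_gt0.
move=> h /hc; set x := complex.Re h; set y := complex.Im h; set s := sin _ => hs h0.
set E := expR (- (2 * pi * y)).
have E0 : 0 < E by exact: expR_gt0.
(* The two parts of the denominator control the two coordinates of h. *)
have hx : x ^+ 2 <= c ^- 2 * s ^+ 2.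
  rewrite mulrC ler_pdivlMr ?exprn_gt0// -(real_normK (num_real x)) -(real_normK (num_real s)) mulrC -exprMn.
  by rewrite ler_pXn2r// nnegrE// mulr_ge0// ltW.
have hy : 4 * E * y ^+ 2 <= (1 - E) ^+ 2.
  set e := expR (pi * y).
  have e0 : 0 < e by exact: expR_gt0.
  have EE : E = e ^- 2.
    by rewrite /E expRN expr2 -expRD; congr (_ ^-1); congr expR; ring.
  have h2 : (pi * y) ^+ 2 <= (e - e^-1) ^+ 2.
    have hp (a : R) : 0 <= a -> a ^+ 2 <= (expR a - expR (- a)) ^+ 2.
      move=> a0; have := expR_ge1Dx a.
      have : expR (- a) <= 1 by rewrite -expR0 ler_expR; lra.
      by move=> h1 h2; rewrite ler_pXn2r ?nnegrE//; lra.
    rewrite /e -expRN; have [y0|y0] := leP 0 (pi * y); first exact: hp.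
    have -> : (expR (pi * y) - expR (- (pi * y))) ^+ 2 = (expR (- (pi * y)) - expR (pi * y)) ^+ 2 by ring.
    by have := hp (- (pi * y)); rewrite sqrrN opprK; apply; lra.
  have h3 : 4 * y ^+ 2 <= (pi * y) ^+ 2.
    rewrite exprMn ler_wpM2r ?sqr_ge0//.
    by have := @pi_ge2 R => p2; have : 2 * 2 <= pi * pi :> R; [exact: ler_pM|lra].
  have -> : (1 - E) ^+ 2 = E * (e - e^-1) ^+ 2 by rewrite EE; field; rewrite gt_eqF.
  by rewrite mulrAC mulrC ler_pM2l//; lra.
have nh : `|h| ^+ 2 = (x ^+ 2 + y ^+ 2)%:C by rewrite add_Re2_Im2.
have xy : 0 < x ^+ 2 + y ^+ 2 by rewrite -ltr0C -nh exprn_gt0// normr_gt0.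
have D0 : 0 < (1 - E) ^+ 2 + 4 * E * s ^+ 2.
  have : 0 < 4 * E * (x ^+ 2 + y ^+ 2) by rewrite !mulr_gt0.
  have := sqr_ge0 s; have := sqr_ge0 (1 - E).
  have : 4 * E * x ^+ 2 <= 4 * E * (c ^- 2 * s ^+ 2) by rewrite ler_pM2l// mulr_gt0.
  move=> h1 h2 h3 h4; rewrite lt_neqAle eq_sym; apply/andP; split; last first.
    by rewrite addr_ge0// mulr_ge0// mulr_ge0// ltW.
  apply/negP => /eqP D; have z : (1 - E) ^+ 2 = 0 /\ 4 * E * s ^+ 2 = 0.
    have : 0 <= 4 * E * s ^+ 2 by rewrite mulr_ge0// mulr_ge0// ltW.
    lra.
  have : 4 * E * (c ^- 2 * s ^+ 2) = 0 by rewrite mulrCA z.2 mulr0.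
  lra.
rewrite /csc2 normrM normfV normrX norm_1Bexp2ipi nh -/x -/y -/s -/E.
rewrite normrM normrN normr_nat norm_exp2ipi -/y -/E.
have -> : (4 : C) = (4 : R)%:C by rewrite rmorph_nat.
rewrite -rmorphM -!fmorphV -!rmorphM lecR ler_pdivlMr// mulrAC ler_pdivrMr// mulrDr.
have h1 : 4 * E * x ^+ 2 <= 4 * E * (c ^- 2 * s ^+ 2) by rewrite ler_pM2l// mulr_gt0.
apply: (le_trans (lerD h1 hy)); rewrite [leRHS]mulrDl !mul1r mulrDr.
have h2 : 0 <= 4 * E * s ^+ 2 by rewrite mulr_ge0 ?sqr_ge0// mulr_ge0// ltW.
have h3 : 0 <= c ^- 2 * (1 - E) ^+ 2 by rewrite mulr_ge0 ?sqr_ge0// invr_ge0 ltW// exprn_gt0.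
have -> : c ^- 2 * (4 * E * s ^+ 2) = 4 * E * (c ^- 2 * s ^+ 2) by ring.
lra.
Qed.

Lemma dyadic_derivative (f : R -> R) (df : R) : is_derive (0 : R) 1 f df ->
  forall e : R, 0 < e -> exists N1, forall N, (N1 <= N)%N ->
  `|2 ^+ N * (f (2 ^- N) - f 0) - df| < e.
Proof.
move=> [dv <-] e e0.
have := @cvgr_dist_lt _ _ _ _ _ _ _ dv e e0.
rewrite near_withinE => hd0. have [d /= d0 hd] := (nbhs_ballP _ _).1 (hd0 _).
have z1 : `|2^-1 : R| < 1 by rewrite ger0_norm ?invr_ge0// invf_lt1// ltr1n.
have := @cvgr_dist_lt _ _ _ _ _ _ _ (cvg_expr z1) d d0.
case=> N1 _ hN; exists N1 => N NN.
have h2 : (2 : R) ^- N != 0 by rewrite invr_eq0 expf_neq0.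
have /= := hd (2 ^- N) _ h2.
rewrite invrK distrC addr0 /GRing.scale/= mulr1; apply.
by rewrite /ball/= distrC subr0 -exprVn -normrN -sub0r; apply: hN.
Qed.

(** The derivative of the exponential at [0], along the dyadic sequence in which
    it is needed. *)
Lemma cexp_derivative z (e : C) : 0 < e -> exists N1, forall N, (N1 <= N)%N ->
  `|2 ^+ N * (cexp (z / 2 ^+ N) - 1) - z| < e.
Proof.
move=> e0; have eR : (complex.Re e)%:C = e by rewrite RRe_real// gtr0_real.
have e20 : 0 < complex.Re e / 2 by rewrite divr_gt0// -ltr0C eR.
have dRe : is_derive (0 : R) 1 (fun t => expR (t * complex.Re z) * cos (t * complex.Im z)) (complex.Re z).
  apply: is_derive_eq.
  by rewrite !mul0r expR0 cos0 sin0 !scaler1; rewrite /GRing.scale/=; ring.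
have dIm : is_derive (0 : R) 1 (fun t => expR (t * complex.Re z) * sin (t * complex.Im z)) (complex.Im z).
  apply: is_derive_eq.
  by rewrite !mul0r expR0 cos0 sin0 !scaler1; rewrite /GRing.scale/=; ring.
have [N1 h1] := dyadic_derivative dRe e20.
have [N2 h2] := dyadic_derivative dIm e20.
exists (maxn N1 N2) => N; rewrite geq_max => /andP[/h1 {}h1 /h2 {}h2].
rewrite -normC_Re -eR ltcR (splitr (complex.Re e)).
apply: le_lt_trans (norm_le_ReIm _) _.
have E : z / 2 ^+ N = (2 ^- N * complex.Re z) +i* (2 ^- N * complex.Im z).
  have -> : (2 : C) ^+ N = (2 ^+ N)%:C by rewrite rmorphXn rmorph_nat.
  by rewrite -fmorphV; case: z {dRe dIm h1 h2} => a b; apply/eqP; rewrite eq_complex/=; apply/andP; split; apply/eqP; ring.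
rewrite E /cexp/=.
have -> : (2 : C) ^+ N = (2 ^+ N)%:C by rewrite rmorphXn rmorph_nat.
rewrite !mul0r expR0 cos0 sin0 mulr0 mulr1 subr0 in h1 h2.
rewrite ltrD//.
  move: h1; congr (`|_| < _); case: z {E dRe dIm h2} => a b /=; ring.
move: h2; congr (`|_| < _); case: z {E dRe dIm h1} => a b /=; ring.
Qed.
End Cosecant.

Section Lipschitz.
Local Open Scope complex_scope.
Local Open Scope ring_scope.
Variable R : realType.
Local Notation C := R[i].
Implicit Types (z u w : C).

Lemma has_sum_int (f : int -> C) s t :
  has_sum (fun n => f (Posz n)) s -> has_sum (fun n => f (Negz n)) t -> has_sum f (s + t).
Proof.
pose f1 k := if k is Posz n then f k else 0.
pose f2 k := if k is Negz n then f k else 0.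
move=> hs ht.
have h1 : has_sum f1 s.
  have Pi : injective Posz by move=> a b [].
  apply: (has_sum_extend Pi); last exact: hs.
  by case=> [n /(_ n)|n _ //]; rewrite eqxx.
have h2 : has_sum f2 t.
  have Ni : injective Negz by move=> a b [].
  apply: (has_sum_extend Ni); last exact: ht.
  by case=> [n _ //|n /(_ n)]; rewrite eqxx.
by apply: eq_has_sum (has_sumD h1 h2) => -[n|n]; rewrite /f1/f2 ?addr0 ?add0r.
Qed.

Lemma abs_summable_int (f : int -> C) :
  abs_summable (fun n => f (Posz n)) -> abs_summable (fun n => f (Negz n)) -> abs_summable f.
Proof. by move=> /abs_summableP[s hs] /abs_summableP[t ht]; exact: has_sum_abs (has_sum_int hs ht). Qed.

(** [Posz n] and [Negz n], that is [n] and [- n - 1], share an index, so that the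
    integers of index less than [m] are those of [-m, m - 1]. *)
Definition int_index (k : int) : nat := match k with Posz n | Negz n => n end.

Lemma int_index_fset m : exists J : {fset int}, forall k, k \notin J -> (m <= int_index k)%N.
Proof.
exists ([fset Posz n | n in iota 0 m] `|` [fset Negz n | n in iota 0 m])%fset => -[n|n] /=;
  apply: contraR; rewrite -ltnNge => nm; rewrite in_fsetU; apply/orP.
  by left; apply/imfsetP; exists n => //=; rewrite mem_iota.
by right; apply/imfsetP; exists n => //=; rewrite mem_iota.
Qed.

Lemma int_index_le (k : int) : (int_index k)%:R <= `|k%:~R : R|.
Proof.
by case: k => n; rewrite ?NegzE ?rmorphN/= ?normrN -pmulrn normr_nat ler_nat.
Qed.

Lemma int_index_ge (k : int) m : (int_index k < m)%N -> `|k%:~R : R| <= m%:R.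
Proof.
by case: k => n /= nm; rewrite ?NegzE ?rmorphN/= ?normrN -pmulrn normr_nat ler_nat// ltnW.
Qed.

(** The sequence [(n + 1) ^ (- 3 / 2)]: it is summable, and the decay
    of the lattice sum, of exponent [- 3], suffices for a product of two such
    factors, one for each coordinate. *)
Definition three_halves (n : nat) : R := (n.+1%:R * Num.sqrt n.+1%:R)^-1.

Lemma three_halves_gt0 n : 0 < three_halves n.
Proof. by rewrite invr_gt0 mulr_gt0// ?sqrtr_gt0 ltr0n. Qed.

(** By induction the partial sums are at most [3 - 2 / sqrt m]: the sequence
    telescopes against [2 / sqrt m]. *)
Lemma abs_summable_three_halves : abs_summable (fun n => (three_halves n)%:C).
Proof.
apply: (@abs_summable_nat R _ 3%:C) => m.
have -> : \sum_(n < m) `|(three_halves n)%:C : C| = (\sum_(n < m) three_halves n)%:C.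
  by rewrite rmorph_sum; apply: eq_bigr => n _; rewrite ger0_norm// lecR ltW// three_halves_gt0.
rewrite lecR; case: m => [|m]; first by rewrite big_ord0.
suff h : \sum_(n < m.+1) three_halves n <= 3 - 2 / Num.sqrt m.+1%:R.
  by apply: (le_trans h); rewrite gerBl divr_ge0// sqrtr_ge0.
elim: m => [|m IH].
  by rewrite big_ord1 /three_halves sqrtr1 mulr1 invr1; lra.
rewrite big_ord_recr/=; apply: (le_trans (lerD IH (lexx _))).
rewrite /three_halves; set b := Num.sqrt m.+2%:R; set a := Num.sqrt m.+1%:R.
have a0 : 0 < a by rewrite sqrtr_gt0 ltr0n.
have b0 : 0 < b by rewrite sqrtr_gt0 ltr0n.
have bb : m.+2%:R = b ^+ 2 by rewrite sqr_sqrtr.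
have aa : b ^+ 2 - a ^+ 2 = 1 by rewrite !sqr_sqrtr// -(natr1 m.+1) addrAC subrr add0r.
have ab : a < b by rewrite ltr_sqrt ?ltr_nat ?ltr0n.
rewrite bb -lerBrDl -subr_ge0.
have -> : 3 - 2 / b - (3 - 2 / a) - (b ^+ 2 * b)^-1 = (2 * b ^+ 2 * (b - a) - a) / (a * b ^+ 3).
  by field; rewrite !gt_eqF.
rewrite divr_ge0//; last by rewrite mulr_ge0// ?exprn_ge0// ltW.
have -> : 2 * b ^+ 2 * (b - a) - a = (b * (b - a) * (2 * b) - a) by ring.
have e1 : (b - a) * (b + a) = 1 by rewrite -subr_sqr.
have h : 1 <= (b - a) * (2 * b).
  by rewrite -[leLHS]e1 ler_pM2l ?subr_gt0//; lra.
have : b * 1 <= b * ((b - a) * (2 * b)) by rewrite ler_pM2l.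
rewrite mulrA; lra.
Qed.

Lemma inv_sqr_le_three_halves (x : R) n : n.+1%:R <= x -> x ^- 2 <= three_halves n.
Proof.
move=> nx; have x0 : 0 < x by apply: lt_le_trans nx; rewrite ltr0n.
rewrite /three_halves lef_pV2 ?posrE ?exprn_gt0 ?mulr_gt0 ?sqrtr_gt0 ?ltr0n//.
apply: ler_pM => //; apply: le_trans nx.
rewrite -[leRHS]sqr_sqrtr ?ler0n// expr2 ler_peMr ?sqrtr_ge0//.
by rewrite -[leLHS]sqrtr1 ler_wsqrtr// ler1n.
Qed.

Lemma intC (k : int) : (k%:~R : C) = (k%:~R)%:C.
Proof. by rewrite rmorph_int. Qed.

Lemma normC_ge0 z : 0 <= complex.Re `|z|.
Proof. by rewrite -ler0c normC_Re. Qed.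

Lemma norm_int (k : int) : complex.Re `|k%:~R : C| = `|k%:~R|.
Proof. by rewrite intC normc_def/= expr0n addr0 sqrtr_sqr. Qed.

Lemma ler_Re_norm (z : C) (x : R) : (complex.Re `|z| <= x) = (`|z| <= x%:C).
Proof. by rewrite -lecR normC_Re. Qed.

Lemma Re_normM z w : complex.Re `|z * w| = complex.Re `|z| * complex.Re `|w|.
Proof. by apply: (@complexI R); rewrite rmorphM/= !normC_Re normrM. Qed.

Lemma Re_normV z : complex.Re `|z^-1| = (complex.Re `|z| )^-1.
Proof. by apply: (@complexI R); rewrite fmorphV/= !normC_Re normfV. Qed.

Lemma Re_normX z n : complex.Re `|z ^+ n| = (complex.Re `|z| ) ^+ n.
Proof. by apply: (@complexI R); rewrite rmorphXn/= !normC_Re normrX. Qed.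

Lemma Re_norm_realC (x : R) : complex.Re `|x%:C : C| = `|x|.
Proof. by rewrite normc_def/= expr0n addr0 sqrtr_sqr. Qed.

Lemma Re_ler_normD z w : complex.Re `|z + w| <= complex.Re `|z| + complex.Re `|w|.
Proof. by rewrite -lecR rmorphD/= !normC_Re ler_normD. Qed.

Lemma Re_ler_distD z w : complex.Re `|w| - complex.Re `|z| <= complex.Re `|z + w|.
Proof.
rewrite lerBlDr; have {1}-> : w = (z + w) + (- z) by ring.
by rewrite (le_trans (Re_ler_normD _ _))// normrN.
Qed.

(** A form of [abs_summable_le] that leaves only real inequalities to prove. *)
Lemma abs_summable_dom (I : choiceType) (f : I -> C) (v : I -> R) (c : R) (J0 : {fset I}) :
  (forall i, i \notin J0 -> complex.Re `|f i| <= c * v i) ->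
  abs_summable (fun i => (v i)%:C) -> abs_summable f.
Proof.
move=> h /(abs_summableZ c%:C); apply: (abs_summable_le (J0 := J0)) => i /h.
move=> h1; rewrite -rmorphM -[leRHS]normC_Re -ler_Re_norm Re_norm_realC.
by rewrite (le_trans h1)// ler_norm.
Qed.

Lemma abs_summable_int_three_halves :
  abs_summable (fun k : int => (three_halves (int_index k))%:C).
Proof. by apply: abs_summable_int => /=; exact: abs_summable_three_halves. Qed.

Lemma abs_summable_int_sqr u : abs_summable (fun k : int => (u + k%:~R) ^- 2).
Proof.
pose m := Num.bound (2 * complex.Re `|u| + 1).
have hm : 2 * complex.Re `|u| + 1 <= m%:R.
  by apply/ltW/archi_boundP; rewrite addr_ge0// mulr_ge0// normC_ge0.
have [J0 hJ] := int_index_fset m.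
apply: (@abs_summable_dom _ _ (fun k => three_halves (int_index k)) 4 J0); last first.
  exact: abs_summable_int_three_halves.
move=> k /hJ mk; rewrite Re_normV Re_normX.
have h : (int_index k).+1%:R <= 2 * complex.Re `|u + k%:~R|.
  have := Re_ler_distD u k%:~R; rewrite norm_int.
  have := int_index_le k; have : m%:R <= (int_index k)%:R :> R by rewrite ler_nat.
  rewrite -natr1; lra.
have := inv_sqr_le_three_halves h; rewrite exprMn invfM.
have -> : ((2 : R) ^+ 2)^-1 = 4^-1 by rewrite -natrX.
by rewrite mulrC ler_pdivrMr// mulrC.
Qed.

(** Convergence of sequences in the form required by [has_sum_dominated]. *)
Definition seq_limit (f : nat -> C) l :=
  forall e : C, 0 < e -> exists N1, forall N, (N1 <= N)%N -> `|f N - l| < e.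

Lemma seq_limitP f l : seq_limit f l <-> (f : nat -> C^o) @ \oo --> (l : C^o).
Proof.
split=> [h|h e e0].
  by apply/cvgrPdist_lt => e /h[N1 hN]; exists N1 => // N NN /=; rewrite distrC; exact: hN.
have [N1 _ hN] := @cvgr_dist_lt _ _ _ _ _ _ _ h e e0.
by exists N1 => N NN; rewrite distrC; exact: hN.
Qed.

Lemma seq_limit_eq f g l : f =1 g -> seq_limit f l -> seq_limit g l.
Proof. by move=> /funext ->. Qed.

Lemma seq_limit_cst l : seq_limit (fun=> l) l.
Proof. by move=> e e0; exists 0%N => N _; rewrite subrr normr0. Qed.

Lemma seq_limitD f g k l : seq_limit f k -> seq_limit g l ->
  seq_limit (fun N => f N + g N) (k + l).
Proof. by rewrite !seq_limitP => hf hg; exact: (cvgD hf hg). Qed.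

Lemma seq_limitM f g k l : seq_limit f k -> seq_limit g l ->
  seq_limit (fun N => f N * g N) (k * l).
Proof. by rewrite !seq_limitP => hf hg; exact: (cvgM hf hg). Qed.

Lemma seq_limitV f l : l != 0 -> seq_limit f l -> seq_limit (fun N => (f N)^-1) l^-1.
Proof. by rewrite !seq_limitP => l0 hf; exact: (cvgV l0 hf). Qed.

Lemma seq_limit_exp2 : seq_limit (fun N => 2 ^- N) 0.
Proof.
move=> e e0; have eR : (complex.Re e)%:C = e by rewrite RRe_real// gtr0_real.
have z1 : `|2^-1 : R| < 1 by rewrite ger0_norm ?invr_ge0// invf_lt1// ltr1n.
have e1 : 0 < complex.Re e by rewrite -ltr0C eR.
have [N1 _ hN] := @cvgr_dist_lt _ _ _ _ _ _ _ (cvg_expr z1) _ e1.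
exists N1 => N NN; rewrite -eR -normC_Re ltcR subr0 Re_normV Re_normX.
have -> : complex.Re `|2 : C| = 2 by rewrite normr_nat.
by have := hN N NN; rewrite /= sub0r normrN normrX normfV normr_nat exprVn.
Qed.

(** With [Z = 2 i pi v] and [w = exp (Z / 2 ^ N)], the quantity [2 ^ N (w - 1)]
    tends to [Z] and [w] to [1]. *)
Lemma csc2_limit (v : C) : v != 0 ->
  seq_limit (fun N => pi%:C ^+ 2 * ((4 ^+ N)^-1 * csc2 (v / 2 ^+ N))) (v ^- 2).
Proof.
move=> v0; set Z : C := 'i%C * (2 * pi)%:C * v.
have Z0 : Z != 0.
  rewrite /Z !mulf_neq0//.
    by rewrite eq_complex/= oner_eq0 andbF.
  by rewrite eq_complex/= eqxx andbT mulf_neq0// gt_eqF ?pi_gt0.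
pose X N : C := 2 ^+ N * (cexp (Z / 2 ^+ N) - 1).
have XZ : seq_limit X Z by move=> e; exact: cexp_derivative.
have W1 : seq_limit (fun N => cexp (Z / 2 ^+ N)) (1 + Z * 0).
  apply: seq_limit_eq (seq_limitD (seq_limit_cst 1) (seq_limitM XZ seq_limit_exp2)) => N.
  have h2 : (2 : C) ^+ N != 0 by rewrite expf_neq0.
  by rewrite /X; field.
have ZZ0 : Z * Z != 0 by exact: mulf_neq0.
have := seq_limitM (seq_limit_cst (- 4 * pi%:C ^+ 2)) (seq_limitM W1 (seq_limitV ZZ0 (seq_limitM XZ XZ))).
have -> : - 4 * pi%:C ^+ 2 * ((1 + Z * 0) * (Z * Z)^-1) = v ^- 2.
  have -> : Z * Z = - 4 * pi%:C ^+ 2 * v ^+ 2.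
    rewrite /Z rmorphM/= rmorph_nat.
    have -> : 'i%C * (2 * pi%:C) * v * ('i%C * (2 * pi%:C) * v) = 'i%C ^+ 2 * (4 * pi%:C ^+ 2 * v ^+ 2) by ring.
    by rewrite sqr_i; ring.
  have p0 : (pi%:C : C) != 0 by rewrite eq_complex/= eqxx andbT gt_eqF// pi_gt0.
  by move: p0; generalize (pi%:C : C) => P p0; field; rewrite v0 p0.
apply: seq_limit_eq => N; rewrite /csc2 /X.
have -> : exp2ipi (v / 2 ^+ N) = cexp (Z / 2 ^+ N) by rewrite /exp2ipi /Z mulrA.
set w := cexp _.
have -> : (4 : C) ^+ N = 2 ^+ N * 2 ^+ N by rewrite -exprMn -natrM.
have -> : 2 ^+ N * (w - 1) * (2 ^+ N * (w - 1)) = (2 ^+ N * 2 ^+ N) * (1 - w) ^+ 2 by ring.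
by rewrite invfM; ring.
Qed.

(** The partial fraction expansion of [csc2]. Iterating the duplication formula
    writes [csc2 u] as a sum over [-2 ^ N, 2 ^ N - 1], whose terms converge to
    [(pi (u + k)) ^ -2] by [csc2_limit] and are dominated by [csc2_bound]. *)
Lemma has_sum_lipschitz u : exp2ipi u != 1 ->
  has_sum (fun k : int => (u + k%:~R) ^- 2) (pi%:C ^+ 2 * csc2 u).
Proof.
move=> u1; have [K K0 hK] := csc2_bound R.
have uk0 (k : int) : u + k%:~R != 0.
  by apply: contraNneq u1 => h; rewrite -(exp2ipiDint u k) h exp2ipi0.
(* Starting at N0 keeps the real parts of the arguments within 1/2 + 1/4. *)
pose N0 := Num.bound (2 * `|complex.Re u| ).
have hN0 N : 2 * `|complex.Re u| <= 2 ^+ (N + N0).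
  apply: (@le_trans _ _ N0%:R); first by apply/ltW/archi_boundP; rewrite mulr_ge0.
  by rewrite -natrX ler_nat (leq_trans (ltnW (ltn_expl N0 (ltnSn 1))))// leq_exp2l// leq_addl.
pose G N (k : int) : C := pi%:C ^+ 2 * ((4 ^+ (N + N0).+1)^-1 * csc2 ((u + k%:~R) / 2 ^+ (N + N0).+1)).
pose F N (k : int) : C := if (int_index k < 2 ^ (N + N0))%N then G N k else 0.
apply: (@has_sum_dominated R _ F _ (fun k : int => (pi ^+ 2 * K)%:C * (u + k%:~R) ^- 2)).
- exact/abs_summableZ/abs_summable_int_sqr.
- move=> N k; rewrite /F; case: ifPn => [kN|_]; last by rewrite normr0.
  set h := (u + k%:~R) / 2 ^+ (N + N0).+1.
  have Rh : `|complex.Re h| <= 3 / 4.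
    have -> : complex.Re h = (complex.Re u + k%:~R) / 2 ^+ (N + N0).+1.
      rewrite /h intC; have -> : (2 : C) ^+ (N + N0).+1 = (2 ^+ (N + N0).+1)%:C by rewrite rmorphXn rmorph_nat.
      by rewrite -fmorphV; case: (u) => a b /=; ring.
    rewrite normrM normfV normrX normr_nat ler_pdivrMr ?exprn_gt0//.
    have := int_index_ge kN; have := hN0 N; rewrite natrX => h1 h2.
    rewrite (le_trans (ler_normD _ _))// exprS; lra.
  have h0 : h != 0 by rewrite mulf_neq0// invr_eq0 expf_neq0.
  have n4 : `|h| ^+ 2 = `|u + k%:~R| ^+ 2 / 4 ^+ (N + N0).+1.
    rewrite /h normrM normfV normrX normr_nat exprMn exprVn -!exprM mulnC exprM.
    by have -> : (2 : C) ^+ 2 = 4 by rewrite -natrX.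
  rewrite /G normrM normrX normrM normfV normrX normr_nat.
  have -> : `|pi%:C : C| = pi%:C by rewrite ger0_norm// ler0c pi_ge0.
  have -> : `|(pi ^+ 2 * K)%:C * (u + k%:~R) ^- 2| = pi%:C ^+ 2 * ((4 ^+ (N + N0).+1)^-1 * (K%:C / `|h| ^+ 2)).
    rewrite n4 normrM normfV normrX rmorphM rmorphXn/= normrM normrX.
    have -> : `|pi%:C : C| = pi%:C by rewrite ger0_norm// ler0c pi_ge0.
    have -> : `|K%:C : C| = K%:C by rewrite ger0_norm// ler0c ltW.
    have n0 : (4 : C) ^+ (N + N0).+1 != 0 by rewrite expf_neq0.
    have n1 : `|u + k%:~R| != 0 by rewrite normr_eq0.
    by field; rewrite n0 n1.
  rewrite ler_wpM2l ?exprn_ge0 ?ler0c ?pi_ge0// ler_wpM2l ?invr_ge0 ?exprn_ge0//.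
  exact: hK.
- move=> N; rewrite (csc2_dyadic_sym (N + N0) u1) mulrDr; apply: has_sum_int.
    rewrite !mulr_sumr (eq_bigr (fun n : 'I__ => G N (Posz n))); first exact: has_sum_nat_lt.
    by move=> n _; rewrite /G -pmulrn.
  rewrite !mulr_sumr.
  rewrite (eq_bigr (fun n : 'I__ => G N (Negz n))); first exact: has_sum_nat_lt.
  by move=> n _; rewrite /G NegzE rmorphN/= -pmulrn.
- move=> k e e0; have [N1 hN] := csc2_limit (uk0 k) e0.
  exists (maxn N1 (int_index k)) => N; rewrite geq_max => /andP[NN kN].
  rewrite /F ifT; first by apply: hN; rewrite (leq_trans NN)// -addnS leq_addr.
  by rewrite (leq_trans (ltn_expl (int_index k) (ltnSn 1)))// leq_exp2l// (leq_trans kN)// leq_addr.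
Qed.

End Lipschitz.

(** * Double sums, Fourier expansions and zeta(2) *)

Section Fourier.
Local Open Scope complex_scope.
Local Open Scope ring_scope.
Variable R : realType.
Local Notation C := R[i].
Implicit Types (z u w : C).

(** A finite set of pairs is contained in a rectangle. *)
Lemma abs_summable_pair (I J : choiceType) (u : I -> C) (v : J -> C) :
  abs_summable u -> abs_summable v -> abs_summable (fun p : I * J => u p.1 * v p.2).
Proof.
move=> [M hM] [N hN]; exists (M * N) => K.
pose K1 := [fset p.1 | p in K]%fset; pose K2 := [fset p.2 | p in K]%fset.
pose s := [seq (i, j) | i <- enum_fset K1, j <- enum_fset K2].
pose B := [fset p | p in s]%fset.
apply: (@le_trans _ _ (\sum_(p <- B) `|u p.1 * v p.2|)).
  apply: ler_sum_fset => [p|]; first exact: normr_ge0.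
  apply/fsubsetP => -[i j] ijK; apply/imfsetP; exists (i, j) => //=.
  by apply: allpairs_f; apply/imfsetP; exists (i, j).
have -> : \sum_(p <- B) `|u p.1 * v p.2| = \sum_(p <- s) `|u p.1 * v p.2|.
  apply: perm_big; apply: uniq_perm; rewrite ?fset_uniq//.
    by apply: allpairs_uniq; rewrite ?fset_uniq// => -[? ?] [? ?].
  by move=> p; apply/imfsetP/idP => [[q /= qs ->]//|ps]; exists p.
have -> : \sum_(p <- s) `|u p.1 * v p.2| = (\sum_(i <- K1) `|u i|) * \sum_(j <- K2) `|v j|.
  rewrite big_allpairs_dep mulr_suml; apply: eq_bigr => i _.
  by rewrite mulr_sumr; apply: eq_bigr => j _; rewrite normrM.
by apply: ler_pM; rewrite ?sumr_ge0.
Qed.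

Lemma csc2N u : exp2ipi u != 1 -> csc2 (- u) = csc2 u.
Proof.
rewrite /csc2 exp2ipiN; have := exp2ipi_neq0 u; set w := exp2ipi u => w0 w1.
have n1 : 1 - w != 0 by rewrite subr_eq0 eq_sym.
have n2 : w - 1 != 0 by rewrite subr_eq0.
by field; rewrite ?w0 ?n1 ?n2.
Qed.

(** In the upper half plane [exp2ipi u] has norm less than [1]. *)
Lemma csc2_fourier u : 0 < complex.Im u ->
  has_sum (fun k : nat => k%:R * exp2ipi (k%:R * u)) (- csc2 u / 4).
Proof.
move=> u0; have := has_sum_geometric_deriv (norm_exp2ipi_lt1 u0).
have -> : - csc2 u / 4 = exp2ipi u / (1 - exp2ipi u) ^+ 2.
  have n1 : 1 - exp2ipi u != 0 by rewrite subr_eq0 eq_sym exp2ipi_neq1// gt_eqF.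
  by rewrite /csc2; field.
by apply: eq_has_sum => k; rewrite exp2ipiMn.
Qed.

(** The even terms contribute a quarter of the sum and the odd ones, by the
    Lipschitz formula at [1 / 2], contribute [pi ^ 2 / 4]. The term [k = 0]
    counts for zero because the inverse of [0] is [0]. *)
Lemma has_sum_zeta2 : has_sum (fun k : int => (k%:~R : C) ^- 2) (pi%:C ^+ 2 / 3).
Proof.
have [s hs] : exists s, has_sum (fun k : int => (k%:~R : C) ^- 2) s.
  apply: abs_summableP; have := abs_summable_int_sqr (0 : C).
  by rewrite (_ : (fun k : int => _) = fun k : int => (k%:~R : C) ^- 2)//; apply/funext => k; rewrite add0r.
suff -> : pi%:C ^+ 2 / 3 = s by [].
pose f0 (k : int) : C := if (2 %| k)%Z then k%:~R ^- 2 else 0.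
pose f1 (k : int) : C := if (2 %| k)%Z then 0 else k%:~R ^- 2.
have h0 : has_sum f0 (4^-1 * s).
  have ij : injective (fun j : int => 2 * j) by apply: mulfI.
  apply: (has_sum_extend ij) => [k hk|].
    rewrite /f0; case: ifPn => // /dvdzP[j kj].
    by have := hk j; rewrite kj mulrC eqxx.
  apply: eq_has_sum (has_sumZ 4^-1 hs) => j; rewrite /f0 dvdz_mulr//.
  by rewrite rmorphM/= exprMn [in RHS]invfM -natrX.
have h1 : has_sum f1 (4^-1 * (pi%:C ^+ 2 * csc2 2^-1)).
  have ij : injective (fun j : int => 2 * j + 1) by move=> a b /addIr; apply: mulfI.
  apply: (has_sum_extend ij) => [k hk|].
    rewrite /f1; case: ifPn => // k2; have := hk (k %/ 2)%Z.
    have e : 2 * (k %/ 2)%Z + 1 = k by lia.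
    by rewrite e eqxx.
  have h2 : exp2ipi (2^-1 : C) != 1.
    by rewrite exp2ipi_half eq_sym -subr_eq0 opprK -[1 + 1]/(2%:R) pnatr_eq0.
  apply: eq_has_sum (has_sumZ 4^-1 (has_sum_lipschitz h2)) => j.
  rewrite /f1; case: ifPn => [|_]; first by lia.
  rewrite rmorphD rmorphM/=.
  have -> : (2%:~R * j%:~R + 1%:~R : C) = 2 * (2^-1 + j%:~R) by field.
  by rewrite exprMn [in RHS]invfM -natrX.
have e : s = 4^-1 * s + 4^-1 * (pi%:C ^+ 2 * csc2 2^-1).
  apply: (has_sum_unique hs); apply: eq_has_sum (has_sumD h0 h1) => k.
  by rewrite /f0 /f1; case: ifP => _; rewrite ?addr0 ?add0r.
have c : csc2 2^-1 = 1 :> C by rewrite /csc2 exp2ipi_half; field.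
rewrite c mulr1 in e; move: e; generalize (pi%:C : C) => P e.
have -> : P ^+ 2 = 4 * (4^-1 * s + 4^-1 * P ^+ 2) - s by field.
by rewrite -e; field.
Qed.

Lemma has_sum_rows (I J : choiceType) (u : I * J -> C) (v : I -> C) s :
  has_sum u s -> (forall i, has_sum (fun j => u (i, j)) (v i)) -> has_sum v s.
Proof.
move=> us uv; apply: (has_sum_partition us (b := fst)) => i.
have ij : injective (fun j : J => (i, j)) by move=> j k [].
apply: (has_sum_extend ij) => [[i' j] h|]; last by apply: eq_has_sum (uv i) => j /=; rewrite eqxx.
by case: eqP => //= e; have := h j; rewrite -e eqxx.
Qed.

Lemma has_sum_cols (I J : choiceType) (u : I * J -> C) (v : J -> C) s :
  has_sum u s -> (forall j, has_sum (fun i => u (i, j)) (v j)) -> has_sum v s.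
Proof.
move=> us uv; apply: (has_sum_partition us (b := snd)) => j.
have ij : injective (fun i : I => (i, j)) by move=> i k [].
apply: (has_sum_extend ij) => [[i j'] h|]; last by apply: eq_has_sum (uv j) => i /=; rewrite eqxx.
by case: eqP => //= e; have := h i; rewrite -e eqxx.
Qed.

Lemma abs_summable_geometric (r : R) : 0 <= r < 1 ->
  abs_summable (fun n : nat => (r ^+ n)%:C) /\ abs_summable (fun n : nat => (n%:R * r ^+ n)%:C).
Proof.
move=> /andP[r0 r1].
have rc : `|r%:C : C| < 1 by rewrite ger0_norm ?ler0c// ltC1.
have h1 := has_sum_abs (has_sum_geometric_deriv rc).
have h2 : abs_summable (fun n : nat => (n%:R * r ^+ n)%:C : C).
  by congr (abs_summable _): h1; apply/funext => n; rewrite rmorphM rmorph_nat rmorphXn.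
split=> //.
apply: (abs_summable_le (J0 := [fset 0%N]%fset)) h2 => n; rewrite inE => n0.
by rewrite rmorphM normrM rmorph_nat normr_nat ler_peMl// ler1n lt0n.
Qed.

End Fourier.

(** * The lattice sum of the Weierstrass function *)

Section Lattice.
Local Open Scope complex_scope.
Local Open Scope ring_scope.
Variable R : realType.
Local Notation C := R[i].
Implicit Types (z u w : C).

Lemma int_pair_fset m : exists J : {fset int * int}, forall p, p \notin J ->
  (m <= int_index p.1)%N \/ (m <= int_index p.2)%N.
Proof.
have [J0 h0] := int_index_fset m.
exists [fset p | p in [seq (i, j) | i <- enum_fset J0, j <- enum_fset J0]]%fset => -[i j] /= h.
have [iJ|/h0] := boolP (i \in J0); last by left.
right; apply: h0; apply: contraNN h => jJ.
by apply/imfsetP; exists (i, j) => //=; apply: allpairs_f.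
Qed.

Lemma inv_three_halves_le (x : R) n : n.+1%:R <= x -> (x * Num.sqrt x)^-1 <= three_halves R n.
Proof.
move=> nx; have x0 : 0 < x by apply: lt_le_trans nx; rewrite ltr0n.
rewrite /three_halves lef_pV2 ?posrE ?mulr_gt0 ?sqrtr_gt0 ?ltr0n//.
by apply: ler_pM; rewrite ?sqrtr_ge0 ?ler0n//; exact: ler_wsqrtr.
Qed.

(** The imaginary part of a lattice point bounds [n], and then its real part
    bounds [m]. *)
Lemma lattice_norm (tau : C) : 0 < complex.Im tau -> exists2 K : R, 1 <= K &
  forall m n : int, `|m%:~R| <= K * complex.Re `|m%:~R + n%:~R * tau| /\
                    `|n%:~R| <= K * complex.Re `|m%:~R + n%:~R * tau|.
Proof.
move=> t0; pose t := complex.Im tau; pose T := complex.Re `|tau|.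
have T0 : 0 <= T by exact: normC_ge0.
exists (1 + (1 + T) / t); first by rewrite lerDl divr_ge0 ?addr_ge0// ltW.
move=> m n; set W := complex.Re _.
have W0 : 0 <= W by exact: normC_ge0.
have hn : `|n%:~R| <= W / t.
  rewrite ler_pdivlMr//; apply: le_trans (le_Im_norm _).
  have -> : complex.Im (m%:~R + n%:~R * tau) = n%:~R * t.
    by rewrite /t !intC; case: (tau) => a b /=; ring.
  by rewrite normrM (gtr0_norm t0).
have hm : `|m%:~R| <= W + `|n%:~R| * T.
  have -> : `|n%:~R : R| * T = complex.Re `|- (n%:~R * tau)| by rewrite normrN Re_normM norm_int.
  by rewrite -norm_int -(addrK (n%:~R * tau) (m%:~R)) Re_ler_normD.
have WT : 0 <= W * T / t by rewrite divr_ge0 ?mulr_ge0// ltW.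
have Wt : 0 <= W / t by rewrite divr_ge0// ltW.
have e : (1 + (1 + T) / t) * W = W + W / t + W * T / t by ring.
rewrite e; split; last by apply: le_trans hn _; lra.
apply: (le_trans hm); have := ler_wpM2r T0 hn; have -> : W / t * T = W * T / t by ring.
lra.
Qed.

Definition lattice_term z (tau : C) (mn : int * int) : C :=
  if mn == 0 then 0
  else let w := mn.1%:~R + mn.2%:~R * tau in (z - w) ^- 2 - w ^- 2.

(** The terms decay like the inverse cube of the norm of the lattice point,
    and by [lattice_norm] an inverse cube is at most the product of the powers
    [- 3 / 2] of the two coordinates. *)
Lemma abs_summable_lattice z (tau : C) : 0 < complex.Im tau ->
  abs_summable (lattice_term z tau).
Proof.
move=> t0; have [K K1 hK] := lattice_norm t0.
pose Z := complex.Re `|z|; have Z0 : 0 <= Z by exact: normC_ge0.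
have K0 : 0 < K by exact: lt_le_trans K1.
pose M := Num.bound (K * (2 * Z + 1)).
have hM : K * (2 * Z + 1) <= M%:R.
  by apply/ltW/archi_boundP; rewrite mulr_ge0 ?addr_ge0 ?mulr_ge0// ltW.
have [J0 hJ] := int_pair_fset M.
(* |z (2 w - z)| <= |z| (5/2) |w| and |z - w| >= |w| / 2 give the factor 10 |z|. *)
apply: (@abs_summable_dom _ _ _
  (fun p : int * int => three_halves R (int_index p.1) * three_halves R (int_index p.2)) (10 * Z * (2 * K) ^+ 3) J0); last first.
  have h := abs_summable_pair (abs_summable_int_three_halves R) (abs_summable_int_three_halves R).
  by congr (abs_summable _): h; apply/funext => p; rewrite rmorphM.
move=> [m n] /hJ hmn; have [hm hn] := hK m n.
set w := m%:~R + n%:~R * tau in hm hn.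
have -> : lattice_term z tau (m, n) = if (m, n) == 0 then 0 else (z - w) ^- 2 - w ^- 2 by [].
set W := complex.Re `|w| in hm hn *.
have W1 : 2 * Z + 1 <= W.
  rewrite -(ler_pM2l K0); apply: (le_trans hM).
  case: hmn => h; [apply: le_trans hm|apply: le_trans hn];
    by apply: le_trans (int_index_le _ _); rewrite ler_nat.
have x1 (k : int) : `|k%:~R| <= K * W -> (int_index k).+1%:R <= 2 * K * W.
  move=> kW; rewrite -natr1; have := int_index_le R k.
  have : 1 * 1 <= K * W by apply: ler_pM => //; lra.
  lra.
case: ifPn => _; first by rewrite normr0 !mulr_ge0 ?exprn_ge0 ?mulr_ge0// ltW// three_halves_gt0.
have w0 : w != 0 by rewrite -normr_eq0 -normC_Re -/W gt_eqF// ltr0C; lra.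
have zw : Z <= W / 2 by lra.
have d1 : W / 2 <= complex.Re `|z - w|.
  have := Re_ler_distD z (- w); rewrite normrN -/W -/Z; lra.
have zw0 : z - w != 0 by rewrite -normr_eq0 -normC_Re gt_eqF// ltr0C; lra.
have d2 : complex.Re `|2 * w - z| <= 5 / 2 * W.
  apply: (le_trans (Re_ler_normD _ _)); rewrite normrN Re_normM -/W -/Z.
  have -> : complex.Re `|2 : C| = 2 by rewrite normr_nat.
  lra.
have -> : (z - w) ^- 2 - w ^- 2 = z * (2 * w - z) / (w ^+ 2 * (z - w) ^+ 2).
  by field; rewrite w0 zw0.
rewrite Re_normM Re_normM Re_normV Re_normM !Re_normX -/Z -/W.
have Wp : 0 < W by lra.
have h1 : Z * complex.Re `|2 * w - z| / (W ^+ 2 * complex.Re `|z - w| ^+ 2)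
    <= Z * (5 / 2 * W) / (W ^+ 2 * (W / 2) ^+ 2).
  apply: ler_pM.
  - by rewrite mulr_ge0// normC_ge0.
  - by rewrite invr_ge0 mulr_ge0 ?exprn_ge0// ?normC_ge0// ltW.
  - by rewrite ler_wpM2l.
  - rewrite lef_pV2 ?posrE ?mulr_gt0 ?exprn_gt0//; [|lra|lra].
    rewrite ler_wpM2l ?sqr_ge0// ler_pXn2r ?nnegrE//; lra.
apply: (le_trans h1).
pose x := 2 * K * W.
have xp : 0 < x by rewrite !mulr_gt0.
have -> : Z * (5 / 2 * W) / (W ^+ 2 * (W / 2) ^+ 2) = 10 * Z * (2 * K) ^+ 3 * x ^- 3.
  by rewrite /x; field; rewrite !gt_eqF.
rewrite ler_wpM2l//; first by rewrite !mulr_ge0 ?exprn_ge0 ?mulr_ge0// ltW.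
have -> : x ^- 3 = (x * Num.sqrt x)^-1 * (x * Num.sqrt x)^-1.
  have sx : Num.sqrt x * Num.sqrt x = x by rewrite -expr2 sqr_sqrtr ?ltW.
  rewrite -invfM; congr (_ ^-1); rewrite mulrACA sx; ring.
have s0 : 0 <= (x * Num.sqrt x)^-1 by rewrite invr_ge0 mulr_ge0 ?sqrtr_ge0 ?ltW.
by apply: ler_pM => //; apply: inv_three_halves_le; exact: x1.
Qed.

End Lattice.

(** * The expansion of the propagator *)

Section Propagator.
Local Open Scope complex_scope.
Local Open Scope ring_scope.
Variable R : realType.
Local Notation C := R[i].
Implicit Types (z u w : C).

Lemma Im_realM (x : R) z : complex.Im (x%:C * z) = x * complex.Im z.
Proof. by case: z => a b /=; ring. Qed.

Lemma ImB z w : complex.Im (z - w) = complex.Im z - complex.Im w.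
Proof. by case: z w => a b []. Qed.

Lemma ImN z : complex.Im (- z) = - complex.Im z.
Proof. by case: z. Qed.

Section Eisenstein.
Variable tau : C.
Hypothesis tau0 : 0 < complex.Im tau.

Lemma Im_mul_tau (n : int) : complex.Im (n%:~R * tau) = n%:~R * complex.Im tau.
Proof. by rewrite intC Im_realM. Qed.

(** The pairs [(n, k)] with [(n + 1) k = d] correspond to the divisors [k] of
    [d]. *)
Lemma divisor_sum (Q : C) d (n k : nat) : (0 < d)%N ->
  (if (n.+1 * k == d)%N then k%:R * Q ^+ d else 0) =
  \sum_(m <- divisors d) (if (n, k) == ((d %/ m).-1, m) then m%:R * Q ^+ d else 0) :> C.
Proof.
move=> d0; case: eqP => [nkd|nkd].
  have kd : k \in divisors d by rewrite -dvdn_divisors// -nkd dvdn_mull.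
  have k0 : (0 < k)%N by move: d0; rewrite -nkd muln_gt0 => /andP[].
  rewrite (bigD1_seq k) ?divisors_uniq//= -{2}nkd mulnK// eqxx big1 ?addr0// => m mk.
  by case: eqP => // -[_ km]; rewrite km eqxx in mk.
rewrite big1_seq// => m /andP[_]; rewrite -dvdn_divisors// => md.
case: eqP => // -[nm km]; case: nkd; rewrite nm km prednK ?divnK//.
have m0 : (0 < m)%N := dvdn_gt0 d0 md.
by rewrite divn_gt0// dvdn_leq.
Qed.

(** Both series are rearrangements of the double series of the
    [k Q ^ ((n + 1) k)]: grouping by exponents gives the divisor sums of the
    Eisenstein series, grouping by [n] gives values of [csc2] on the rows of the
    lattice. *)
Lemma lambert_series : exists A,
  has_sum (fun d : nat => (sigma1 d.+1)%:R * exp2ipi tau ^+ d.+1) A /\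
  has_sum (fun n : nat => - csc2 (n.+1%:R * tau) / 4) A.
Proof.
set Q := exp2ipi tau; pose r := complex.Re `|Q|.
have rC : r%:C = `|Q| by rewrite normC_Re.
have r01 : 0 <= r < 1 by rewrite normC_ge0 -ltC1 rC norm_exp2ipi_lt1.
have [g0 g1] := abs_summable_geometric r01.
pose u (p : nat * nat) : C := p.2%:R * Q ^+ (p.1.+1 * p.2).
have /abs_summableP[A hA] : abs_summable u.
  apply: (abs_summable_le (J0 := fset0)) (abs_summable_pair g0 g1) => -[n k] _ /=.
  rewrite /u/= normrM normr_nat normrX -rC -!rmorphXn -rmorphM -(rmorph_nat (real_complex R)) -rmorphM/=.
  have r0 : 0 <= r by case/andP: r01.
  have r1 : r <= 1 by case/andP: r01 => _ /ltW.
  rewrite ger0_norm ?ler0c ?mulr_ge0 ?exprn_ge0// lecR mulrCA.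
  case: k => [|k]; first by rewrite !mul0r.
  rewrite ler_wpM2l// -exprD ler_wiXn2l//; nia.
exists A; split.
  pose v d : C := if d == 0%N then 0 else (sigma1 d)%:R * Q ^+ d.
  suff hv : has_sum v A.
    suff : has_sum (fun d => v d.+1) A by [].
    by apply/(has_sum_natS v); rewrite /v eqxx add0r.
  apply: (has_sum_partition hA (b := fun p : nat * nat => (p.1.+1 * p.2)%N)) => -[|d]; rewrite /v/=.
    apply: eq_has_sum (@has_sum0 R _) => -[n k] /=; case: eqP => // /eqP.
    by rewrite muln_eq0/= => /eqP ->; rewrite /u/= mul0r.
  rewrite /sigma1 natr_sum mulr_suml.
  have := @has_sum_big _ _ _ (divisors d.+1) xpredT (fun m p => if p == ((d.+1 %/ m).-1, m) then m%:R * Q ^+ d.+1 else 0)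
    (fun m => m%:R * Q ^+ d.+1).
  move=> h2; apply: eq_has_sum (h2 _) => [[n k]|m _].
    rewrite -divisor_sum//; case: eqP => //= <-; by rewrite /u.
  have := @has_sum_single R _ (fun p => if p == ((d.+1 %/ m).-1, m) then m%:R * Q ^+ d.+1 else 0) ((d.+1 %/ m).-1, m).
  by rewrite eqxx; apply => p /negPf ->.
apply: (has_sum_rows hA) => n.
have Im0 : 0 < complex.Im (n.+1%:R * tau) by rewrite (Im_mul_tau n.+1) mulr_gt0// ltr0z.
apply: eq_has_sum (csc2_fourier Im0) => k.
by rewrite /u/= /Q exp2ipiMn natrM; congr (_ * exp2ipi _); ring.
Qed.

Lemma csc2_mul_tauN (n : int) : n != 0 -> csc2 (- n%:~R * tau) = csc2 (n%:~R * tau).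
Proof.
move=> n0; rewrite mulNr csc2N//; apply: exp2ipi_neq1.
by rewrite Im_mul_tau mulf_neq0 ?intr_eq0// gt_eqF.
Qed.

Lemma has_sum_csc2_lattice A : has_sum (fun n : nat => - csc2 (n.+1%:R * tau) / 4) A ->
  has_sum (fun n : int => if n == 0 then 0 else - csc2 (n%:~R * tau) / 4) (A + A).
Proof.
move=> hA; apply: has_sum_int.
  pose f (n : nat) : C := if Posz n == 0 then 0 else - csc2 ((Posz n)%:~R * tau) / 4.
  suff : has_sum f A by [].
  suff : has_sum f (f 0%N + A) by rewrite /f eqxx add0r.
  by apply/(has_sum_natS f); apply: eq_has_sum hA => n; rewrite /f -pmulrn.
apply: eq_has_sum hA => n; rewrite /= NegzE rmorphN/= csc2_mul_tauN//.
Qed.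

Variable z : C.
Hypothesis z0 : complex.Im z != 0.
Hypothesis z_tau : `|complex.Im z| < complex.Im tau.

(** The sign for which [row_sign n * (z - n tau)] lies in the upper half plane,
    so that [csc2] can be expanded there. *)
Definition row_sign (n : int) : int :=
  if n == 0 then (if 0 < complex.Im z then 1 else -1) else if n < 0 then 1 else -1.

Lemma Im_row (n : int) : complex.Im (z - n%:~R * tau) = complex.Im z - n%:~R * complex.Im tau.
Proof. by rewrite ImB Im_mul_tau. Qed.

(** The margin grows linearly in [n], so the double series [row_term] is
    dominated by the product of two geometric series. *)
Lemma row_margin : exists2 d : R, 0 < d & forall n : int,
  d * (`|n|%:R + 1) <= (row_sign n)%:~R * complex.Im (z - n%:~R * tau).
Proof.
set y := complex.Im z; set t := complex.Im tau.
have y0 : 0 < `|y| by rewrite normr_gt0.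
pose d := Num.min `|y| ((t - `|y| ) / 2).
have d1 : d <= `|y| by rewrite ge_min lexx.
have d2 : d <= (t - `|y| ) / 2 by rewrite ge_min lexx orbT.
exists d; first by rewrite lt_min y0 divr_gt0// subr_gt0.
move=> n; rewrite Im_row /row_sign -/y -/t.
have [->|n0] := eqVneq n 0.
  rewrite mul0r subr0 add0r mulr1 (le_trans d1)//.
  by case: ltP => y1; rewrite ?mul1r ?rmorphN1 ?mulN1r ?(gtr0_norm y1) ?(ler0_norm y1).
have yt : - t < y < t by rewrite -ltr_norml.
have key (m : nat) (y' : R) : `|y'| = `|y| -> (0 < m)%N -> d * (m%:R + 1) <= m%:R * t + y'.
  move=> yy m0; have : 1 <= m%:R :> R by rewrite ler1n.
  have : - `|y| <= y' by rewrite -yy; exact: lerNnormlW.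
  have : d * (m%:R - 1) <= t * (m%:R - 1).
    rewrite ler_wpM2r ?subr_ge0 ?ler1n//; lra.
  lra.
case: ltP => n1.
  have -> : n%:~R = - (`|n|%:R) :> R by rewrite natr_absz ltr0_norm// rmorphN/= opprK.
  by rewrite mul1r mulNr opprK [leRHS]addrC; apply: key => //; rewrite absz_gt0.
have -> : n%:~R = `|n|%:R :> R by rewrite natr_absz ger0_norm.
by rewrite rmorphN1 mulN1r opprB; apply: key; rewrite ?normrN// absz_gt0.
Qed.

Lemma row_sign_gt0 (n : int) : 0 < (row_sign n)%:~R * complex.Im (z - n%:~R * tau).
Proof.
have [d d0 hd] := row_margin; apply: lt_le_trans (hd n).
by rewrite mulr_gt0// ltr_wpDl.
Qed.

Lemma row_signE n : row_sign n = 1 \/ row_sign n = -1.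
Proof. by rewrite /row_sign; case: ifP => _; [case: ifP => _; auto|case: ifP => _; auto]. Qed.

Lemma row_neq0 (n : int) : complex.Im (z - n%:~R * tau) != 0.
Proof. by have := row_sign_gt0 n; apply: contraTneq => ->; rewrite mulr0 ltxx. Qed.

Definition row_term (p : int * nat) : C :=
  p.2%:R * exp2ipi (p.2%:R * ((row_sign p.1)%:~R * (z - p.1%:~R * tau))).

Lemma has_sum_row (n : int) : has_sum (fun k => row_term (n, k)) (- csc2 (z - n%:~R * tau) / 4).
Proof.
have -> : csc2 (z - n%:~R * tau) = csc2 ((row_sign n)%:~R * (z - n%:~R * tau)).
  case: (row_signE n) => ->; rewrite ?mul1r// rmorphN1 mulN1r csc2N//.
  exact/exp2ipi_neq1/row_neq0.
have h : 0 < complex.Im ((row_sign n)%:~R * (z - n%:~R * tau)).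
  by rewrite intC Im_realM row_sign_gt0.
exact: (csc2_fourier h).
Qed.

Lemma abs_summable_row_term : abs_summable row_term.
Proof.
have [d d0 hd] := row_margin; pose r := expR (- (2 * pi * d)).
have p0 : 0 < 2 * pi :> R by rewrite mulr_gt0// pi_gt0.
have r1 : r < 1 by rewrite /r -[ltRHS]expR0 ltr_expR oppr_lt0 mulr_gt0.
have r01 : 0 <= r < 1 by rewrite expR_ge0 r1.
have [g0 g1] := abs_summable_geometric r01.
have gi : abs_summable (fun n : int => (r ^+ int_index n)%:C) by exact: abs_summable_int.
apply: (abs_summable_le (J0 := fset0)) (abs_summable_pair gi g1) => -[n k] _.
rewrite /row_term -rmorphM -normC_Re -[leRHS]normC_Re lecR Re_norm_realC Re_normM.
rewrite norm_exp2ipi [fst _]/= [snd _]/= -[k%:R]/((Posz k)%:~R) norm_int !intC !Im_realM.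
rewrite -[complex.Re _%:C]/(expR _) -pmulrn normr_nat.
rewrite ger0_norm; last by rewrite !mulr_ge0 ?exprn_ge0// expR_ge0.
case: k => [|k]; first by rewrite !mul0r mulr0.
rewrite [leRHS]mulrCA ler_wpM2l// -exprD /r -expRM_natl ler_expR mulrN lerN2.
rewrite -!mulrA [leLHS]mulrCA ler_pM2l// [leLHS]mulrCA ler_pM2l ?pi_gt0//.
have h1 : d * ((int_index n)%:R + 1) <= d * (`|n|%:R + 1).
  by rewrite ler_pM2l// lerD2r ler_nat; case: (n) => m.
have h2 := le_trans h1 (hd n).
apply: (@le_trans _ _ (k.+1%:R * (d * ((int_index n)%:R + 1)))); last first.
  by rewrite ler_pM2l ?ltr0n ?ltr0z// -intC.
rewrite [leRHS]mulrCA mulrC ler_pM2l// -(natrD _ _ 1) -natrM ler_nat; nia.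
Qed.

(** Eisenstein summation: the sum over [m] of each row [n] is a difference of
    two values of [csc2] by the Lipschitz formula, except that in the row [n = 0]
    the subtracted part is the constant of [has_sum_zeta2] and the term of the
    pole [z ^ -2] is missing. *)
Lemma csum_lattice T A : has_sum row_term T ->
  has_sum (fun n : nat => - csc2 (n.+1%:R * tau) / 4) A ->
  has_sum (lattice_term z tau) (- (4 * pi%:C ^+ 2) * (T - (A + A)) - z ^- 2 - pi%:C ^+ 2 / 3).
Proof.
move=> hT /has_sum_csc2_lattice hA.
have {}hT : has_sum (fun n : int => - csc2 (z - n%:~R * tau) / 4) T.
  by apply: has_sum_rows hT _ => n; exact: has_sum_row.
have [S hS] := abs_summableP (abs_summable_lattice z tau0).
pose v (n : int) : C := - (4 * pi%:C ^+ 2) * ((- csc2 (z - n%:~R * tau) / 4) +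
   (-1) * (if n == 0 then 0 else - csc2 (n%:~R * tau) / 4)) +
   (if n == 0 then - z ^- 2 - pi%:C ^+ 2 / 3 else 0).
have hv : has_sum v (- (4 * pi%:C ^+ 2) * (T + (-1) * (A + A)) + (- z ^- 2 - pi%:C ^+ 2 / 3)).
  apply: has_sumD (has_sumZ _ (has_sumD hT (has_sumZ _ hA))) _.
  have := @has_sum_single R _ (fun n : int => if n == 0 then - z ^- 2 - pi%:C ^+ 2 / 3 else 0) 0.
  by rewrite eqxx; apply=> n /negPf ->.
have hvS : has_sum v S.
  apply: (has_sum_cols hS) => n; rewrite /v.
  have sqrN (a b : C) : (a - b) ^- 2 = (b - a) ^- 2 by congr (_ ^-1); ring.
  have [->|n0] := eqVneq n 0.
    rewrite mul0r subr0 mulr0 addr0.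
    have hz : exp2ipi (- z) != 1 by rewrite exp2ipi_neq1// ImN oppr_eq0.
    have h1 := has_sumD (has_sum_lipschitz hz) (has_sumZ (-1) (@has_sum_zeta2 R)).
    have := @has_sum_single R _ (fun m : int => if m == 0 then - z ^- 2 else 0) 0.
    rewrite eqxx => h2; have {}h2 := h2 (fun m m0 => ifN_eq _ _ m0).
    have -> : - (4 * pi%:C ^+ 2) * (- csc2 z / 4) + (- z ^- 2 - pi%:C ^+ 2 / 3) =
        (pi%:C ^+ 2 * csc2 (- z) + (-1) * (pi%:C ^+ 2 / 3)) + (- z ^- 2).
      by rewrite csc2N ?exp2ipi_neq1//; generalize (pi%:C : C) (z ^- 2) => P Q; field.
    apply: eq_has_sum (has_sumD h1 h2) => m.
    have -> : lattice_term z tau (m, 0) = if (m, 0 : int) == 0 then 0 else (z - (m%:~R + 0%:~R * tau)) ^- 2 - (m%:~R + 0%:~R * tau) ^- 2 by [].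
    have -> : ((m, 0 : int) == 0) = (m == 0) by rewrite xpair_eqE eqxx andbT.
    rewrite mul0r addr0 mulN1r addrC [- z + _]addrC -(sqrN z).
    case: eqP => [->|_]; last by rewrite add0r.
    by rewrite subr0 expr0n/= invr0 subr0 addNr.
  have hz : exp2ipi (n%:~R * tau - z) != 1.
    by rewrite exp2ipi_neq1// -opprB ImN oppr_eq0 row_neq0.
  have ht : exp2ipi (n%:~R * tau) != 1.
    by rewrite exp2ipi_neq1// Im_mul_tau mulf_neq0 ?intr_eq0// gt_eqF.
  have := has_sumD (has_sum_lipschitz hz) (has_sumZ (-1) (has_sum_lipschitz ht)).
  have <- : csc2 (- (n%:~R * tau - z)) = csc2 (n%:~R * tau - z) by rewrite csc2N.
  rewrite opprB.
  have -> : pi%:C ^+ 2 * csc2 (z - n%:~R * tau) + (-1) * (pi%:C ^+ 2 * csc2 (n%:~R * tau)) =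
    - (4 * pi%:C ^+ 2) * (- csc2 (z - n%:~R * tau) / 4 + (-1) * (- csc2 (n%:~R * tau) / 4)) + 0.
    by generalize (pi%:C : C) => P; field.
  apply: eq_has_sum => m.
  have -> : lattice_term z tau (m, n) = if (m, n) == 0 then 0 else (z - (m%:~R + n%:~R * tau)) ^- 2 - (m%:~R + n%:~R * tau) ^- 2 by [].
  rewrite ifN; last by rewrite xpair_eqE (negPf n0) andbF.
  by rewrite mulN1r [m%:~R + _]addrC; congr (_ ^-1 - _); ring.
rewrite (_ : _ - _ - _ = S)//; apply: has_sum_unique hvS.
by congr (has_sum _ _): hv; generalize (pi%:C : C) => P; ring.
Qed.

(** The constants left by [csum_lattice] are those of the Eisenstein series
    [E_2]: this is the reason for adding it to the Weierstrass function. *)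
Lemma propagator_row_sum T : has_sum row_term T -> - propagator z tau = T.
Proof.
move=> hT; have [A [hA1 hA2]] := lambert_series.
have e1 : weierstrass_p z tau = z ^- 2 + (- (4 * pi%:C ^+ 2) * (T - (A + A)) - z ^- 2 - pi%:C ^+ 2 / 3).
  by rewrite /weierstrass_p; congr (_ + _); apply: csum_has_sum; exact: csum_lattice.
have e2 : eisenstein2 (nome tau ^+ 2) = 1 - 24 * A.
  by rewrite /eisenstein2 nome_sqr; congr (_ - _ * _); exact: csum_has_sum.
rewrite /propagator e1 e2.
have p0 : (pi%:C : C) != 0 by rewrite eq_complex/= eqxx andbT gt_eqF// pi_gt0.
move: p0; generalize (pi%:C : C) (z ^- 2) => P Q P0; field.
by rewrite ?P0.
Qed.

(** The pairs [(s, a)] that an edge can carry: a nonzero slope [s], and a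
    winding around the circle, [a / |s|] times, in the direction of [s]. Without
    winding the slope has to agree with the relative position [up] of the two
    ends of the edge. *)
Definition edge_ok (up : bool) (sa : int * nat) : bool :=
  [&& sa.1 != 0, (`|sa.1| %| sa.2)%N & (sa.2 == 0%N) ==> ((0 < sa.1) == up)].

Definition edge_coef (q : C) (sa : int * nat) : C := `|sa.1|%N%:R * q ^+ (2 * sa.2).

(** The [k]-th Fourier term of row [n] has frequency [s] with [|s| = k], and
    the power of the nome that it carries shows that [a = |n| k]. *)
Definition row_index (p : int * nat) : int * nat := (row_sign p.1 * p.2%:Z, (`|p.1| * p.2)%N).

Lemma absz_row_sign n : `|row_sign n|%N = 1%N.
Proof. by case: (row_signE n) => ->. Qed.

Lemma row_sign_mul n : row_sign n * n = - (`|n|%N)%:Z.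
Proof.
by rewrite /row_sign; have [->|n0] := eqVneq n 0; [rewrite mulr0|case: ltP => n1; lia].
Qed.

Lemma row_index_ok n k : (0 < k)%N -> edge_ok (0 < complex.Im z) (row_index (n, k)).
Proof.
move=> k0; rewrite /edge_ok /row_index/= abszM absz_row_sign mul1n absz_nat dvdn_mull//=.
apply/andP; split; first by case: (row_signE n) => ->; lia.
apply/implyP; rewrite muln_eq0 (gtn_eqF k0) orbF absz_eq0 => /eqP ->.
by rewrite /row_sign eqxx; case: ifP => _; apply/eqP; lia.
Qed.

Lemma row_term_index n k :
  row_term (n, k) = edge_coef (nome tau) (row_index (n, k)) * exp2ipi ((row_index (n, k)).1%:~R * z).
Proof.
rewrite /row_term /edge_coef /row_index [fst _]/= [snd _]/=.
rewrite abszM absz_row_sign mul1n absz_nat -mulrA exprM nome_sqr exp2ipiMn -exp2ipiD.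
congr (_ * exp2ipi _); rewrite intrM -pmulrn mulrBr.
have : (row_sign n)%:~R * n%:~R = - (`|n|%N)%:R :> C.
  by rewrite -rmorphM row_sign_mul rmorphN/= -pmulrn.
rewrite mulrA => ->; rewrite natrM; ring.
Qed.

Lemma row_index_inj n k n' k' : (0 < k)%N -> row_index (n, k) = row_index (n', k') -> (n, k) = (n', k').
Proof.
move=> k0 [e1 e2].
(* The frequency gives k, then the nome gives |n|, and its sign the sign of n. *)
have ek : k = k'.
  by have := congr1 absz e1; rewrite !abszM !absz_row_sign !mul1n !absz_nat.
subst k'; congr (_, _).
have en : `|n|%N = `|n'|%N by apply/eqP; rewrite -(eqn_pmul2r k0); apply/eqP.
have es : row_sign n = row_sign n' by apply: mulIf e1; lia.
move: en es; rewrite /row_sign.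
have [->|n0] := eqVneq n 0; have [->|n1] := eqVneq n' 0; try by lia.
by case: ifP => h1; case: ifP => h2; lia.
Qed.

Lemma row_index_surj sa : edge_ok (0 < complex.Im z) sa ->
  exists2 p, (0 < p.2)%N & row_index p = sa.
Proof.
case: sa => s a /and3P[/= s0 /dvdnP[m ->] /implyP ha].
(* Winding in the direction of s > 0 comes from the rows n < 0. *)
exists ((if 0 < s then - m%:Z else m%:Z), `|s|%N) => /=; first by rewrite absz_gt0.
rewrite /row_index/=; congr (_, _); last by case: ifP => _; rewrite ?abszN absz_nat.
rewrite /row_sign; move: ha; rewrite muln_eq0 absz_eq0 (negPf s0) orbF.
have [->|m0] := eqVneq m 0%N.
  by move=> /(_ isT)/eqP e; rewrite oppr0 if_same eqxx -e; case: ltP => sp; lia.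
move=> _; have mz : (m%:Z == 0) = false by lia.
have [sp|sp] := ltP 0 s; rewrite ?oppr_eq0 mz.
  have -> : (- m%:Z < 0) = true by lia.
  by lia.
have -> : (m%:Z < 0) = false by lia.
by lia.
Qed.

(** The terms of [row_term] with [k > 0] are reindexed bijectively by the pairs
    [(s, a)] that an edge can carry. *)
Lemma has_sum_propagator :
  has_sum (fun sa => if edge_ok (0 < complex.Im z) sa
                     then edge_coef (nome tau) sa * exp2ipi (sa.1%:~R * z) else 0)
          (- propagator z tau).
Proof.
have [T hT] := abs_summableP abs_summable_row_term.
rewrite (propagator_row_sum hT); apply: (has_sum_partition hT (b := row_index)) => sa.
case: ifPn => [/row_index_surj[[n k] /= k0 <-]|nok].
  rewrite -row_term_index.
  have := @has_sum_single R _ (fun p => if row_index p == row_index (n, k) then row_term p else 0) (n, k).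
  rewrite eqxx; apply => -[n' k'] h; case: eqP => // e.
  have := row_index_inj k0 (esym e) => e2; by rewrite -e2 eqxx in h.
apply: eq_has_sum (@has_sum0 R _) => -[n k]; case: eqP => // e.
case: k e => [|k] e; first by rewrite /row_term mul0r.
by move: nok; rewrite -e row_index_ok.
Qed.

End Eisenstein.
End Propagator.

(** * Integration of trigonometric series over a period *)

Section Integral01.
Local Open Scope complex_scope.
Local Open Scope ring_scope.
Variable R : realType.
Local Notation C := R[i].
Implicit Types (z u w : C) (f g : R -> R).

Definition int01 f : R := \int[lebesgue_measure]_(t in `[0, 1]) f t.

Lemma integrable01 f : continuous f ->
  (@lebesgue_measure R).-integrable `[0, 1] (EFin \o f).
Proof.
move=> cf; apply: continuous_compact_integrable; first exact: segment_compact.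
exact: continuous_subspaceT.
Qed.

Lemma int01D f g : continuous f -> continuous g ->
  int01 (fun s => f s + g s) = int01 f + int01 g.
Proof. by move=> cf cg; rewrite /int01 RintegralD//; exact: integrable01. Qed.

Lemma int01B f g : continuous f -> continuous g ->
  int01 (fun s => f s - g s) = int01 f - int01 g.
Proof. by move=> cf cg; rewrite /int01 RintegralB//; exact: integrable01. Qed.

Lemma int01_cst c : int01 (fun=> c) = c.
Proof.
rewrite /int01 Rintegral_cst//= lebesgue_measure_itv/= lte_fin ltr01.
by rewrite -EFinB subr0/= mulr1.
Qed.

Lemma int01_norm_le f c : continuous f -> (forall s, `|f s| <= c) -> `|int01 f| <= c.
Proof.
move=> cf fc; apply: (le_trans (le_normr_Rintegral _ (integrable01 cf))) => //.
rewrite -[leRHS]int01_cst; apply: le_Rintegral => //.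
- by apply: integrable01 => s; apply: continuous_comp; [exact: cf|exact: norm_continuous].
- by apply: integrable01; exact: cst_continuous.
Qed.

(** The real part of [(a + i b) exp (2 i pi k s)], the frequency being the
    integer [k]. *)
Definition trig (a b : R) (k : int) s := a * cos (2 * pi * k%:~R * s) - b * sin (2 * pi * k%:~R * s).

Lemma trig_continuous a b k : continuous (trig a b k).
Proof.
move=> s; rewrite /trig.
have cl : {for s, continuous (fun s : R => 2 * pi * k%:~R * s)} by exact: mulrl_continuous.
have cc : {for s, continuous (fun s : R => cos (2 * pi * k%:~R * s))}.
  by apply: continuous_comp; [exact: cl|exact: continuous_cos].
have cs : {for s, continuous (fun s : R => sin (2 * pi * k%:~R * s))}.
  by apply: continuous_comp; [exact: cl|exact: continuous_sin].
have ca : {for s, continuous (fun _ : R => a)} by exact: cst_continuous.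
have cb : {for s, continuous (fun _ : R => b)} by exact: cst_continuous.
exact: (continuousB (continuousM ca cc) (continuousM cb cs)).
Qed.

Lemma cos_sin_2pi_int (k : int) : cos (2 * pi * k%:~R : R) = 1 /\ sin (2 * pi * k%:~R : R) = 0.
Proof.
have := exp2ipi_int R k; rewrite /exp2ipi /cexp Re_exponent Im_exponent intC/=.
by rewrite mulr0 oppr0 expR0 !mul1r => -[-> ->].
Qed.

Lemma int01_trig a b k : int01 (trig a b k) = if k == 0 then a else 0.
Proof.
have [->|k0] := eqVneq k 0.
  have -> : trig a b 0 = fun=> a.
    by apply/funext => s; rewrite /trig mulr0 mul0r cos0 sin0 mulr1 mulr0 subr0.
  exact: int01_cst.
pose c : R := 2 * pi * k%:~R.
have c0 : c != 0 by rewrite !mulf_neq0 ?intr_eq0 ?pnatr_eq0// gt_eqF// pi_gt0.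
pose H s := c^-1 * (a * sin (c * s) + b * cos (c * s)).
have dH (s : R) : is_derive s (1 : R) H (trig a b k s).
  rewrite /H; apply: is_derive_eq.
  by rewrite /trig -/c /GRing.scale/= ; field.
rewrite /int01 /Rintegral (@continuous_FTC2 _ _ H)//.
- rewrite -EFinB/= /H !mulr0 !mulr1 sin0 cos0.
  by have [-> ->] := cos_sin_2pi_int k; rewrite subrr.
- exact/continuous_subspaceT/trig_continuous.
- have cH : continuous H.
    by move=> s; apply: differentiable_continuous; apply/derivable1_diffP; by case: (dH s).
  split.
  + by move=> s _; by case: (dH s).
  + exact: cvg_at_right_filter (cH 0).
  + exact: cvg_at_left_filter (cH 1).
- by move=> s _; rewrite derive1E; by case: (dH s).
Qed.
End Integral01.

Section TrigonometricSeries.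
Local Open Scope complex_scope.
Local Open Scope ring_scope.
Variable R : realType.
Local Notation C := R[i].

Lemma Re_sub (z w : C) : complex.Re (z - w) = complex.Re z - complex.Re w.
Proof. by case: z w => ? ? []. Qed.

Lemma norm_oscillation (k : int) (s : R) : `|exp2ipi (k%:~R * s%:C)| = 1.
Proof. by rewrite norm_exp2ipi intC Im_realM /= !mulr0 oppr0 expR0. Qed.

Lemma Re_oscillation (d : C) k (s : R) :
  complex.Re (d * exp2ipi (k%:~R * s%:C)) = trig (complex.Re d) (complex.Im d) k s.
Proof.
rewrite /exp2ipi /cexp Re_exponent Im_exponent intC Im_realM /= !mulr0 oppr0 expR0 !mul1r.
by case: d => x y; rewrite /trig/= addr0 mulrA.
Qed.

Lemma trig_sum_continuous (I : Type) (r : seq I) (a b : I -> R) (k : I -> int) :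
  continuous (fun s => \sum_(i <- r) trig (a i) (b i) (k i) s).
Proof.
elim: r => [|i r IH].
  rewrite (_ : (fun s => _) = fun=> 0); first exact: cst_continuous.
  by apply/funext => s; rewrite big_nil.
rewrite (_ : (fun s => _) = fun s => trig (a i) (b i) (k i) s + \sum_(i <- r) trig (a i) (b i) (k i) s).
  by move=> s; apply: (continuousD (@trig_continuous _ _ _ _ s) (IH s)).
by apply/funext => s; rewrite big_cons.
Qed.

Lemma int01_trig_sum (I : Type) (r : seq I) (a b : I -> R) (k : I -> int) :
  int01 (fun s => \sum_(i <- r) trig (a i) (b i) (k i) s) =
  \sum_(i <- r) (if k i == 0 then a i else 0).
Proof.
elim: r => [|i r IH].
  rewrite (_ : (fun s => _) = fun=> 0) ?int01_cst ?big_nil//.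
  by apply/funext => s; rewrite big_nil.
rewrite (_ : (fun s => _) = fun s => trig (a i) (b i) (k i) s + \sum_(i <- r) trig (a i) (b i) (k i) s).
  rewrite int01D; [|exact: trig_continuous|exact: trig_sum_continuous].
  by rewrite IH int01_trig big_cons.
by apply/funext => s; rewrite big_cons.
Qed.

Section Step.
Variables (I : choiceType) (d : I -> C) (k : I -> int) (f : R -> C) (S : C).
Hypothesis sd : abs_summable d.
Hypothesis fs : forall s : R, has_sum (fun i => d i * exp2ipi ((k i)%:~R * s%:C)) (f s).
Hypothesis hS : has_sum (fun i => if k i == 0 then d i else 0) S.

(** A finite partial sum approximates the series uniformly in [s]. It therefore
    suffices to integrate trigonometric polynomials. *)
Lemma oscillation_approx (e : R) : 0 < e -> exists J : {fset I},
  (forall s, `|complex.Re (f s) - \sum_(i <- J) trig (complex.Re (d i)) (complex.Im (d i)) (k i) s| <= e + e) /\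
  `|complex.Re S - \sum_(i <- J) (if k i == 0 then complex.Re (d i) else 0)| <= e + e.
Proof.
rewrite -ltr0C => e0; have [J0 hJ] := has_sum_tail sd e0.
exists J0; split=> [s|].
  have := has_sum_dist_tail e0 (@fs s) (J0 := J0).
  rewrite -normC_Re -rmorphD ltcR => h; apply: le_trans (ltW (h _)) => [|J dJ].
    apply: le_trans (le_Re_norm _); rewrite Re_sub Re_sum.
    by under [X in _ <= `|_ - X|]eq_bigr do rewrite Re_oscillation.
  by under eq_bigr do rewrite normrM norm_oscillation mulr1; exact: hJ.
have := has_sum_dist_tail e0 hS (J0 := J0).
rewrite -normC_Re -rmorphD ltcR => h; apply: le_trans (ltW (h _)) => [|J dJ].
  apply: le_trans (le_Re_norm _); rewrite Re_sub Re_sum.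
  by under [X in _ <= `|_ - X|]eq_bigr do rewrite (fun_if (@complex.Re R)).
apply: le_lt_trans (hJ J dJ); apply: ler_sum => i _; case: ifP => _ //.
by rewrite normr0.
Qed.

Lemma oscillation_continuous : continuous (fun s => complex.Re (f s)).
Proof.
move=> s; apply/cvgrPdist_lt => e e0.
have e5 : 0 < e / 5 by rewrite divr_gt0.
have [J [hJ _]] := oscillation_approx e5.
have cP := @trig_sum_continuous _ J (fun i => complex.Re (d i)) (fun i => complex.Im (d i)) k s.
set p := fun s => \sum_(i <- J) _ in hJ cP; near=> t.
have hp : `|p s - p t| < e / 5 by near: t; exact: (@cvgr_dist_lt _ _ _ _ _ _ _ cP _ e5).
have h1 : `|complex.Re (f t) - p t| <= _ := hJ t.
have h2 : `|complex.Re (f s) - p s| <= _ := hJ s.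
have -> : complex.Re (f s) - complex.Re (f t) =
  (complex.Re (f s) - p s) + (p s - p t) - (complex.Re (f t) - p t) by ring.
rewrite (le_lt_trans (ler_normB _ _))//.
have := ler_normD (complex.Re (f s) - p s) (p s - p t); lra.
Unshelve. all: by end_near.
Qed.

Lemma oscillation_integral : int01 (fun s => complex.Re (f s)) = complex.Re S.
Proof.
apply/eqP; rewrite -subr_eq0 -normr_le0; apply/ler_addgt0Pr => e e0.
have e4 : 0 < e / 4 by rewrite divr_gt0.
have [J [hJ1 hJ2]] := oscillation_approx e4.
set P := fun s => \sum_(i <- J) trig (complex.Re (d i)) (complex.Im (d i)) (k i) s in hJ1.
have cP : continuous P by exact: trig_sum_continuous.
have cf := oscillation_continuous.
have h1 : `|int01 (fun s => complex.Re (f s)) - int01 P| <= e / 4 + e / 4.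
  rewrite -int01B//; apply: int01_norm_le => // s.
  by apply: (continuousB (cf s) (cP s)).
rewrite int01_trig_sum in h1; set q := \sum_(i <- J) _ in h1 hJ2.
have -> : int01 (fun s => complex.Re (f s)) - complex.Re S =
   (int01 (fun s => complex.Re (f s)) - q) - (complex.Re S - q) by ring.
rewrite (le_trans (ler_normB _ _))//; lra.
Qed.
End Step.

(** The imaginary part of [f] is the real part of [- i f], so the real case
    applies twice. *)
Lemma cintegral01_series (I : choiceType) (d : I -> C) (k : I -> int) (f : R -> C) :
  abs_summable d ->
  (forall s : R, has_sum (fun i => d i * exp2ipi ((k i)%:~R * s%:C)) (f s)) ->
  has_sum (fun i => if k i == 0 then d i else 0) (cintegral01 f).
Proof.
move=> sd fs.
have [S hS] : exists S, has_sum (fun i => if k i == 0 then d i else 0) S.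
  apply: abs_summableP; apply: (abs_summable_le (J0 := fset0)) sd => i _.
  by case: ifP => // _; rewrite normr0.
suff -> : cintegral01 f = S by [].
rewrite /cintegral01 -!/(int01 _).
have h1 := oscillation_integral sd fs hS.
have h2 : int01 (fun s => complex.Re (- 'i%C * f s)) = complex.Re (- 'i%C * S).
  apply: (oscillation_integral (abs_summableZ (- 'i%C) sd)).
    by move=> s; apply: eq_has_sum (has_sumZ (- 'i%C) (fs s)) => i; rewrite mulrA.
  by apply: eq_has_sum (has_sumZ (- 'i%C) hS) => i; case: ifP => _ //; rewrite mulr0.
have RI (z : C) : complex.Re (- 'i%C * z) = complex.Im z by case: z => a b /=; ring.
rewrite RI in h2; have {}h2 : int01 (fun s => complex.Im (f s)) = complex.Im S.
  by rewrite -h2; congr int01; apply/funext => s; rewrite RI.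
by rewrite h1 h2; case: (S).
Qed.

(** One variable is integrated at a time: when the other ones are fixed, the
    integrand is an absolutely convergent series of oscillations in that variable,
    of which only those of frequency zero survive. *)
Lemma iterated_integral_series (V : finType) (I : choiceType) (c : I -> C) (k : I -> V -> int)
    (f : (V -> R) -> C) : abs_summable c ->
  (forall t, has_sum (fun i => c i * exp2ipi (\sum_v (k i v)%:~R * (t v)%:C)) (f t)) ->
  forall vs t, has_sum (fun i => if all (fun v => k i v == 0) vs
     then c i * exp2ipi (\sum_v (k i v)%:~R * (t v)%:C) else 0) (iterated_integral vs f t).
Proof.
move=> sc hf; elim=> [|v vs IH] t /=; first exact: hf.
pose t0 u := if u == v then 0 else t u.
have e t' i : \sum_u (k i u)%:~R * ((if u == v then t' else t u)%:C : C) =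
    \sum_u (k i u)%:~R * (t0 u)%:C + (k i v)%:~R * t'%:C.
  rewrite (bigD1 v)//= [in RHS](bigD1 v)//= /t0 eqxx mulr0 add0r addrC; congr (_ + _).
  by apply: eq_bigr => u uv; rewrite (negPf uv).
pose d i : C := if all (fun v => k i v == 0) vs then c i * exp2ipi (\sum_u (k i u)%:~R * (t0 u)%:C) else 0.
have norm1 i (t' : V -> R) : `|exp2ipi (\sum_u (k i u)%:~R * (t' u)%:C)| = 1.
  have -> : \sum_u (k i u)%:~R * (t' u)%:C = 1%:~R * (\sum_u (k i u)%:~R * t' u)%:C :> C.
    by rewrite mul1r rmorph_sum; apply: eq_bigr => u _; rewrite rmorphM/= intC.
  exact: norm_oscillation.
have sd : abs_summable d.
  apply: (abs_summable_le (J0 := fset0)) sc => i _; rewrite /d.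
  by case: ifP => _; rewrite ?normr0// normrM norm1 mulr1.
have h s : has_sum (fun i => d i * exp2ipi ((k i v)%:~R * s%:C))
   (iterated_integral vs f (fun u => if u == v then s else t u)).
  apply: eq_has_sum (IH _) => i; rewrite /d; case: ifP => _; last by rewrite mul0r.
  by rewrite e exp2ipiD mulrA.
apply: eq_has_sum (cintegral01_series sd h) => i; rewrite /d.
case: (eqVneq (k i v) 0) => //= kv; case: ifP => // _.
congr (_ * exp2ipi _); apply: eq_bigr => u _; rewrite /t0.
by case: eqP => [->|//]; rewrite kv !mul0r.
Qed.

End TrigonometricSeries.

(** * Balanced flows on graphs *)

Section Flows.
Local Open Scope ring_scope.
Variables (V E : finType).
Implicit Types (G : multigraph V E) (s : E -> int).

Definition divergence G s (v : V) : int :=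
  \sum_e s e * (((G e).1 == v)%:R - ((G e).2 == v)%:R).

(** Summation by parts: potentials on the vertices are paired with the
    divergence, their differences along the edges with the flow. *)
Lemma sum_divergence (A : comPzRingType) G s (y : V -> A) :
  \sum_v (divergence G s v)%:~R * y v = \sum_e (s e)%:~R * (y (G e).1 - y (G e).2).
Proof.
under eq_bigr do rewrite rmorph_sum mulr_suml.
rewrite exchange_big; apply: eq_bigr => e _.
have h (u : V) : \sum_v (u == v)%:R * y v = y u.
  rewrite (bigD1 u)//= eqxx mul1r big1 ?addr0// => v vu.
  by rewrite eq_sym (negPf vu) mul0r.
rewrite -(h (G e).1) -(h (G e).2) -sumrB mulr_sumr; apply: eq_bigr => v _.
by rewrite rmorphM rmorphB/= !mulrz_nat -mulrBl mulrA.
Qed.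

Lemma divergence_half_edges G s v :
  divergence G s v = \sum_(h | half_base G h == v) out_slope s h.
Proof.
rewrite /divergence.
have -> : \sum_(h | half_base G h == v) out_slope s h =
    \sum_e \sum_b (if half_base G (e, b) == v then out_slope s (e, b) else 0).
  by rewrite pair_big/= big_mkcond/=; apply: eq_bigr => -[e b].
apply: eq_bigr => e _; rewrite big_bool /half_base /out_slope/=.
by case: eqP => _; case: eqP => _; rewrite ?mulr1n ?mulr0n; ring.
Qed.

(** In a trivalent graph the two ends of a loop contribute opposite slopes, so
    balancing kills the slope of the third half-edge. *)
Lemma balanced_no_loop G s : trivalent G -> (forall e, s e != 0) ->
  (forall v, divergence G s v = 0) -> has_loop G = false.
Proof.
rewrite /has_loop /trivalent => /fintype.forallP tri s0 bal; apply/negbTE/fintype.existsPn => e; apply/eqP => loop.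
pose v := (G e).1; pose A := [set h | half_base G h == v]%SET.
have hf : (e, false) \in A by rewrite inE.
have ht : (e, true) \in (A :\ (e, false))%SET by rewrite !inE xpair_eqE andbF /half_base/= -loop eqxx.
have /eqP/cards1P[h Ah] : #|(A :\ (e, false) :\ (e, true))%SET| = 1%N.
  have : #|A| = 3%N.
    rewrite -(eqP (tri v)); apply: eq_card => h; rewrite inE.
    by apply/idP/idP => [hv|]; [exact: mem_set|rewrite in_setE].
  rewrite (cardsD1 (e, false)) hf (cardsD1 (e, true)) ht.
  by case.
have := bal v; rewrite divergence_half_edges.
rewrite (eq_bigl (fun h => h \in A)) => [|h']; last by rewrite [in RHS]inE.
rewrite (big_setD1 (e, false))//= (big_setD1 (e, true))//= Ah big_set1.
rewrite /out_slope/= addrA subrr add0r.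
by case: h.2 => /eqP; rewrite ?oppr_eq0 (negPf (s0 _)).
Qed.

End Flows.

Section FlowCount.
Variables (V E : finType).
Implicit Types (G : multigraph V E).

Definition flow_valid G (up : E -> bool) (a : {ffun E -> nat}) : set {ffun E -> int} :=
  [set s : {ffun E -> int} | (forall v, divergence G s v = 0) /\
     forall e, edge_ok (up e) (s e, a e)].

Definition flow_count G up a : nat :=
  (\sum_(s <- fset_set (flow_valid G up a)) \prod_e `|s e|%N)%N.

(** An edge with [a e != 0] has [|s e| <= a e], since [|s e|] divides [a e]. For
    an edge [e0] with [a e0 = 0], the vertices are cut at the level of its upper
    end: the net flow through the cut vanishes, all the edges with [a e = 0] cross it
    in the same direction, and the other ones cannot compensate for more than the
    sum of the [a e]. *)
Lemma flow_valid_bound d (T : orderType d) (y : V -> T) G up (a : {ffun E -> nat}) s :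
  (forall e, y (G e).1 != y (G e).2) ->
  (forall e, up e = (y (G e).2 < y (G e).1)%O) ->
  flow_valid G up a s -> forall e, (`|s e| <= \sum_e a e)%N.
Proof.
move=> yN upE [bal ok] e0.
have ale e : (a e <= \sum_e a e)%N by rewrite (bigD1 e)//= leq_addr.
have small e : a e != 0%N -> (`|s e| <= a e)%N.
  by move=> ae; have /and3P[_ /= dv _] := ok e; rewrite dvdn_leq// lt0n.
have [ae|ae] := eqVneq (a e0) 0%N; last exact: leq_trans (small _ ae) (ale _).
pose r := Order.max (y (G e0).1) (y (G e0).2).
(* The indicator of the vertices at or above the level r. *)
pose ind v : int := (r <= y v)%O%:R.
have := sum_divergence G s ind.
rewrite big1 => [|v _]; last by rewrite bal mul0r.
move/esym; rewrite (bigD1 e0)//=.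
have term e : - (a e)%:Z <= (s e)%:~R * (ind (G e).1 - ind (G e).2) :> int.
  rewrite /ind intz; have [a0|a0] := eqVneq (a e) 0%N; last first.
    have := small e a0; case: (r <= _)%O; case: (r <= _)%O => /=; lia.
  rewrite a0; have /and3P[/= sn _] := ok e; rewrite a0 eqxx/= upE => /eqP sup.
  case: (leP r (y (G e).1)) => h1; case: (leP r (y (G e).2)) => h2 //=; try lia.
    have lt : (y (G e).2 < y (G e).1)%O by exact: lt_le_trans h2 h1.
    by rewrite lt in sup; lia.
  have lt : (y (G e).1 < y (G e).2)%O by exact: lt_le_trans h1 h2.
  by rewrite ltNge (ltW lt) in sup; lia.
have rest : - (\sum_(e | e != e0) (a e)%:Z) <= \sum_(e | e != e0) (s e)%:~R * (ind (G e).1 - ind (G e).2) :> int.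
  by rewrite -sumrN; apply: ler_sum => e _; exact: term.
have main : (s e0)%:~R * (ind (G e0).1 - ind (G e0).2) = `|s e0|%N%:Z :> int.
  rewrite /ind intz /r; have /and3P[/= sn _] := ok e0; rewrite ae eqxx/= upE => /eqP sup.
  rewrite !ge_max !lexx/= ?andbT.
  by case: (ltgtP (y (G e0).1) (y (G e0).2)) sup (yN e0) => h /= sup; lia.
have sumE : (\sum_e a e)%N%:Z = (a e0)%:Z + \sum_(e | e != e0) (a e)%:Z.
  by rewrite (bigD1 e0)//= PoszD; congr (_ + _); rewrite -!natz natr_sum; apply: eq_bigr => e _; rewrite natz.
rewrite main => /eqP; rewrite addr_eq0 => /eqP h0; rewrite -lez_nat sumE h0.
by move: rest; rewrite lerNl => rest; apply: (le_trans rest); rewrite lerDr.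
Qed.

Lemma finite_flow_valid d (T : orderType d) (y : V -> T) G up (a : {ffun E -> nat}) :
  (forall e, y (G e).1 != y (G e).2) ->
  (forall e, up e = (y (G e).2 < y (G e).1)%O) -> finite_set (flow_valid G up a).
Proof.
move=> yN upE; pose N := (\sum_e a e)%N.
pose val_of (x : bool * 'I_N.+1) : int := if x.1 then (x.2 : nat)%:Z else - (x.2 : nat)%:Z.
pose h (f : {ffun E -> bool * 'I_N.+1}) : {ffun E -> int} := [ffun e => val_of (f e)].
apply: (@sub_finite_set _ _ (range h)); last exact: finite_image.
move=> s /(flow_valid_bound yN upE) sN.
have sN' e : (`|s e| < N.+1)%N by rewrite ltnS.
exists [ffun e => (0 <= s e, Ordinal (sN' e))] => //.
by apply/ffunP => e; rewrite !ffunE /val_of/=; case: ifP => ?; lia.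
Qed.

Lemma flow_count_loop G up a : trivalent G -> has_loop G -> flow_count G up a = 0%N.
Proof.
move=> tri loop; rewrite /flow_count (_ : flow_valid _ _ _ = set0) ?fset_set0 ?big_seq_fset0//.
rewrite -subset0 => s [bal ok] /=.
by move: loop; rewrite (balanced_no_loop tri _ bal)// => e; have /and3P[] := ok e.
Qed.
End FlowCount.

(** * The expansion of Feynman integrals *)

Section Order.
Local Open Scope complex_scope.
Local Open Scope ring_scope.
Variables (R : realType) (g : nat).
Local Notation C := R[i].
Variables (G : feynman_graph g) (tau : edge g -> C) (y : vert g -> R).
Hypothesis tau0 : forall k, 0 < complex.Im (tau k).
Hypothesis y_tau : forall i j k, `|y i - y j| < complex.Im (tau k).
Hypothesis y_inj : injective y.
Hypothesis no_loop : has_loop (val G) = false.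

Let src k := (val G k).1.
Let tgt k := (val G k).2.
Let up k := y (tgt k) < y (src k).
Let q k := nome (tau k).
Let drop k : C := 0 +i* (y (src k) - y (tgt k)).

Lemma no_loopP k : src k != tgt k.
Proof. by apply: contraFneq no_loop => h; apply/fintype.existsP; exists k; apply/eqP. Qed.

Let coef k (sa : int * nat) : C := if edge_ok (up k) sa then edge_coef (q k) sa else 0.

Lemma has_sum_edge (t : vert g -> R) k :
  has_sum (fun sa => coef k sa * exp2ipi (sa.1%:~R * drop k) *
                     exp2ipi (sa.1%:~R * (t (src k) - t (tgt k))%:C))
    (- propagator ((t (src k) +i* y (src k)) - (t (tgt k) +i* y (tgt k))) (tau k)).
Proof.
set z := (X in propagator X _).
have zI : complex.Im z = y (src k) - y (tgt k) by [].
have z0 : complex.Im z != 0.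
  by rewrite zI subr_eq0; apply: contraNneq (no_loopP k) => /y_inj ->.
have zt : `|complex.Im z| < complex.Im (tau k) by rewrite zI.
have := has_sum_propagator (tau0 k) z0 zt; rewrite zI subr_gt0.
apply: eq_has_sum => sa; rewrite /coef -/(up k); case: ifP => _; last by rewrite !mul0r.
rewrite -mulrA -exp2ipiD -mulrDr; congr (_ * exp2ipi (_ * _)).
by apply/eqP; rewrite eq_complex/= !add0r addr0 !eqxx.
Qed.

Let flow (F : {ffun edge g -> int * nat}) : edge g -> int := fun k => (F k).1.
Let total_coef (F : {ffun edge g -> int * nat}) : C :=
  \prod_k (coef k (F k) * exp2ipi ((F k).1%:~R * drop k)).

Lemma exp2ipi_sum (T : Type) (r : seq T) (f : T -> C) :
  \prod_(i <- r) exp2ipi (f i) = exp2ipi (\sum_(i <- r) f i).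
Proof. by rewrite /exp2ipi cexp_sum mulr_sumr. Qed.

(** Expanding the product of the propagators turns the integrand into a Fourier
    series in the real parts [t], indexed by the flows with their windings. By
    summation by parts the frequency of [t v] is the divergence at [v]. *)
Lemma has_sum_integrand (t : vert g -> R) :
  has_sum (fun F => total_coef F * exp2ipi (\sum_v (divergence (val G) (flow F) v)%:~R * (t v)%:C))
    (\prod_k - propagator ((t (src k) +i* y (src k)) - (t (tgt k) +i* y (tgt k))) (tau k)).
Proof.
have h := has_sum_prod (@has_sum_edge t).
apply: eq_has_sum h => F.
rewrite big_split/=; congr (_ * _).
rewrite (sum_divergence (val G) (flow F) (fun v => (t v)%:C : C)) exp2ipi_sum.
by congr exp2ipi; apply: eq_bigr => k _; rewrite rmorphB.
Qed.

(** For a balanced flow the heights [y] disappear, again by summation by parts: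
    they only matter through their order. *)
Lemma total_coef_balanced F : (forall v, divergence (val G) (flow F) v = 0) ->
  total_coef F = \prod_k coef k (F k).
Proof.
move=> bal; rewrite /total_coef big_split/= exp2ipi_sum.
have := sum_divergence (val G) (flow F) (fun v => 0 +i* y v : C).
rewrite big1 => [h|v _]; last by rewrite bal mul0r.
suff -> : \sum_k (F k).1%:~R * drop k = 0 by rewrite exp2ipi0 mulr1.
rewrite [RHS]h; apply: eq_bigr => k _; congr (_ * _).
by apply/eqP; rewrite eq_complex/= subr0 !eqxx.
Qed.

Lemma has_sum_order :
  has_sum (fun F => if [forall v, divergence (val G) (flow F) v == 0] then \prod_k coef k (F k) else 0)
    (feynman_integral_order G tau y).
Proof.
rewrite /feynman_integral_order no_loop.
have sc : abs_summable total_coef.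
  have := has_sum_abs (@has_sum_integrand (fun=> 0)).
  congr (abs_summable _); apply/funext => F.
  by rewrite big1 ?exp2ipi0 ?mulr1// => v _; rewrite mulr0.
have h := iterated_integral_series sc (@has_sum_integrand) (vs := enum (vert g)) (t := fun=> 0).
apply: eq_has_sum h => F.
have -> : all (fun v => divergence (val G) (flow F) v == 0) (enum (vert g)) =
    [forall v, divergence (val G) (flow F) v == 0].
  by apply/allP/fintype.forallP => h v; [apply: h; rewrite mem_enum|].
case: ifP => // /fintype.forallP bal.
rewrite total_coef_balanced => [|v]; last exact/eqP.
by rewrite [\sum_v _]big1 ?exp2ipi0 ?mulr1// => v _; rewrite mulr0.
Qed.

Lemma prod_coef F : \prod_k coef k (F k) =
  if [forall k, edge_ok (up k) (F k)] then
    (\prod_k `|(F k).1|)%N%:R * monomial q (twice [ffun k => (F k).2]) else 0.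
Proof.
case: ifPn => [/fintype.forallP ok|].
  rewrite natr_prod /monomial -big_split/=; apply: eq_bigr => k _.
  by rewrite /coef ok /edge_coef !ffunE.
rewrite negb_forall => /fintype.existsP[k nok].
by rewrite (bigD1 k)//= /coef (negPf nok) mul0r.
Qed.

(** The terms are grouped by the exponents of the [q_k], which are all even. *)
Lemma feynman_order_series_no_loop :
  has_sum (fun b => even_series R (flow_count (val G) up) b * monomial q b)
    (feynman_integral_order G tau y).
Proof.
pose beta (F : {ffun edge g -> int * nat}) : exponent g := twice [ffun k => (F k).2].
apply: (@has_sum_partition _ _ _ beta _ _ _ has_sum_order) => b.
rewrite /even_series; case: ifPn => [/fintype.forallP even|odd]; last first.
  rewrite mul0r; apply: eq_has_sum (@has_sum0 R _) => F; case: eqP => // e.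
  case/negP: odd; apply/fintype.forallP => k.
  by rewrite -e !ffunE mul2n odd_double.
set a := [ffun k => (b k)./2].
have ba : b = twice a by apply/ffunP => k; rewrite !ffunE mul2n even_halfK// even.
have fin : finite_set (flow_valid (val G) up a).
  apply: (@finite_flow_valid _ _ _ _ y) => // k.
  by apply: contraNneq (no_loopP k) => /y_inj e; apply/eqP.
pose h (s : {ffun edge g -> int}) : {ffun edge g -> int * nat} := [ffun k => (s k, a k)].
have hI : injective h by move=> s s' /ffunP e; apply/ffunP => k; have := e k; rewrite !ffunE => -[].
apply: (has_sum_extend hI) => [F nF|].
  case: eqP => // e; have := nF [ffun k => (F k).1]; rewrite (_ : h _ = F) ?eqxx//.
  apply/ffunP => k; have e2 : (F k).2 = a k.
    have /ffunP/(_ k) := e; rewrite ba [twice a k]ffunE [beta F k]ffunE ffunE => /eqP.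
    by rewrite eqn_mul2l => /eqP.
  by rewrite [h _ k]ffunE ffunE -e2; case: (F k).
rewrite /flow_count natr_sum mulr_suml.
pose u (s : {ffun edge g -> int}) : C :=
  if s \in fset_set (flow_valid (val G) up a) then (\prod_k `|s k|)%N%:R * monomial q b else 0.
have : has_sum u (\sum_(s <- fset_set (flow_valid (val G) up a)) u s).
  by apply: has_sum_finite => s; rewrite /u => /negPf ->.
rewrite [X in has_sum _ X](_ : _ = \sum_(s <- fset_set (flow_valid (val G) up a)) (\prod_k `|s k|)%N%:R * monomial q b); last first.
  by rewrite big_seq [RHS]big_seq; apply: eq_bigr => s; rewrite /u => ->.
apply: eq_has_sum => s; rewrite /u in_fset_set//.
have -> : (twice [ffun k => (h s k).2] == b).
  by apply/eqP; rewrite ba; apply/ffunP => k; rewrite !ffunE.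
rewrite prod_coef.
have -> : monomial q (twice [ffun k => (h s k).2]) = monomial q b.
  by rewrite ba; congr monomial; apply/ffunP => k; rewrite !ffunE.
have -> : (\prod_k `|(h s k).1|)%N = (\prod_k `|s k|)%N by apply: eq_bigr => k _; rewrite ffunE.
have fl v : divergence (val G) (flow (h s)) v = divergence (val G) s v.
  by apply: eq_bigr => k _; rewrite /flow ffunE.
case: ifPn => [/set_mem[bal ok]|ns].
  rewrite ifT; last by apply/fintype.forallP => v; rewrite fl bal.
  by rewrite ifT//; apply/fintype.forallP => k; rewrite ffunE; exact: ok.
case: ifPn => // /fintype.forallP bal; case: ifPn => // /fintype.forallP ok.
case/negP: ns; apply/mem_set; split=> [v|k]; first by rewrite -fl; exact/eqP.
by have := ok k; rewrite ffunE.
Qed.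
End Order.

Section Total.
Local Open Scope complex_scope.
Local Open Scope ring_scope.
Variables (R : realType) (g : nat).
Local Notation C := R[i].

Definition order_up (G : multigraph (vert g) (edge g)) (Omega : {perm vert g}) (k : edge g) : bool :=
  (Omega (G k).2 < Omega (G k).1)%N.

(** If the graph has a loop both sides vanish, the integral by convention and the
    coefficients by [balanced_no_loop]. *)
Lemma feynman_order_series (G : feynman_graph g) (tau : edge g -> C) (y : vert g -> R)
    (Omega : {perm vert g}) :
  (forall k, 0 < complex.Im (tau k)) ->
  (forall i j k, `|y i - y j| < complex.Im (tau k)) ->
  (forall i j, (y i < y j) = (Omega i < Omega j)%N) ->
  has_sum (fun b => even_series R (flow_count (val G) (order_up (val G) Omega)) b *
                    monomial (fun k => nome (tau k)) b)
    (feynman_integral_order G tau y).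
Proof.
move=> tau0 y_tau y_lt; have [loop|no_loop] := boolP (has_loop (val G)).
  rewrite /feynman_integral_order loop; apply: eq_has_sum (@has_sum0 R _) => b.
  rewrite /even_series flow_count_loop ?if_same ?mul0r//.
  by have /and3P[] := valP G.
have y_inj : injective y.
  move=> i j e; apply: (@perm_inj _ Omega); apply: val_inj => /=.
  by case: (ltngtP (Omega i) (Omega j)) => //; rewrite -y_lt e ltxx.
have := feynman_order_series_no_loop tau0 y_tau y_inj (negbTE no_loop).
rewrite (_ : (fun k => y _ < y _) = order_up (val G) Omega)//.
by apply/funext => k; rewrite y_lt.
Qed.

Lemma feynman_integral_series (G : feynman_graph g) :
  expands_to (@feynman_integral R g G)
    (even_series R (fun a => \sum_Omega flow_count (val G) (order_up (val G) Omega) a)%N).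
Proof.
move=> tau Y tau0 adm.
have h (Omega : {perm vert g}) : has_sum (fun b => even_series R (flow_count (val G) (order_up (val G) Omega)) b *
                    monomial (fun k => nome (tau k)) b) (feynman_integral_order G tau (Y Omega)).
  by have [y_lt y_tau] := adm Omega; exact: feynman_order_series.
have := @has_sum_big R _ _ (index_enum _) xpredT _ _ (fun Omega _ => h Omega).
apply: eq_has_sum => b; rewrite -mulr_suml; congr (_ * _); rewrite /even_series.
by case: ifP => _; [rewrite natr_sum|rewrite big1].
Qed.

Lemma iterated_integral0 (V : eqType) (vs : seq V) (t : V -> R) :
  iterated_integral vs (fun=> 0 : C) t = 0.
Proof.
elim: vs t => [|v vs IH] t //=.
rewrite (_ : (fun s => _) = fun=> 0); last by apply/funext => s; rewrite IH.
by rewrite /cintegral01/= -!/(int01 _) int01_cst.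
Qed.

(** On the line [tau k = 2 (t k) + i] the [b]-th monomial is a nonzero constant
    times the oscillation of frequency [b] in [t]; integrating against the
    opposite oscillation over the unit cube isolates one coefficient of the
    difference of the two series. *)
Lemma expands_to_unique F (c c' : power_series R g) :
  expands_to F c -> expands_to F c' -> c = c'.
Proof.
move=> hc hc'.
pose tau (t : edge g -> R) k : C := (2 * t k) +i* 1.
(* Heights of spread less than 1, which is the imaginary part of tau. *)
pose Y (Omega : {perm vert g}) (i : vert g) : R := (Omega i : nat)%:R / (2 * g - 2)%N.+1%:R.
have N0 : (0 : R) < (2 * g - 2)%N.+1%:R by rewrite ltr0n.
have adm t : admissible_heights (tau t) Y.
  move=> Omega; split=> [i j|i j k].
    by rewrite /Y ltr_pM2r ?invr_gt0// ltr_nat.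
  rewrite /Y -mulrBl normrM normfV (gtr0_norm N0) ltr_pdivrMr// mul1r.
  have hi (i' : vert g) : (0 : R) <= (Omega i' : nat)%:R < ((2 * g - 2)%N.+1%:R : R).
    by rewrite ler0n ltr_nat ltnS ltnW.
  by have /andP[? ?] := hi i; have /andP[? ?] := hi j; rewrite ltr_norml; apply/andP; split; lra.
have Im1 t k : 0 < complex.Im (tau t k) by exact: ltr01.
pose d b : C := c b - c' b.
have hd t : has_sum (fun b => d b * monomial (fun k => nome (tau t k)) b) 0.
  have := has_sumD (hc _ _ (Im1 t) (adm t)) (has_sumZ (-1) (hc' _ _ (Im1 t) (adm t))).
  by rewrite mulN1r subrr; apply: eq_has_sum => b; rewrite /d mulrBl mulN1r.
have mono t (b : exponent g) : monomial (fun k => nome (tau t k)) b =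
    (\prod_k exp2ipi ((b k)%:R * (0 +i* 2^-1))) * exp2ipi (\sum_k (b k)%:~R * (t k)%:C).
  rewrite /monomial -exp2ipi_sum -big_split/=; apply: eq_bigr => k _.
  rewrite -exp2ipiD /nome -complexiE cexpMn /exp2ipi -pmulrn; congr cexp.
  have -> : tau t k = 2 * (t k)%:C + 2 * (0 +i* 2^-1).
    by apply/eqP; rewrite eq_complex/=; apply/andP; split; apply/eqP; field.
  rewrite rmorphM rmorph_nat/=; ring.
apply/funext => b0; apply/eqP; rewrite -subr_eq0 -/(d b0).
pose D b : C := d b * \prod_k exp2ipi ((b k)%:R * (0 +i* 2^-1)).
have sD : abs_summable D.
  have := has_sum_abs (hd (fun=> 0)); congr (abs_summable _); apply/funext => b.
  by rewrite mono [\sum_k _]big1 ?exp2ipi0 ?mulr1// => k _; rewrite mulr0.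
have hD t : has_sum (fun b => D b * exp2ipi (\sum_k ((b k)%:Z - (b0 k)%:Z)%:~R * (t k)%:C)) 0.
  have := has_sumZ (exp2ipi (- \sum_k (b0 k)%:~R * (t k)%:C)) (hd t).
  rewrite mulr0; apply: eq_has_sum => b; rewrite mono /D -!mulrA mulrCA; congr (_ * _).
  rewrite mulrCA; congr (_ * _); rewrite -exp2ipiD -sumrN -big_split/=; congr exp2ipi.
  by apply: eq_bigr => k _; rewrite rmorphB/=; ring.
have := iterated_integral_series sD hD (vs := enum (edge g)) (t := fun=> 0).
rewrite iterated_integral0 => h0.
have h1 : has_sum (fun b => if b == b0 then D b else 0) 0.
  apply: eq_has_sum h0 => b.
  have -> : all (fun k => (b k)%:Z - (b0 k)%:Z == 0) (enum (edge g)) = (b == b0).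
    apply/allP/eqP => [h|-> k _]; last by rewrite subrr.
    by apply/ffunP => k; have := h k; rewrite mem_enum subr_eq0 => /(_ isT)/eqP[].
  by case: ifP => // _; rewrite [\sum_k _]big1 ?exp2ipi0 ?mulr1// => k _; rewrite mulr0.
have := @has_sum_single R _ (fun b => if b == b0 then D b else 0) b0.
rewrite eqxx => h2; have := has_sum_unique h1 (h2 (fun b n => ifN_eq _ _ n)).
rewrite /D => /esym/eqP; rewrite mulf_eq0 => /orP[//|].
by rewrite prodf_seq_eq0 => /hasP[k _]; rewrite (negPf (exp2ipi_neq0 _)).
Qed.

End Total.

(** * The tropical elliptic curve *)

Section Circle.
Local Open Scope ring_scope.
Variables (R : realType) (L : {posnum R}).
Implicit Types (x y : R) (c : circle L).

Lemma circle_projP x y :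
  circle_proj L x = circle_proj L y <-> exists n : int, x = y + n%:~R * L%:num.
Proof.
have L0 : L%:num != 0 :> R by [].
split=> [/(congr1 val)/= h|[n ->]].
  exists (Num.floor (x / L%:num) - Num.floor (y / L%:num)).
  by rewrite rmorphB/= mulrBl addrA [y + _]addrC -addrA -h; ring.
apply: val_inj => /=; rewrite mulrDl mulfK// floorDrz ?intr_int// intrKfloor.
by rewrite rmorphD/=; ring.
Qed.

Lemma circle_projDint x (n : int) : circle_proj L (x + n%:~R * L%:num) = circle_proj L x.
Proof. by apply/circle_projP; exists n. Qed.

Lemma circle_proj_val c : circle_proj L (val c) = c.
Proof.
apply: val_inj => /=; rewrite (_ : Num.floor _ = 0) ?mul0r ?subr0//.
apply/eqP; rewrite floor_eq; case: c => x /= /andP[x0 xL].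
by rewrite ler_pdivlMr// mul0r x0 add0r ltr_pdivrMr// mul1r.
Qed.

Lemma circle_dist_le x y : circle_dist (circle_proj L x) (circle_proj L y) <= `|x - y|.
Proof.
rewrite /circle_dist; set a := val _; set b := val _.
have ab : `|a - b| < L%:num.
  rewrite /a /b ltr_norml.
  by have /andP[? ?] := valP (circle_proj L x); have /andP[? ?] := valP (circle_proj L y); apply/andP; split; lra.
have [n hn] : exists n : int, a - b = (x - y) + n%:~R * L%:num.
  exists (Num.floor (y / L%:num) - Num.floor (x / L%:num)).
  by rewrite /a /b /= rmorphB/=; ring.
rewrite ge_min; have [n0|n0] := eqVneq n 0; first by rewrite hn n0 mul0r addr0 lexx.
apply/orP; right.
have : L%:num <= `|n%:~R * L%:num|.
  rewrite normrM (gtr0_norm (gt0 L)) ler_peMl//.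
  by rewrite -intr_norm -[leLHS]/(1%:~R) ler_int -gtz0_ge1 normr_gt0.
have -> : n%:~R * L%:num = (a - b) - (x - y) by rewrite hn; ring.
have := ler_normB (a - b) (x - y); lra.
Qed.

(** The distance from [p0] to [c] along the positively oriented circle. Cutting
    the circle at [p0] in this way orders the other points. *)
Definition circle_pos (p0 c : circle L) : R :=
  if val c < val p0 then val c - val p0 + L%:num else val c - val p0.

Lemma circle_posK p0 c : circle_proj L (val p0 + circle_pos p0 c) = c.
Proof.
rewrite /circle_pos; case: ifP => _; last by rewrite addrC subrK circle_proj_val.
have -> : val p0 + (val c - val p0 + L%:num) = val c + 1%:~R * L%:num by ring.
by rewrite circle_projDint circle_proj_val.
Qed.

Lemma circle_pos_itv p0 c : 0 <= circle_pos p0 c < L%:num.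
Proof.
have /andP[? ?] := valP p0; have /andP[? ?] := valP c.
by rewrite /circle_pos; case: ltP => h; apply/andP; split; lra.
Qed.

Lemma circle_pos_inj p0 : injective (circle_pos p0).
Proof. by move=> c c' h; rewrite -(circle_posK p0 c) h circle_posK. Qed.

Lemma circle_pos_gt0 p0 c : c <> p0 -> 0 < circle_pos p0 c.
Proof.
move=> cp; have /andP[h _] := circle_pos_itv p0 c; rewrite lt_def h andbT.
by apply/eqP => e; apply: cp; rewrite -(circle_posK p0 c) e addr0 circle_proj_val.
Qed.

(** Two affine maps to the circle that agree have lifts differing by multiples of
    [L]; on a sufficiently short segment the multiple is constant. *)
Lemma affine_slope_unique (A s A' s' l : R) : 0 < l ->
  (forall t, 0 <= t <= l -> circle_proj L (A + s * t) = circle_proj L (A' + s' * t)) -> s = s'.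
Proof.
move=> l0 h; apply/eqP; rewrite -subr_eq0; apply/negP => /negP ss.
have n0 : 0 < `|s - s'| by rewrite normr_gt0.
have [n hn] := (circle_projP _ _).1 (h 0 (introT andP (conj (lexx _) (ltW l0)))).
(* Up to this parameter the two lifts separate by at most L / 2. *)
pose t := Num.min l (L%:num / (2 * `|s - s'|)).
have t0 : 0 < t by rewrite lt_min l0 divr_gt0// mulr_gt0.
have tl : 0 <= t <= l by rewrite ltW//= ge_min lexx.
have [m hm] := (circle_projP _ _).1 (h t tl).
have e : (s - s') * t = (m - n)%:~R * L%:num by rewrite rmorphB/= mulrBl; lra.
have e1 : `|(s - s') * t| < L%:num.
  rewrite normrM (gtr0_norm t0) mulrC -ltr_pdivlMr//.
  apply: (@le_lt_trans _ _ (L%:num / (2 * `|s - s'|))); first by rewrite ge_min lexx orbT.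
  by rewrite ltr_pM2l// ltf_pV2 ?posrE ?mulr_gt0//; lra.
have e0 : (s - s') * t != 0 by rewrite mulf_neq0// gt_eqF.
rewrite e in e0 e1; move: e0 e1; rewrite mulf_eq0 negb_or intr_eq0 => /andP[mn _].
rewrite normrM (gtr0_norm (gt0 L)) -[ltRHS]mul1r ltr_pM2r// -intr_norm -[ltRHS]/(1%:~R) ltr_int.
have h1 : 0 < `|m - n| by rewrite normr_gt0.
by lia.
Qed.

Lemma nat_offset (al be n : int) (N : nat) : N%:Z = be - al -> al < n -> n < be + 1 ->
  exists2 i : nat, (i < N)%N & al + 1 + i%:Z = n.
Proof. by move=> NE n1 n2; exists `|(n - al - 1)%R|%N; lia. Qed.

(** The fibre corresponds to the terms of the progression [P + n L] between [A]
    and [A + s * l], which a difference of integer parts counts since neither end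
    belongs to the progression. *)
Lemma card_affine_fiber (T : choiceType) (gam : R -> T) (A s l P : R) (F : set T) :
  0 < l -> 0 < s ->
  (forall t t', 0 < t < l -> 0 < t' < l -> gam t = gam t' -> t = t') ->
  (forall n : int, A <> P + n%:~R * L%:num) ->
  (forall n : int, A + s * l <> P + n%:~R * L%:num) ->
  F = [set gam t | t in [set t | 0 <= t <= l /\ circle_proj L (A + s * t) = circle_proj L P]] ->
  (#|` fset_set F |%:Z = Num.floor ((A + s * l - P) / L%:num) - Num.floor ((A - P) / L%:num))%R.
Proof.
move=> l0 s0 gI hA hB ->.
set al := Num.floor ((A - P) / L%:num); set be := Num.floor _.
have Lp : 0 < L%:num :> R by [].
have alA : al%:~R * L%:num < A - P < (al + 1)%:~R * L%:num.
  have := floor_itv ((A - P) / L%:num); rewrite -/al ler_pdivlMr// ltr_pdivrMr// => /andP[h ->].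
  rewrite andbT lt_neqAle h andbT; apply/eqP => e; apply: (hA al); lra.
have beB : be%:~R * L%:num < A + s * l - P < (be + 1)%:~R * L%:num.
  have := floor_itv ((A + s * l - P) / L%:num); rewrite -/be ler_pdivlMr// ltr_pdivrMr// => /andP[h ->].
  rewrite andbT lt_neqAle h andbT; apply/eqP => e; apply: (hB be); lra.
have ab : al <= be.
  by apply: le_floor; rewrite ler_pM2r ?invr_gt0//; have := mulr_gt0 s0 l0; lra.
pose N := `|be - al|%N.
have NE : N%:Z = be - al by rewrite /N; lia.
pose tt (i : nat) := (P + (al + 1 + i%:Z)%:~R * L%:num - A) / s.
have ttE i : A + s * tt i = P + (al + 1 + i%:Z)%:~R * L%:num.
  by rewrite /tt; field; rewrite gt_eqF.
have ttin i : (i < N)%N -> 0 < tt i < l.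
  move=> iN; have hi : (al + 1 + i%:Z) <= be by lia.
  have hi' : al + 1 <= al + 1 + i%:Z by lia.
  rewrite /tt divr_gt0 ?ltr_pdivrMr//=; last first.
    have : (al + 1)%:~R * L%:num <= (al + 1 + i%:Z)%:~R * L%:num by rewrite ler_pM2r// ler_int.
    by case/andP: alA => _; lra.
  have : (al + 1 + i%:Z)%:~R * L%:num <= be%:~R * L%:num by rewrite ler_pM2r// ler_int.
  by case/andP: beB => + _; lra.
have -> : [set gam t | t in [set t | 0 <= t <= l /\ circle_proj L (A + s * t) = circle_proj L P]] =
    (fun i => gam (tt i)) @` `I_N.
  apply/seteqP; split=> [_ [t [/andP[t0 tl] /circle_projP[n hn]] <-]|_ [i /= iN <-]]; last first.
    have /andP[h1 h2] := ttin i iN; exists (tt i) => //; split; first by rewrite !ltW.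
    by rewrite ttE circle_projDint.
  have st0 : 0 <= s * t by rewrite mulr_ge0// ltW.
  have stl : s * t <= s * l by rewrite ler_pM2l.
  have n1 : al < n.
    rewrite -(ltr_int R) -(ltr_pM2r Lp); case/andP: alA => h _; lra.
  have n2 : n < be + 1.
    rewrite -(ltr_int R) -(ltr_pM2r Lp); case/andP: beB => _ h; lra.
  have [i iN ei] := nat_offset NE n1 n2; exists i => //=.
  congr gam; apply: (mulfI (lt0r_neq0 s0)).
  have := ttE i; rewrite ei; lra.
have inj : {in `I_N &, injective (fun i => gam (tt i))}.
  move=> i j; rewrite !in_setE /= => iN jN /(gI _ _ (ttin i iN) (ttin j jN)) e.
  have := congr1 (fun t => A + s * t) e; rewrite !ttE => /addrI/(mulIf (lt0r_neq0 Lp)) /eqP.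
  by rewrite eqr_int => /eqP; lia.
have -> : #|` fset_set ((fun i => gam (tt i)) @` `I_N)| = N.
  by apply: card_fset_set; exact: inj_card_eq.
by [].
Qed.
End Circle.

(** * Curves and covers oriented by a reference graph *)

Section Curves.
Local Open Scope ring_scope.
Variables (R : realType) (V E : finType).
Implicit Types (C D : tropical_curve R V E) (G : multigraph V E).

Lemma edge_param_inner C e t (h : 0 < t < curve_len C e) :
  edge_param C e t = inr (exist (fun x : E * R => is_true (0 < x.2 < curve_len C x.1)) (e, t) h).
Proof. by rewrite /edge_param insubT. Qed.

Lemma edge_param_outer C e t : ~~ (0 < t < curve_len C e) ->
  edge_param C e t = inl (if t <= 0 then (curve_graph C e).1 else (curve_graph C e).2).
Proof. by move=> h; rewrite /edge_param insubN. Qed.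

Lemma edge_param0 C e : edge_param C e 0 = inl (curve_graph C e).1.
Proof. by rewrite edge_param_outer ?ltxx// lexx. Qed.

Lemma edge_param_len C e : edge_param C e (curve_len C e) = inl (curve_graph C e).2.
Proof. by rewrite edge_param_outer ?ltxx ?andbF// leNgt curve_len_gt0. Qed.

Lemma edge_param_inner_inj C e e' t t' : 0 < t < curve_len C e ->
  edge_param C e t = edge_param C e' t' -> e = e' /\ t = t'.
Proof.
move=> h; rewrite (edge_param_inner h); have [h'|h'] := boolP (0 < t' < curve_len C e').
  by rewrite (edge_param_inner h') => -[-> ->].
by rewrite edge_param_outer.
Qed.

Lemma curve_pointP C (x : curve_point C) : (exists v, x = inl v) \/
  exists e, exists2 t, 0 < t < curve_len C e & x = edge_param C e t.
Proof.
case: x => [v|[[e t] /= h]]; [by left; exists v|right; exists e, t => //].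
by rewrite (edge_param_inner h).
Qed.

Lemma same_ends_refl (x : V * V) : same_ends x x.
Proof. by rewrite /same_ends eqxx. Qed.

Lemma same_ends_sym (x y : V * V) : same_ends x y -> same_ends y x.
Proof.
by case: x y => [a b] [c d]; rewrite /same_ends/= => /orP[/eqP[-> ->]|/eqP[-> ->]]; rewrite eqxx ?orbT.
Qed.

Lemma same_ends_trans (x y z : V * V) : same_ends x y -> same_ends y z -> same_ends x z.
Proof.
case: x y z => [a b] [c d] [e f]; rewrite /same_ends/=.
by move=> /orP[/eqP[-> ->]|/eqP[-> ->]] /orP[/eqP[-> ->]|/eqP[-> ->]]; rewrite eqxx ?orbT.
Qed.

Definition same_dir C G e := curve_graph C e == G e.

Definition flip C G e t := if same_dir C G e then t else curve_len C e - t.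

(** The curve may store an edge with its ends exchanged with respect to the
    reference graph [G]; [orient_param] runs through the edge as [G] does. *)
Definition orient_param C G e t := edge_param C e (flip C G e t).

Lemma flip_flip C G e t : flip C G e (flip C G e t) = t.
Proof. by rewrite /flip; case: same_dir => //; rewrite opprB addrC subrK. Qed.

Lemma flip_itv C G e t : 0 <= t <= curve_len C e -> 0 <= flip C G e t <= curve_len C e.
Proof. by move=> /andP[? ?]; rewrite /flip; case: same_dir; apply/andP; split; lra. Qed.

Lemma flip_itvo C G e t : 0 < t < curve_len C e -> 0 < flip C G e t < curve_len C e.
Proof. by move=> /andP[? ?]; rewrite /flip; case: same_dir; apply/andP; split; lra. Qed.

Lemma edge_param_orient C G e t : edge_param C e t = orient_param C G e (flip C G e t).
Proof. by rewrite /orient_param flip_flip. Qed.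

Section Oriented.
Variables (C : tropical_curve R V E) (G : multigraph V E).
Hypothesis CG : same_graph (curve_graph C) G.

Lemma not_same_dir e : ~~ same_dir C G e -> curve_graph C e = ((G e).2, (G e).1).
Proof. by rewrite /same_dir => h; move: (CG e); rewrite /same_ends (negPf h) => /eqP. Qed.

Lemma orient_param0 e : orient_param C G e 0 = inl (G e).1.
Proof.
rewrite /orient_param /flip; case: ifPn => [/eqP <-|/not_same_dir cg]; first exact: edge_param0.
by rewrite subr0 edge_param_len cg.
Qed.

Lemma orient_param_len e : orient_param C G e (curve_len C e) = inl (G e).2.
Proof.
rewrite /orient_param /flip; case: ifPn => [/eqP <-|/not_same_dir cg]; first exact: edge_param_len.
by rewrite subrr edge_param0 cg.
Qed.

Lemma orient_param_inj e e' t t' : 0 < t < curve_len C e ->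
  orient_param C G e t = orient_param C G e' t' -> e = e' /\ t = t'.
Proof.
rewrite /orient_param => h /edge_param_inner_inj[]; first exact: flip_itvo.
by move=> <- h'; split=> //; rewrite -(flip_flip C G e t) h' flip_flip.
Qed.

Lemma orient_pointP (x : curve_point C) : (exists v, x = inl v) \/
  exists e, exists2 t, 0 < t < curve_len C e & x = orient_param C G e t.
Proof.
have [[v ->]|[e [t h ->]]] := curve_pointP x; first by left; exists v.
right; exists e, (flip C G e t); first exact: flip_itvo.
exact: edge_param_orient.
Qed.

Lemma on_edgeP e x : on_edge C e x <->
  exists2 t, 0 <= t <= curve_len C e & x = orient_param C G e t.
Proof.
split=> [[t]|[t h ->]].
  rewrite /= in_itv/= => h <-; exists (flip C G e t); first exact: flip_itv.
  exact: edge_param_orient.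
by exists (flip C G e t) => //=; rewrite in_itv/=; exact: flip_itv.
Qed.
End Oriented.

Section Covers.
Variables (L : {posnum R}) (C : tropical_curve R V E) (f : tropical_cover L C) (G : multigraph V E).
Hypothesis CG : same_graph (curve_graph C) G.

Definition orient_slope e : int :=
  if same_dir C G e then cover_slope f e else - cover_slope f e.

Lemma weight_orient e : weight f e = `|orient_slope e|%N.
Proof. by rewrite /weight /orient_slope; case: ifP; rewrite ?abszN. Qed.

(** The affine expression of the cover on an edge may start at any lift [A] of
    the image of its first end. *)
Lemma cover_orient_param e (A : R) : circle_proj L A = cover_map f (inl (G e).1) ->
  forall t, 0 <= t <= curve_len C e ->
  cover_map f (orient_param C G e t) = circle_proj L (A + (orient_slope e)%:~R * t).
Proof.
move=> hA t ht; have [b hb] := cover_affine f e.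
have l0 := curve_len_gt0 C e.
have hb' u : 0 <= u <= curve_len C e -> cover_map f (orient_param C G e u) =
   circle_proj L (b + (cover_slope f e)%:~R * flip C G e u).
  by move=> hu; rewrite /orient_param hb// in_itv/=; exact: flip_itv.
have h00 : (0 : R) <= 0 <= curve_len C e by rewrite lexx ltW.
have := hb' 0 h00; rewrite orient_param0// -hA hb'// => /circle_projP[n hn].
apply/circle_projP; exists (- n); rewrite hn /orient_slope /flip rmorphN/=.
by case: same_dir; rewrite ?rmorphN/=; ring.
Qed.

Lemma divergence_orient v :
  divergence (curve_graph C) (cover_slope f) v = divergence G orient_slope v.
Proof.
apply: eq_bigr => e _; rewrite /orient_slope; case: ifPn => [/eqP -> //|/(not_same_dir CG) ->/=].
by ring.
Qed.

(** Each half-edge contributes its signed outgoing slope to the divergence, and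
    the positive and negative contributions are the two sides of the balancing
    condition. *)
Lemma balanced_divergence (H : multigraph V E) (s : E -> int) :
  balanced H s <-> forall v, divergence H s v = 0.
Proof.
have key v : divergence H s v =
    (\sum_(h | (half_base H h == v) && (0 < out_slope s h)%R) `|out_slope s h|)%N%:Z -
    (\sum_(h | (half_base H h == v) && (out_slope s h < 0)%R) `|out_slope s h|)%N%:Z.
  rewrite divergence_half_edges (bigID (fun h => 0 < out_slope s h)) /=; congr (_ + _).
    rewrite -[RHS]natz natr_sum; apply: eq_bigr => h /andP[_ h0].
    by rewrite natz; lia.
  rewrite -[X in - X]natz natr_sum -sumrN.
  rewrite [LHS](bigID (fun h => out_slope s h == 0))/= big1 ?add0r => [|h /andP[_ /eqP]//].
  apply: eq_big => [h|h /andP[/andP[_ h1] h2]]; last by rewrite natz; lia.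
  by rewrite -andbA; congr (_ && _); lia.
split=> bal v; have := bal v; first by rewrite key => ->; rewrite subrr.
by rewrite key => /eqP; rewrite subr_eq0 => /eqP[].
Qed.

Lemma orient_divergence0 v : divergence G orient_slope v = 0.
Proof. by rewrite -divergence_orient; exact: (balanced_divergence _ _).1 (cover_balanced f) v. Qed.

(** The edge lifts to the segment from [A] to [A + slope * length], and its
    points over [P] are those where the segment meets the progression
    [P + n L]. *)
Lemma fiber_card e (A : R) (P : circle L) : orient_slope e != 0 ->
  circle_proj L A = cover_map f (inl (G e).1) ->
  ~ branch_points f P ->
  edge_fiber_card f P e = `|Num.floor ((A + (orient_slope e)%:~R * curve_len C e - val P) / L%:num)
                           - Num.floor ((A - val P) / L%:num)|%N.
Proof.
move=> s0 hA nb; set s := orient_slope e; set l := curve_len C e.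
have l0 : 0 < l := curve_len_gt0 C e.
have cov := cover_orient_param hA.
have nA v (B : R) : circle_proj L B = cover_map f (inl v) -> forall n : int, B <> val P + n%:~R * L%:num.
  move=> hB n e'; apply: nb; exists v => //; rewrite -hB e' circle_projDint; exact: circle_proj_val.
have hl : 0 <= l <= l by rewrite lexx ltW.
have hB : circle_proj L (A + s%:~R * l) = cover_map f (inl (G e).2).
  by rewrite -cov// orient_param_len.
have FE : cover_map f @^-1` [set P] `&` on_edge C e =
   [set orient_param C G e t | t in [set t | 0 <= t <= l /\ circle_proj L (A + s%:~R * t) = circle_proj L (val P)]].
  apply/seteqP; split=> [x [/= fx /(on_edgeP G _ _)[t ht xt]]|_ [t [ht ft] <-]].
    exists t => //; split=> //; rewrite circle_proj_val -fx xt; symmetry; exact: cov.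
  split; first by rewrite /= cov// ft circle_proj_val.
  by apply/(on_edgeP G _ _); exists t.
rewrite /edge_fiber_card FE.
have gI t t' : 0 < t < l -> 0 < t' < l -> orient_param C G e t = orient_param C G e t' -> t = t'.
  by move=> h _ /(orient_param_inj h)[].
have [sp|sn|s1] := ltgtP 0 s; last by move: s0; rewrite -/s -s1 eqxx.
  have sp' : 0 < s%:~R :> R by rewrite ltr0z.
  have <- := card_affine_fiber l0 sp' gI (nA _ _ hA) (nA _ _ hB) erefl.
  by rewrite absz_nat.
have sp' : 0 < - s%:~R :> R by rewrite oppr_gt0 ltrz0.
(* A negative slope becomes positive when the edge is run through backwards. *)
pose gam t := orient_param C G e (l - t).
have gI' t t' : 0 < t < l -> 0 < t' < l -> gam t = gam t' -> t = t'.
  move=> /andP[? ?] /andP[? ?] /gI; rewrite !subr_gt0 !gtrBl => h.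
  have : l - t = l - t' by apply: h; apply/andP; split; lra.
  lra.
have hA' : A + s%:~R * l + - s%:~R * l = A by ring.
have nA' := nA _ _ hA; rewrite -{1}hA' in nA'.
have := card_affine_fiber l0 sp' gI' (nA _ _ hB) nA' erefl.
rewrite hA'; set F1 := [set orient_param _ _ _ _ | _ in _]; set F2 := [set gam _ | _ in _].
have -> : F2 = F1.
  apply/seteqP; split=> [_ [t [/andP[t0 tl] ft] <-]|_ [t [/andP[t0 tl] ft] <-]].
    exists (l - t) => //; split; first by apply/andP; split; lra.
    by rewrite -ft; congr circle_proj; ring.
  exists (l - t); last by rewrite /gam; congr orient_param; ring.
  split; first by apply/andP; split; lra.
  by rewrite -ft; congr circle_proj; ring.
by move=> h; rewrite -[LHS]absz_nat h -abszN opprB.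
Qed.
End Covers.
End Curves.

(** * Isomorphisms of labeled covers *)

Section Isos.
Local Open Scope ring_scope.
Variables (R : realType) (L : {posnum R}) (g : nat).
Implicit Types (X Y Z : labeled_cover L g).

Notation len X := (curve_len (source X)).
Notation map X := (cover_map (underlying_cover X)).
Notation slope X := (cover_slope (underlying_cover X)).
Notation par X := (edge_param (source X)).

(** Isomorphisms of labeled covers, the label of the image edge being explicit. *)
Definition edgewise_iso X Y (f : curve_point (source X) -> curve_point (source Y)) :=
  [/\ bijective f, forall x, map Y (f x) = map X x, forall v, f (inl v) = inl v
    & forall e, len Y e = len X e /\
      ((forall t, 0 <= t <= len X e -> f (par X e t) = par Y e t) \/
       (forall t, 0 <= t <= len X e -> f (par X e t) = par Y e (len X e - t)))].

(** An isometry carries an edge isometrically onto some edge; preservation of the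
    labels identifies this edge by means of its midpoint. *)
Lemma cover_isoP X Y : cover_iso X Y <-> exists f, @edgewise_iso X Y f.
Proof.
split=> [[f [[fb fe] fm fv fon]]|[f [fb fm fv fe]]]; exists f.
  split=> // e; have [e' [le fe']] := fe e.
  suff ee : e' = e.
    rewrite ee in le fe'; split; first exact: le.
    by case: fe' => h; [left=> t ht|right=> t ht]; apply: h; rewrite in_itv.
  have l0 := curve_len_gt0 (source X) e.
  have hm : 0 <= len X e / 2 <= len X e by apply/andP; split; lra.
  have hin : 0 < len X e / 2 < len Y e' by rewrite le; apply/andP; split; lra.
  have hx : f (par X e (len X e / 2)) = par Y e' (len X e / 2).
    case: fe' => h; rewrite h ?in_itv//; congr edge_param; lra.
  have [|t _ ht] := fon e (par X e (len X e / 2)); first by exists (len X e / 2); rewrite //= in_itv.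
  by rewrite hx in ht; have [] := edge_param_inner_inj hin (esym ht).
split=> //.
  split=> // e; have [le fe'] := fe e; exists e; split=> //.
move=> e x [t]; rewrite /= in_itv/= => ht <-; have [le [h|h]] := fe e; rewrite h//.
  by exists t => //=; rewrite in_itv/= le.
by exists (len X e - t) => //=; rewrite in_itv/= le; move/andP: ht => [? ?]; apply/andP; split; lra.
Qed.

Lemma cover_iso_refl X : cover_iso X X.
Proof.
apply/cover_isoP; exists id; split=> //; first by exists id.
by move=> e; split=> //; left.
Qed.

Lemma cover_iso_sym X Y : cover_iso X Y -> cover_iso Y X.
Proof.
move=> /cover_isoP[f [[h fh hf] fm fv fe]]; apply/cover_isoP; exists h; split.
- by exists f.
- by move=> x; rewrite -fm hf.
- by move=> v; rewrite -(fv v) fh.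
- move=> e; have [le [fe'|fe']] := fe e; split=> //; [left=> t ht|right=> t ht].
    by rewrite -fe' ?fh// -le.
  rewrite le in ht *; rewrite -(fh (par X e (len X e - t))) fe'.
    by congr (h (edge_param _ _ _)); ring.
  by move/andP: ht => [? ?]; apply/andP; split; lra.
Qed.

Lemma cover_iso_trans X Y Z : cover_iso X Y -> cover_iso Y Z -> cover_iso X Z.
Proof.
move=> /cover_isoP[f [fb fm fv fe]] /cover_isoP[h [hb hm hv he]].
apply/cover_isoP; exists (h \o f); split.
- exact: bij_comp.
- by move=> x; rewrite /= hm fm.
- by move=> v; rewrite /= fv hv.
- move=> e; have [le fe'] := fe e; have [le' he'] := he e; split; first by rewrite le'.
  have rev t : 0 <= t <= len X e -> 0 <= len X e - t <= len X e.
    by move=> /andP[? ?]; apply/andP; split; lra.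
  rewrite le in he'; case: fe' => fe'; case: he' => he'.
  + by left=> t ht; rewrite /= fe'// he'.
  + by right=> t ht; rewrite /= fe'// he'.
  + by right=> t ht; rewrite /= fe'// he'//; exact: rev.
  + left=> t ht; rewrite /= fe'// he'; last exact: rev.
    by congr edge_param; ring.
Qed.

Lemma iso_class_eq X Y : cover_iso X Y -> iso_class X = iso_class Y.
Proof.
move=> XY; apply/seteqP; split=> Z; first exact: cover_iso_trans (cover_iso_sym XY).
exact: cover_iso_trans XY.
Qed.

Lemma iso_class_inj X Y : iso_class X = iso_class Y -> cover_iso X Y.
Proof. by move=> e; have : iso_class Y Y := cover_iso_refl Y; rewrite -e; apply. Qed.

(** The slopes agree if the isomorphism respects the stored direction of the edge
    and are opposite if it reverses it. *)
Lemma cover_iso_weight X Y : cover_iso X Y ->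
  forall e, weight (underlying_cover X) e = weight (underlying_cover Y) e.
Proof.
move=> /cover_isoP[f [fb fm fv fe]] e; have [le fe'] := fe e.
have l0 := curve_len_gt0 (source X) e.
have [b hb] := cover_affine (underlying_cover X) e.
have [b' hb'] := cover_affine (underlying_cover Y) e.
rewrite /weight; case: fe' => h.
  suff : (slope X e)%:~R = (slope Y e)%:~R :> R by move=> /eqP; rewrite eqr_int => /eqP ->.
  apply: (affine_slope_unique (L := L) (A := b) (A' := b') l0) => t ht.
  by rewrite -hb ?in_itv// -hb' ?in_itv/= ?le// -h// fm.
suff : (slope X e)%:~R = - (slope Y e)%:~R :> R.
  by rewrite -rmorphN => /eqP; rewrite eqr_int => /eqP ->; rewrite abszN.
apply: (affine_slope_unique (L := L) (A := b) (A' := b' + (slope Y e)%:~R * len X e) l0) => t ht.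
rewrite -hb ?in_itv// -fm h// hb' ?in_itv/= ?le; first by congr circle_proj; ring.
by move/andP: ht => [? ?]; apply/andP; split; lra.
Qed.

Lemma class_mult_iso_class X : class_mult (iso_class X) = cover_mult X.
Proof.
rewrite /class_mult.
have -> : [set cover_mult Y | Y in iso_class X] = [set cover_mult X].
  apply/seteqP; split=> [_ [Y /cover_iso_weight XY <-]|_ ->]; last by exists X => //; exact: cover_iso_refl.
  by apply: eq_bigr => e _; rewrite -XY.
by case: xgetP => [m _ -> //|/(_ (cover_mult X))/=]; exact.
Qed.

Lemma cover_iso_graph X Y : cover_iso X Y ->
  same_graph (curve_graph (source X)) (curve_graph (source Y)).
Proof.
move=> /cover_isoP[f [fb fm fv fe]] e; have [le fe'] := fe e.
have l0 := curve_len_gt0 (source X) e.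
have h0 : (0 : R) <= 0 <= len X e by rewrite lexx ltW.
have hl : 0 <= len X e <= len X e by rewrite lexx ltW.
rewrite /same_ends; case: fe' => h.
  have := h _ h0; rewrite !edge_param0 fv => -[e1].
  have := h _ hl; rewrite -{2}le !edge_param_len fv => -[e2].
  by rewrite [curve_graph _ _]surjective_pairing e1 e2 -surjective_pairing eqxx.
have := h _ h0; rewrite subr0 edge_param0 -le edge_param_len fv => -[e1].
have := h _ hl; rewrite subrr edge_param0 edge_param_len fv => -[e2].
by rewrite [X in X == _]surjective_pairing [X in _ || (X == _)]surjective_pairing e1 e2 eqxx orbT.
Qed.

End Isos.

(** * Flows, positions and windings of a cover *)

Section Realize.
Local Open Scope ring_scope.
Variables (R : realType) (L : {posnum R}) (g : nat).
Variables (p0 : circle L) (p : vert g -> circle L).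
Hypothesis p_inj : injective p.
Hypothesis p0_p : forall i, p i <> p0.
Implicit Types (X Y : labeled_cover L g) (G : feynman_graph g) (sigma : {perm vert g}).

Notation len X := (curve_len (source X)).
Notation map X := (cover_map (underlying_cover X)).

(** The position of the image of [v] when the vertex [v] lies over the branch point
    of index [sigma v]. *)
Definition vertex_pos sigma v := circle_pos p0 (p (sigma v)).

Definition pos_up (G : multigraph (vert g) (edge g)) sigma (e : edge g) : bool :=
  vertex_pos sigma (G e).1 < vertex_pos sigma (G e).2.

Lemma vertex_pos_itv sigma v : 0 < vertex_pos sigma v < L%:num.
Proof.
have /andP[_ h] := circle_pos_itv p0 (p (sigma v)).
by rewrite /vertex_pos h andbT; apply: circle_pos_gt0; exact: p0_p.
Qed.

Lemma vertex_pos_inj sigma : injective (vertex_pos sigma).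
Proof. by move=> u v /circle_pos_inj/p_inj/perm_inj. Qed.

Lemma vertex_posK sigma v : circle_proj L (val p0 + vertex_pos sigma v) = p (sigma v).
Proof. exact: circle_posK. Qed.

(** The combinatorial data of a labeled cover: its type, the distribution of the
    vertices over the branch points, and the slopes of the edges directed as in
    [G]. *)
Record realizes X G sigma (s : edge g -> int) : Prop := Realizes {
  realizes_type : has_type X G;
  realizes_vertex : forall v, map X (inl v) = p (sigma v);
  realizes_slope : forall e, orient_slope (underlying_cover X) (val G) e = s e
}.

Section OneCover.
Variables (X : labeled_cover L g) (G : feynman_graph g) (sigma : {perm vert g}) (s : edge g -> int).
Hypothesis XG : realizes X G sigma s.

Let src e := (val G e).1.
Let tgt e := (val G e).2.
Let q := vertex_pos sigma.

Lemma realizes_start e : circle_proj L (val p0 + q (src e)) = map X (inl (val G e).1).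
Proof. by rewrite (realizes_vertex XG) vertex_posK. Qed.

Lemma realizes_branch_points : branch_points (underlying_cover X) = range p.
Proof.
apply/seteqP; split=> [_ [v _ <-]|_ [i _ <-]].
  by exists (sigma v); rewrite // (realizes_vertex XG).
by exists ((sigma^-1)%g i); rewrite // (realizes_vertex XG) permKV.
Qed.

Lemma p0_not_branch : ~ branch_points (underlying_cover X) p0.
Proof. by rewrite realizes_branch_points => -[i _]; exact: p0_p. Qed.

Lemma realizes_weight e : weight (underlying_cover X) e = `|s e|%N.
Proof. by rewrite (weight_orient _ (val G)) (realizes_slope XG). Qed.

Lemma realizes_balanced v : divergence (val G) s v = 0.
Proof.
rewrite -(orient_divergence0 (underlying_cover X) (realizes_type XG) v).
by apply: eq_bigr => e _; rewrite (realizes_slope XG).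
Qed.

(** An edge lifts to a path between the positions of its ends, up to the number
    [n] of windings around the circle. *)
Lemma realizes_lift e : exists n : int,
  (s e)%:~R * len X e = q (tgt e) - q (src e) + n%:~R * L%:num.
Proof.
have l0 := curve_len_gt0 (source X) e.
have hl : 0 <= len X e <= len X e by rewrite lexx ltW.
have := cover_orient_param (realizes_type XG) (realizes_start e) hl.
rewrite (orient_param_len (realizes_type XG)) (realizes_slope XG) (realizes_vertex XG).
by rewrite -vertex_posK => /esym/circle_projP[n hn]; exists n; rewrite -/q in hn *; lra.
Qed.

Section Winding.
Variable n : edge g -> int.
Hypothesis s0 : forall e, s e != 0.
Hypothesis lift : forall e, (s e)%:~R * len X e = q (tgt e) - q (src e) + (n e)%:~R * L%:num.

(** The weighted fibre over [P], divided by the slope, differs from the winding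
    number by the change of the integer potential [phi], which records on which
    side of [P] a vertex lies. *)
Lemma realizes_fiber_weight e (P : circle L) : ~ branch_points (underlying_cover X) P ->
  let phi v := Num.floor ((val p0 + q v - val P) / L%:num) in
  (edge_fiber_card (underlying_cover X) P e * weight (underlying_cover X) e)%N%:Z =
  s e * (n e + phi (tgt e) - phi (src e)).
Proof.
move=> nb phi.
have se : orient_slope (underlying_cover X) (val G) e != 0 by rewrite (realizes_slope XG).
rewrite (fiber_card (realizes_type XG) se (realizes_start e) nb) (realizes_slope XG) lift realizes_weight.
set fa := Num.floor ((_ + q (src e) - _) / _); set fb := Num.floor _.
have -> : n e + phi (tgt e) - phi (src e) = fb - fa.
  rewrite /fb /fa /phi; congr (_ - _).
  have -> : (val p0 + q (src e) + (q (tgt e) - q (src e) + (n e)%:~R * L%:num) - val P) / L%:num =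
    (n e)%:~R + (val p0 + q (tgt e) - val P) / L%:num by field; rewrite gt_eqF.
  by rewrite floorDzr ?intr_int ?intrKfloor.
have l0 := curve_len_gt0 (source X) e.
have mono : (0 < s e -> fa <= fb) /\ (s e < 0 -> fb <= fa).
  split=> sp; apply: le_floor; rewrite ler_pM2r ?invr_gt0// -lift.
    have : 0 <= (s e)%:~R * len X e by rewrite mulr_ge0// ?ler0z ltW.
    lra.
  have : (s e)%:~R * len X e <= 0 by rewrite mulr_le0_ge0// ?lerz0 ltW.
  lra.
case: (ltgtP (s e) 0) (s0 e) => // sp _.
  by have := mono.2 sp; rewrite PoszM; nia.
by have := mono.1 sp; rewrite PoszM; nia.
Qed.

(** The potentials of [realizes_fiber_weight] cancel in the sum, as the flow is
    balanced; so the degree does not depend on the point [P]. *)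
Lemma realizes_degree (P : circle L) : ~ branch_points (underlying_cover X) P ->
  (\sum_e edge_fiber_card (underlying_cover X) P e * weight (underlying_cover X) e)%N%:Z =
  \sum_e s e * n e.
Proof.
move=> nb; rewrite -[LHS]natz natr_sum.
pose phi v := Num.floor ((val p0 + q v - val P) / L%:num).
rewrite (eq_bigr (fun e => s e * n e - s e * (phi (src e) - phi (tgt e)))); last first.
  by move=> e _; rewrite natz realizes_fiber_weight//; ring.
rewrite sumrB; have h := sum_divergence (val G) s phi.
rewrite big1 in h => [|v _]; last by rewrite realizes_balanced mul0r.
rewrite (_ : \sum_e s e * (phi (src e) - phi (tgt e)) = 0) ?subr0//.
by rewrite [RHS]h; apply: eq_bigr => e _; rewrite intz.
Qed.

(** All the positions are counted from [p0], so the potentials vanish for [P = p0]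
    and the fibre over [p0] measures the winding of each edge. *)
Lemma realizes_fiber_p0 e :
  (edge_fiber_card (underlying_cover X) p0 e * weight (underlying_cover X) e)%N%:Z = s e * n e.
Proof.
rewrite realizes_fiber_weight; last exact: p0_not_branch.
have h v : Num.floor ((val p0 + q v - val p0) / L%:num) = 0.
  have /andP[? ?] := vertex_pos_itv sigma v.
  have -> : val p0 + q v - val p0 = q v by ring.
  by apply/eqP; rewrite floor_eq ler_pdivlMr// mul0r ltW//= ltr_pdivrMr// mul1r.
by rewrite !h addr0 subr0.
Qed.
End Winding.

(** The prescribed fibre over [p0] makes [a e] the product of the slope and the
    winding number; when it vanishes, the sign of the slope is dictated by the
    positions of the ends, because the length of the edge is positive. *)
Lemma realizes_valid (a : exponent g) : (forall e, s e != 0) ->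
  (forall e, (edge_fiber_card (underlying_cover X) p0 e * weight (underlying_cover X) e)%N = a e) ->
  forall e, edge_ok (pos_up (val G) sigma e) (s e, a e).
Proof.
move=> s0 ha e; have [n hn] := choice realizes_lift.
have := realizes_fiber_p0 s0 hn e; rewrite ha => an.
rewrite /edge_ok /= s0 /=; apply/andP; split.
  have -> : a e = (`|s e| * `|n e|)%N by rewrite -abszM -an absz_nat.
  by rewrite dvdn_mulr.
apply/implyP => /eqP a0; move: an; rewrite a0 => /esym/eqP; rewrite mulf_eq0 (negPf (s0 e))/= => /eqP n0.
have := hn e; rewrite n0 mul0r addr0 => sl.
have l0 := curve_len_gt0 (source X) e.
rewrite /pos_up -/(src e) -/(tgt e) -/q -(subr_gt0 (q (src e))) -sl pmulr_lgt0// ltr0z.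
exact: eqxx.
Qed.

End OneCover.

Section Transfer.
Variables (V E : finType) (C D : tropical_curve R V E) (H : multigraph V E).
Hypothesis CH : same_graph (curve_graph C) H.
Hypothesis DH : same_graph (curve_graph D) H.
Hypothesis lenE : forall e, curve_len D e = curve_len C e.

(** The map between two metric graphs of the same type that preserves vertices and
    the parameters of the edges. *)
Definition transfer (x : curve_point C) : curve_point D :=
  match x with
  | inl v => inl v
  | inr z => orient_param D H (val z).1 (flip C H (val z).1 (val z).2)
  end.

Lemma transfer_orient e t : 0 <= t <= curve_len C e ->
  transfer (orient_param C H e t) = orient_param D H e t.
Proof.
move=> /andP[t0 tl]; have [->|tn0] := eqVneq t 0; first by rewrite !orient_param0.
have [->|tnl] := eqVneq t (curve_len C e); first by rewrite (orient_param_len CH) -lenE (orient_param_len DH).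
have h : 0 < t < curve_len C e by rewrite !lt_def t0 tl tn0 eq_sym tnl.
by rewrite [in LHS]/orient_param (edge_param_inner (flip_itvo H h))/= flip_flip.
Qed.
End Transfer.

Lemma transferK (V E : finType) (C D : tropical_curve R V E) (H : multigraph V E) :
  same_graph (curve_graph C) H -> same_graph (curve_graph D) H ->
  (forall e, curve_len D e = curve_len C e) -> cancel (@transfer V E C D H) (@transfer V E D C H).
Proof.
move=> CH DH lenE x; have [[v ->//]|[e [t h ->]]] := orient_pointP H x.
have h' : 0 <= t <= curve_len C e by case/andP: h => ? ?; rewrite !ltW.
by rewrite transfer_orient// transfer_orient// lenE.
Qed.

(** The slopes, the images of the vertices and the fibre over [p0] determine the
    lengths of the edges, hence the cover. *)
Lemma realizes_unique X Y G sigma s (a : exponent g) :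
  (forall e, s e != 0) -> realizes X G sigma s -> realizes Y G sigma s ->
  (forall e, (edge_fiber_card (underlying_cover X) p0 e * weight (underlying_cover X) e)%N = a e) ->
  (forall e, (edge_fiber_card (underlying_cover Y) p0 e * weight (underlying_cover Y) e)%N = a e) ->
  cover_iso X Y.
Proof.
move=> s0 XG YG aX aY.
have [n hn] := choice (realizes_lift XG); have [m hm] := choice (realizes_lift YG).
have nm e : n e = m e.
  have := realizes_fiber_p0 XG s0 hn e; have := realizes_fiber_p0 YG s0 hm e.
  by rewrite aX aY => -> /(mulfI (s0 e)).
have lenE e : len Y e = len X e.
  have s0' : (s e)%:~R != 0 :> R by rewrite intr_eq0.
  by apply: (mulfI s0'); rewrite hn hm nm.
have [XT YT] := (realizes_type XG, realizes_type YG).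
pose f := @transfer _ _ (source X) (source Y) (val G).
have fE := transfer_orient XT YT lenE.
apply/cover_isoP; exists f; split.
- by exists (@transfer _ _ (source Y) (source X) (val G)); exact: transferK.
- move=> x; have [[v ->]|[e [t h ->]]] := orient_pointP (val G) x.
    by rewrite /f/= (realizes_vertex XG) (realizes_vertex YG).
  have h' : 0 <= t <= len X e by case/andP: h => ? ?; rewrite !ltW.
  rewrite /f fE// (cover_orient_param XT (realizes_start XG e) h').
  rewrite (cover_orient_param YT (realizes_start YG e)) ?lenE//.
  by rewrite (realizes_slope XG) (realizes_slope YG).
- by [].
- move=> e; split=> //.
  have key t : 0 <= t <= len X e -> f (edge_param (source X) e t) =
      edge_param (source Y) e (flip (source Y) (val G) e (flip (source X) (val G) e t)).
    by move=> h; rewrite (edge_param_orient _ (val G)) /f fE//; exact: flip_itv.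
  rewrite /flip in key; case: (same_dir (source X) (val G) e) key => key;
    case: (same_dir (source Y) (val G) e) key => key.
  + by left=> t /key.
  + by right=> t /key ->; rewrite lenE.
  + by right=> t /key.
  + by left=> t /key ->; rewrite lenE; congr edge_param; ring.
Qed.

(** An isomorphism preserves the vertices and the map to the circle, and it cannot
    reverse an edge, whose ends are distinct by [balanced_no_loop]. *)
Lemma realizes_iso_inj X Y G G' sigma sigma' (s s' : edge g -> int) :
  realizes X G sigma s -> realizes Y G' sigma' s' -> (forall e, s e != 0) ->
  (same_graph (val G) (val G') -> G = G') -> cover_iso X Y ->
  [/\ G = G', sigma = sigma' & s =1 s'].
Proof.
move=> XG YG s0 GG iso.
have XT := realizes_type XG.
have eG : G = G'.
  apply: GG => e; apply: same_ends_trans (same_ends_sym (XT e)) _.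
  exact: same_ends_trans (cover_iso_graph iso e) (realizes_type YG e).
subst G'; split=> //.
  apply/permP => v; apply: p_inj; rewrite -(realizes_vertex XG) -(realizes_vertex YG).
  by have /cover_isoP[f [_ fm fv _]] := iso; rewrite -fm fv.
have YT := realizes_type YG.
have no_loop e : (val G e).1 != (val G e).2.
  have /and3P[tri _ _] := valP G.
  have := balanced_no_loop tri s0 (realizes_balanced XG).
  by apply: contraFneq => h; apply/fintype.existsP; exists e; apply/eqP.
move=> e; have /cover_isoP[f [fb fm fv fe]] := iso; have [le fe'] := fe e.
have l0 := curve_len_gt0 (source X) e.
have h0 : (0 : R) <= 0 <= len X e by rewrite lexx ltW.
(* The stored directions and the effect of f combine into one of two cases. *)
have key : (forall t, 0 <= t <= len X e -> f (orient_param (source X) (val G) e t) = orient_param (source Y) (val G) e t) \/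
   (forall t, 0 <= t <= len X e -> f (orient_param (source X) (val G) e t) = orient_param (source Y) (val G) e (len X e - t)).
  have hfl t : 0 <= t <= len X e -> 0 <= flip (source X) (val G) e t <= len X e by exact: flip_itv.
  rewrite /orient_param; case: fe' => h.
    rewrite /flip in hfl *; case: (same_dir (source X) _ e) hfl => hfl; case: (same_dir (source Y) _ e).
    + by left=> t /h.
    + by right=> t /h ->; rewrite le; congr edge_param; ring.
    + by right=> t /hfl/h ->.
    + by left=> t /hfl/h ->; rewrite le.
  rewrite /flip in hfl *; case: (same_dir (source X) _ e) hfl => hfl; case: (same_dir (source Y) _ e).
  + by right=> t /h.
  + by left=> t /h ->; rewrite le.
  + by left=> t /hfl/h ->; congr edge_param; ring.
  + by right=> t /hfl/h ->; rewrite le; congr edge_param; ring.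
case: key => [key|/(_ 0 h0)]; last first.
  rewrite subr0 -le (orient_param0 XT) (orient_param_len YT) fv => -[/eqP].
  by rewrite (negPf (no_loop e)).
suff : (s e)%:~R = (s' e)%:~R :> R by move=> /eqP; rewrite eqr_int => /eqP.
apply: (@affine_slope_unique _ L (val p0 + vertex_pos sigma (val G e).1) _
  (val p0 + vertex_pos sigma' (val G e).1) _ _ l0) => t ht.
have hX := cover_orient_param XT (realizes_start XG e) ht.
have ht' : 0 <= t <= len Y e by rewrite le.
have hY := cover_orient_param YT (realizes_start YG e) ht'.
rewrite (realizes_slope XG) in hX; rewrite (realizes_slope YG) in hY.
by rewrite -hX -hY -key// fm.
Qed.
End Realize.

(** * The cover realizing a flow *)

Section Construct.
Local Open Scope ring_scope.
Variables (R : realType) (L : {posnum R}) (g : nat).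
Variables (p0 : circle L) (p : vert g -> circle L).
Hypothesis g_gt1 : (1 < g)%N.
Hypothesis p_inj : injective p.
Hypothesis p0_p : forall i, p i <> p0.

Lemma circle_dist_ge0 (x y : circle L) : 0 <= circle_dist x y.
Proof.
rewrite /circle_dist le_min normr_ge0 subr_ge0 ler_norml.
by have /andP[? ?] := valP x; have /andP[? ?] := valP y; apply/andP; split; lra.
Qed.

Variables (G : feynman_graph g) (sigma : {perm vert g}) (s : edge g -> int) (a : exponent g).
Hypothesis bal : forall v, divergence (val G) s v = 0.
Hypothesis ok : forall e, edge_ok (pos_up p0 p (val G) sigma e) (s e, a e).

Let src e := (val G e).1.
Let tgt e := (val G e).2.
Let q := vertex_pos p0 p sigma.

Lemma slope_neq0 e : s e != 0.
Proof. by have /and3P[] := ok e. Qed.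

Definition winding e : int :=
  if 0 < s e then (a e %/ `|s e|)%N%:Z else - (a e %/ `|s e|)%N%:Z.

Lemma slope_winding e : s e * winding e = (a e)%:Z.
Proof.
have /and3P[_ /= dv _] := ok e; rewrite -[in RHS](divnK dv) /winding PoszM.
by case: ltP => h; nia.
Qed.

(** The length of an edge is forced by its slope, the positions of its ends and its
    winding number. *)
Definition new_len e : R := (q (tgt e) - q (src e) + (winding e)%:~R * L%:num) / (s e)%:~R.

(** A nonzero winding in the direction of the slope outweighs the difference of
    two positions, which is less than [L]; without winding, [edge_ok] gives the
    slope the sign of the difference of the positions of the ends. *)
Lemma new_len_gt0 e : 0 < new_len e.
Proof.
have s0 := slope_neq0 e; have /and3P[_ /= dv /implyP up] := ok e.
have no_loop : q (src e) != q (tgt e).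
  have /and3P[tri _ _] := valP G.
  have h := balanced_no_loop tri slope_neq0 bal.
  apply: contraFneq h => /(vertex_pos_inj p_inj) h; apply/fintype.existsP; exists e; exact/eqP.
have /andP[qs0 qsL] : 0 < q (src e) < L%:num := vertex_pos_itv p0_p sigma (src e).
have /andP[qt0 qtL] : 0 < q (tgt e) < L%:num := vertex_pos_itv p0_p sigma (tgt e).
have Lp : 0 < L%:num :> R by [].
have a0 : winding e = 0 -> (0 < s e) = (q (src e) < q (tgt e)).
  move=> w0; apply/eqP; apply: up; have := slope_winding e; rewrite w0 mulr0 => /esym/eqP.
  by rewrite eqz_nat.
have sw := slope_winding e; rewrite /new_len.
have hw (m : int) : 1 <= m -> L%:num <= m%:~R * L%:num by move=> m1; rewrite ler_peMl// -[1]/(1%:~R) ler_int.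
have hw' (m : int) : m <= -1 -> m%:~R * L%:num <= - L%:num.
  by move=> m1; rewrite -mulN1r ler_pM2r// -[-1]/((-1)%:~R) ler_int.
rewrite -/q in no_loop a0 *; have [sp|sn|/eqP] := ltgtP 0 (s e); last by rewrite eq_sym (negPf s0).
  rewrite divr_gt0// ?ltr0z//.
  have [w0|w0] := eqVneq (winding e) 0; first by rewrite w0 mul0r addr0 subr_gt0 -a0.
  have /hw : 1 <= winding e by nia.
  lra.
rewrite ltr_ndivlMr ?ltrz0// mul0r.
have [w0|w0] := eqVneq (winding e) 0.
  rewrite w0 mul0r addr0 subr_lt0 lt_neqAle eq_sym no_loop/= leNgt -a0//.
  by rewrite ltNge ltW.
have /hw' : winding e <= -1 by nia.
lra.
Qed.

Definition new_curve : tropical_curve R (vert g) (edge g) :=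
  @TropicalCurve R _ _ (val G) new_len (proj1 (andP (valP G)))
    (proj1 (andP (proj2 (andP (valP G))))) new_len_gt0.

Definition new_map (x : curve_point new_curve) : circle L :=
  match x with
  | inl v => p (sigma v)
  | inr z => circle_proj L (val p0 + q (src (val z).1) + (s (val z).1)%:~R * (val z).2)
  end.

Lemma new_map_edge e t : 0 <= t <= new_len e ->
  new_map (edge_param new_curve e t) = circle_proj L (val p0 + q (src e) + (s e)%:~R * t).
Proof.
move=> /andP[t0 tl]; have [->|tn0] := eqVneq t 0.
  by rewrite edge_param0/= mulr0 addr0 vertex_posK.
have [->|tnl] := eqVneq t (new_len e).
  rewrite (edge_param_len new_curve)/= -(vertex_posK p0) -/q -/(tgt e).
  have s0 : (s e)%:~R != 0 :> R by rewrite intr_eq0 slope_neq0.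
  rewrite mulrC divfK//; apply/circle_projP; exists (- winding e).
  by rewrite rmorphN/=; ring.
have h : 0 < t < curve_len new_curve e by rewrite /= !lt_def t0 tl tn0 eq_sym tnl.
by rewrite (edge_param_inner h).
Qed.

Lemma new_continuous e t0 : t0 \in `[0, curve_len new_curve e] ->
  circle_dist (new_map (edge_param new_curve e t0)) (new_map (edge_param new_curve e t))
    @[t --> within `[0, curve_len new_curve e] (nbhs t0)] --> (0 : R).
Proof.
rewrite in_itv/= => ht0; apply/cvgrPdist_lt => eps eps0; rewrite near_withinE.
have k0 : 0 < `|(s e)%:~R : R| + 1 by rewrite ltr_wpDl.
near=> t; rewrite /= in_itv/= => ht.
rewrite sub0r normrN ger0_norm ?circle_dist_ge0// !new_map_edge//.
apply: le_lt_trans (circle_dist_le _ _ _) _.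
have -> : val p0 + q (src e) + (s e)%:~R * t0 - (val p0 + q (src e) + (s e)%:~R * t) = (s e)%:~R * (t0 - t) by ring.
rewrite normrM; have : `|t0 - t| < eps / (`|(s e)%:~R| + 1).
  near: t; apply: (@cvgr_dist_lt _ _ _ (nbhs t0) _ id t0) => //; exact: divr_gt0.
rewrite ltr_pdivlMr// mulrDr mulr1 mulrC => h; apply: le_lt_trans h.
by rewrite lerDl.
Unshelve. all: by end_near.
Qed.

Lemma new_nonconstant : exists x y, new_map x <> new_map y.
Proof.
have h : (1 < 2 * g - 2)%N by lia.
exists (inl (Ordinal (ltnW h))), (inl (Ordinal h)) => /= /p_inj/perm_inj.
by move=> /(congr1 val).
Qed.

Lemma new_affine e : exists b : R, forall t, t \in `[0, curve_len new_curve e] ->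
  new_map (edge_param new_curve e t) = circle_proj L (b + (s e)%:~R * t).
Proof. by exists (val p0 + q (src e)) => t; rewrite in_itv/=; exact: new_map_edge. Qed.

Definition new_cover : labeled_cover L g :=
  LabeledCover (TropicalCover new_continuous new_nonconstant new_affine
    ((balanced_divergence _ _).2 bal)).

Lemma realizes_new_cover : realizes p new_cover G sigma s.
Proof.
split=> // [e|e]; first exact: same_ends_refl.
by rewrite /orient_slope /same_dir eqxx.
Qed.

Lemma new_cover_lift e : (s e)%:~R * curve_len (source new_cover) e =
  q (tgt e) - q (src e) + (winding e)%:~R * L%:num.
Proof. by rewrite mulrC /= divfK// intr_eq0 slope_neq0. Qed.

Lemma new_cover_counted (T : {set feynman_graph g}) : G \in T ->
  counted_covers p0 p T a new_cover.
Proof.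
move=> GT; have XG := realizes_new_cover; split.
- by exists G => //; exact: realizes_type XG.
- move=> P nb; have /eqP := realizes_degree XG slope_neq0 new_cover_lift nb.
  rewrite (eq_bigr (fun e => (a e)%:Z)) => [|e _]; last exact: slope_winding.
  rewrite -[X in _ == X -> _](_ : (\sum_k a k)%N%:Z = _) ?eqz_nat => [/eqP //|].
  by rewrite -natz natr_sum; apply: eq_bigr => e _; rewrite natz.
- exact: realizes_branch_points XG.
- move=> e; have := realizes_fiber_p0 p0_p XG slope_neq0 new_cover_lift e.
  by rewrite slope_winding => -[].
Qed.
End Construct.

(** * Tropical counts as counts of flows *)

Section Count.
Local Open Scope ring_scope.
Variables (R : realType) (L : {posnum R}) (g : nat).
Variables (p0 : circle L) (p : vert g -> circle L).
Hypothesis g_gt1 : (1 < g)%N.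
Hypothesis p_inj : injective p.
Hypothesis p0_p : forall i, p i <> p0.
Variables (T : {set feynman_graph g}) (a : exponent g).
Hypothesis T_sep : forall G G' : feynman_graph g, G \in T -> G' \in T ->
  same_graph (val G) (val G') -> G = G'.

Definition pos_flows (x : feynman_graph g * {perm vert g}) : set {ffun edge g -> int} :=
  flow_valid (val x.1) (pos_up p0 p (val x.1) x.2) a.

Definition valid_data : set (feynman_graph g * {perm vert g} * {ffun edge g -> int}) :=
  [set d | d.1.1 \in T /\ pos_flows d.1 d.2].

Lemma finite_pos_flows x : finite_set (pos_flows x).
Proof.
case: x => G sigma; have /and3P[tri _ _] := valP G.
have [loop|no_loop] := boolP (has_loop (val G)).
  rewrite (_ : pos_flows _ = set0)// -subset0 => s [bal ok] /=.
  by move: loop; rewrite (balanced_no_loop tri _ bal)// => e; have /and3P[] := ok e.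
apply: (@finite_flow_valid _ _ _ _ (fun v => - vertex_pos p0 p sigma v)) => e.
  rewrite eqr_opp; apply: contraNneq no_loop => /(vertex_pos_inj p_inj) h.
  by apply/fintype.existsP; exists e; apply/eqP.
by rewrite ltrN2.
Qed.

Lemma finite_valid_data : finite_set valid_data.
Proof.
apply: (@sub_finite_set _ _ (\bigcup_(x in [set: feynman_graph g * {perm vert g}]) (pair x @` pos_flows x))).
  by move=> [x s] [_ /= h]; exists x => //; exists s.
apply: bigcup_finite; first exact: finite_finset.
by move=> x _; apply: finite_image; exact: finite_pos_flows.
Qed.

Lemma valid_slope_neq0 d : valid_data d -> forall e, d.2 e != 0.
Proof. by move=> [_ [_ ok]] e; have /and3P[] := ok e. Qed.

Lemma valid_data_cover d : valid_data d -> exists2 X : labeled_cover L g,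
  counted_covers p0 p T a X & realizes p X d.1.1 d.1.2 d.2.
Proof.
move=> [GT [bal ok]].
exists (new_cover g_gt1 p_inj p0_p bal ok); first exact: new_cover_counted.
exact: realizes_new_cover.
Qed.

(** There are as many vertices as branch points, so the vertices map bijectively
    to the [p i]. A cover contracting an edge has multiplicity zero and does not
    contribute to the count. *)
Lemma cover_valid_data X : counted_covers p0 p T a X -> cover_mult X <> 0%N ->
  exists2 d, valid_data d & realizes p X d.1.1 d.1.2 d.2.
Proof.
move=> [[G GT XG] deg br fib] mult.
have /choice[h hh] v : exists i, cover_map (underlying_cover X) (inl v) = p i.
  have : branch_points (underlying_cover X) (cover_map (underlying_cover X) (inl v)) by exists v.
  by rewrite br => -[i _ <-]; exists i.
have /choice[k hk] i : exists v, h v = i.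
  have : range p (p i) by exists i.
  by rewrite -br => -[v _]; rewrite hh => /p_inj; exists v.
have h_inj : injective h := can_inj (canF_sym hk).
pose s := [ffun e => orient_slope (underlying_cover X) (val G) e].
have XR : realizes p X G (perm h_inj) s.
  by split=> // [v|e]; [rewrite hh permE|rewrite ffunE].
exists (G, perm h_inj, s) => //.
have s0 e : s e != 0.
  have : weight (underlying_cover X) e != 0%N.
    apply/negP => /eqP w0; apply: mult; rewrite /cover_mult (bigD1 e)//= w0 mul0n//.
  by rewrite (realizes_weight XR) absz_eq0.
split=> //=; split; first exact: realizes_balanced XR.
exact: (realizes_valid p0_p XR s0 fib).
Qed.

(** Isomorphism classes of nonzero multiplicity correspond bijectively to valid
    data: surjectivity is [cover_valid_data] with [realizes_unique], injectivity
    is [realizes_iso_inj], and every datum is realized by a cover. *)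
Lemma trop_count_data : trop_count p0 p T a =
  (\sum_(d <- fset_set valid_data) \prod_e `|d.2 e|)%N.
Proof.
have /choice[Phi hPhi] d : exists K, valid_data d -> exists X : labeled_cover L g,
    [/\ K = iso_class X, counted_covers p0 p T a X & realizes p X d.1.1 d.1.2 d.2].
  have [vd|nd] := pselect (valid_data d); last by exists set0.
  by have [X cX rX] := valid_data_cover vd; exists (iso_class X) => _; exists X.
have mult d X : valid_data d -> realizes p X d.1.1 d.1.2 d.2 -> cover_mult X = (\prod_e `|d.2 e|)%N.
  by move=> vd rX; apply: eq_bigr => e _; rewrite (realizes_weight rX).
rewrite /trop_count fsbig_supp.
rewrite (@reindex_fsbig _ _ _ _ _ Phi valid_data); last first.
  split.
  - move=> d vd /=; have [X [-> cX rX]] := hPhi d vd; split; first by exists X.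
    rewrite /= class_mult_iso_class (mult d)// => /eqP; apply/negP.
    by rewrite -lt0n prodn_gt0// => e; rewrite absz_gt0 valid_slope_neq0.
  - move=> d d'; rewrite !in_setE => vd vd' e.
    have [X [eX cX rX]] := hPhi d vd; have [Y [eY cY rY]] := hPhi d' vd'.
    have XY : cover_iso X Y by apply: iso_class_inj; rewrite -eX -eY.
    have := realizes_iso_inj p0 p_inj rX rY (valid_slope_neq0 vd) (T_sep (proj1 vd) (proj1 vd')) XY.
    case: d vd {eX rX e} => [[G sig] s] vd; case: d' vd' {eY rY} => [[G' sig'] s'] vd' /= [-> -> ss].
    by congr (_, _); apply/ffunP.
  - move=> K [[X cX <-]] /=; rewrite class_mult_iso_class => m0.
    have [d vd rd] := cover_valid_data cX m0; exists d => //.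
    have [Y [-> cY rY]] := hPhi d vd; apply: iso_class_eq.
    have [_ _ _ fX] := cX; have [_ _ _ fY] := cY.
    exact: (realizes_unique p0_p (valid_slope_neq0 vd) rY rd fY fX).
rewrite fsbig_finite; last exact: finite_valid_data.
rewrite big_seq [RHS]big_seq; apply: eq_bigr => d.
rewrite in_fset_set; last exact: finite_valid_data.
move=> /set_mem vd; have [X [-> cX rX]] := hPhi d vd.
by rewrite class_mult_iso_class (mult d).
Qed.

Lemma sum_valid_data : (\sum_(d <- fset_set valid_data) \prod_e `|d.2 e|)%N =
  (\sum_(G in T) \sum_sigma flow_count (val G) (pos_up p0 p (val G) sigma) a)%N.
Proof.
rewrite (partition_big fst xpredT)//=.
rewrite pair_big_dep/= [RHS]big_mkcond/=; apply: eq_bigr => -[G sigma] _ /=.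
rewrite andbT; case: ifPn => GT; last first.
  rewrite big_seq_cond big1// => d; rewrite in_fset_set; last exact: finite_valid_data.
  by move=> /andP[/set_mem[dT _]] /eqP e; rewrite e (negPf GT) in dT.
have mem d : (d \in fset_set valid_data) = (d \in valid_data).
  by rewrite in_fset_set//; exact: finite_valid_data.
have mem' s : (s \in fset_set (pos_flows (G, sigma))) = (s \in pos_flows (G, sigma)).
  by rewrite in_fset_set//; exact: finite_pos_flows.
rewrite /flow_count -/(pos_flows (G, sigma)) -big_filter.
rewrite (perm_big [seq ((G, sigma), s) | s <- fset_set (pos_flows (G, sigma))]) ?big_map//.
apply: uniq_perm; first by rewrite filter_uniq// fset_uniq.
  by rewrite map_inj_uniq ?fset_uniq// => s s' [].
move=> [x s]; rewrite mem_filter mem /=; apply/andP/mapP => [[/eqP -> /set_mem[_ /= h]]|].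
  by exists s; rewrite // mem'; exact: mem_set.
by move=> [s']; rewrite mem' => /set_mem h [-> ->]; rewrite eqxx; split=> //; exact/mem_set.
Qed.

(** The ranks are taken by decreasing [f]: without winding, an edge of positive
    slope goes from lower to higher positions on the circle, whereas in the
    expansion of the propagator it goes from higher to lower heights. *)
Lemma rank_perm (f : vert g -> R) : injective f ->
  exists rho : {perm vert g}, forall i j, (rho i < rho j)%N = (f j < f i).
Proof.
move=> f_inj; pose above i := [set j | f i < f j]%SET.
have lt_card i : (#|above i| < 2 * g - 2)%N.
  have : above i \proper [set: vert g]%SET by apply/properP; split; [exact: finset.subsetT|exists i; rewrite ?inE ?ltxx].
  by move=> /proper_card; rewrite cardsT card_ord.
pose r i : vert g := Ordinal (lt_card i).
have r_lt i j : f j < f i -> (r i < r j)%N.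
  move=> ji; apply: proper_card; apply/properP; split.
    by apply/fintype.subsetP => k; rewrite !inE; exact: lt_trans.
  by exists i; rewrite !inE ?ltxx.
have r_lt' i j : (r i < r j)%N = (f j < f i).
  apply/idP/idP; last exact: r_lt.
  apply: contraTT; rewrite -leNgt -leqNgt le_eqVlt => /orP[/eqP/f_inj -> //|/r_lt/ltnW//].
have r_inj : injective r.
  move=> i j e; apply: f_inj; apply/eqP; rewrite eq_le !leNgt -!r_lt' e ltnn//.
by exists (perm r_inj) => i j; rewrite !permE.
Qed.

(** As [sigma] runs through all permutations, so does the order of the vertices
    by their positions. *)
Lemma sum_pos_order (G : feynman_graph g) :
  (\sum_sigma flow_count (val G) (pos_up p0 p (val G) sigma) a =
   \sum_Omega flow_count (val G) (order_up (val G) Omega) a)%N.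
Proof.
have f_inj : injective (fun i => circle_pos p0 (p i)) by move=> i j /circle_pos_inj/p_inj.
have [rho hrho] := rank_perm f_inj.
rewrite [RHS](reindex_inj (mulIg rho)); apply: eq_bigr => sigma _.
by congr flow_count; apply/funext => e; rewrite /pos_up /order_up !permM hrho.
Qed.

Theorem trop_count_flows : trop_count p0 p T a =
  (\sum_(G in T) \sum_Omega flow_count (val G) (order_up (val G) Omega) a)%N.
Proof.
by rewrite trop_count_data sum_valid_data; apply: eq_bigr => G _; exact: sum_pos_order.
Qed.
End Count.

(** * Comparison of the two expansions *)

Section Main.
Variables (R : realType) (g : nat).

Lemma graph_iso_same (V E : finType) (G H : multigraph V E) : same_graph G H -> graph_iso G H.
Proof. by move=> GH; exists 1%g, 1%g => e; rewrite !perm1 -surjective_pairing. Qed.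

(** Graphs that differ by the directions of their edges only are isomorphic, so at
    most one of them is a representative. *)
Lemma representatives_separated (T : {set feynman_graph g}) : feynman_representatives T ->
  forall G G' : feynman_graph g, G \in T -> G' \in T ->
    same_graph (val G) (val G') -> G = G'.
Proof.
move=> T_rep G G' GT GT' /graph_iso_same GG'; have [H [_ uniH]] := T_rep G.
have GG : graph_iso (val G) (val G) by apply: graph_iso_same => e; rewrite /same_ends eqxx.
by rewrite -(uniH G (conj GT GG)) -(uniH G' (conj GT' GG')).
Qed.

Lemma even_series_twice (N : exponent g -> nat) a : even_series R N (twice a) = (N a)%:R.
Proof.
rewrite /even_series; case: ifPn => [_|/negP[]].
  by congr (N _)%:R; apply/ffunP => k; rewrite !ffunE mul2n doubleK.
by apply/fintype.forallP => k; rewrite ffunE mul2n odd_double.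
Qed.

Lemma even_series_sum (I : finType) (P : pred I) (N : I -> exponent g -> nat) b :
  even_series R (fun a => \sum_(i | P i) N i a)%N b = \sum_(i | P i) even_series R (N i) b.
Proof. by rewrite /even_series; case: ifP => _; [rewrite natr_sum|rewrite big1]. Qed.

End Main.

Theorem theorem2p20 (R : realType) (g : nat) (g_gt1 : (1 < g)%N)
    (L : {posnum R}) (p0 : circle L) (p : vert g -> circle L)
    (p_inj : injective p) (p0_p : forall i, p i <> p0)
    (T : {set feynman_graph g}) (T_rep : feynman_representatives T) :
  expands_to (fun tau Y => \sum_(G in T) feynman_integral G tau Y)
    (even_series R (trop_count p0 p T))
  /\
  (forall G : feynman_graph g,
     (exists c : power_series R g, expands_to (feynman_integral G) c) /\
     (forall c : power_series R g, expands_to (feynman_integral G) c ->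
        forall a : exponent g,
          c (twice a) = (trop_count p0 p [set G]%SET a)%:R)).
Proof.
split=> [|G].
  move=> tau Y tau_gt0 adm.
  have count : trop_count p0 p T = (fun a => \sum_(G in T) \sum_Omega
      flow_count (val G) (order_up (val G) Omega) a)%N.
    by apply/funext => a; exact: trop_count_flows (representatives_separated T_rep).
  rewrite count.
  have sums := @has_sum_big R (exponent g) (feynman_graph g) (index_enum _) (mem T) _ _
    (fun G _ => @feynman_integral_series R g G tau Y tau_gt0 adm).
  by apply: eq_has_sum sums => b; rewrite even_series_sum mulr_suml.
have series := @feynman_integral_series R g G.
split; first by exists (even_series R (fun a => \sum_Omega flow_count (val G) (order_up (val G) Omega) a)%N).
move=> c /expands_to_unique/(_ series) -> a; rewrite even_series_twice trop_count_flows//.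
  by rewrite big_set1.
by move=> G1 G2; rewrite !inE => /eqP -> /eqP ->.
Qed.
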